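(* (I) Let $b$ be a non vanishing vector field at least in $C^2_\sharp(Y_2)^2$ admitting an invariant probability measure $\sigma(x)\,dx$ where $\sigma$ is a positive function at least in $C^5_\sharp(Y_2)$, such that $$\overline{\sigma b}\ \text{ is incommensurable in }\mathbb{R}^2\quad\text{and}\quad\text{the ratio}\ \ \frac{\overline{\sigma b_1}}{\overline{\sigma b_2}}\ \ \text{is a Diophantine number}.$$ Then, provided that $b$ and $\sigma$ are regular enough, the flow $X$ associated with $b$ satisfies the fine asymptotic expansion $$\forall\,t\ge 0,\ \forall\,x\in\mathbb{R}^2,\quad X(t,x)=x+t\,\overline{\sigma b}+O(1),$$ where $O(1)$ is a vector-valued function which is bounded uniformly with respect to $t$ and $x$. (II) Let $\xi=(\xi_1,\xi_2)$ be a unit vector of $\mathbb{R}^2$ such that $\xi_1/\xi_2$ is a Liouville number. Then there exists a positive function $a\in C^\infty_\sharp(Y_2)$ such that the Stepanoff flow $X$ associated with the vector field $b=a\,\xi$ does not satisfy the fine asymptotic expansion; that is, there is no $\mathbb{Z}^2$-periodic vector-valued function $\zeta$ such that $X(t,x)=x+t\,\zeta(x)+O(1)$ for all $t\ge 0$ and all $x\in\mathbb{R}^2$, with $O(1)$ bounded uniformly with respect to $t$ and $x$.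
   Context: $Y_2=\mathbb{R}^2/\mathbb{Z}^2$. $C^k_\sharp(Y_2)$ denotes the space of $\mathbb{Z}^2$-periodic real functions in $C^k(\mathbb{R}^2)$. For $b=(b_1,b_2)\in C^1_\sharp(Y_2)^2$, the flow $X$ associated with $b$ is the solution of $\frac{\partial X}{\partial t}(t,x)=b(X(t,x))$, $X(0,x)=x$, for $x\in\mathbb{R}^2$; it induces a flow on $Y_2$, and a probability measure $\mu$ on $Y_2$ is invariant for $X$ if $\mu\circ X(t,\cdot)=\mu$ for any $t\ge 0$; ''admitting an invariant probability measure'' means invariant for the flow $X$. A Stepanoff flow is a flow associated with a vector field of the form $a\,\xi$ with $a$ a periodic scalar function and $\xi$ a fixed vector. $\overline{f}:=\int_{Y_2}f(x)\,dx$ is the mean value of a $\mathbb{Z}^2$-periodic scalar- or vector-valued function $f$. A vector $v\in\mathbb{R}^2$ is incommensurable if $v\cdot k\ne 0$ for all $k\in\mathbb{Z}^2\setminus\{0\}$. A Diophantine number is an irrational real number $\lambda$ for which there exists $m\in\mathbb{N}$ such that the set of pairs $(p,q)\in\mathbb{Z}\times\mathbb{N}$, $q\ge1$, with $|\lambda-p/q|\le q^{-m}$ is finite. A Liouville number is an irrational number $\lambda$ such that for any $n\in\mathbb{N}$ there are integers $p_n,q_n$ with $q_n>1$ and $0<|\lambda-p_n/q_n|<(q_n)^{-n}$. *)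

(* Defs.v *)
From HB Require Import structures.
From mathcomp Require Import all_boot all_order all_algebra.
From mathcomp Require Import all_classical all_reals all_analysis.
Set Implicit Arguments.
Unset Strict Implicit.
Unset Printing Implicit Defensive.
Import Order.TTheory GRing.Theory Num.Theory.
Import numFieldNormedType.Exports.
Local Open Scope classical_set_scope.
Local Open Scope ring_scope.

(* The plane is R * R (with the max norm). Functions on the
   torus Y_2 = R^2/Z^2 are Z^2-periodic functions on the plane, and Borel sets
   of Y_2 are Z^2-periodic Borel sets of the plane. *)

Section TorusFlows.
Variable R : realType.
Implicit Types (f sigma : R * R -> R) (b : R * R -> R * R)
  (X : R -> R * R -> R * R) (A : set (R * R)) (k : int * int).

Definition lattice k : R * R := (k.1%:~R, k.2%:~R).

Definition Z2periodic (T : Type) (f : R * R -> T) :=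
  forall x k, f (x + lattice k) = f x.

(* All iterated partial derivatives of order <= n exist and are continuous. *)
Fixpoint classC (n : nat) f : Prop :=
  continuous f /\
  if n is n'.+1 then
    [/\ forall x, derivable f x (1, 0), forall x, derivable f x (0, 1),
        classC n' (fun x => 'D_(1, 0) f x) & classC n' (fun x => 'D_(0, 1) f x)]
  else True.

Definition Csharp (n : nat) f := classC n f /\ Z2periodic f.

Definition Csharp_infty f := forall n, Csharp n f.

Definition Csharp2 (n : nat) b :=
  Csharp n (fun x => (b x).1) /\ Csharp n (fun x => (b x).2).

Definition unit_square : set (R * R) := `[0, 1[ `*` `[0, 1[.

Definition mean f : R :=
  \int[(@lebesgue_measure R \x @lebesgue_measure R)%E]_(x in unit_square) f x.

Definition mean2 b : R * R := (mean (fun x => (b x).1), mean (fun x => (b x).2)).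

(* The flow of a C^1 periodic field is complete, so time ranges over R. *)
Definition is_flow b X :=
  forall x, X 0 x = x /\
    forall t : R, is_derive t 1 (fun s : R => X s x) (b (X t x)).

(* The measure sigma(x) dx on Y_2, computed on the fundamental domain; it is
   meaningful on Z^2-periodic sets. *)
Definition torus_measure sigma A : \bar R :=
  (\int[(@lebesgue_measure R \x @lebesgue_measure R)%E]_(x in unit_square `&` A)
     (sigma x)%:E)%E.

Definition torus_measurable A :=
  measurable A /\ forall x k, A (x + lattice k) <-> A x.

Definition torus_probability sigma := torus_measure sigma setT = 1%E.

Definition invariant_density X sigma :=
  forall (t : R) A, 0 <= t -> torus_measurable A ->
    torus_measure sigma (X t @` A) = torus_measure sigma A.

Definition incommensurable (v : R * R) :=
  forall k, k != 0 -> v.1 * k.1%:~R + v.2 * k.2%:~R != 0.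

Definition diophantine (lambda : R) :=
  irrational lambda /\
  exists m : nat, finite_set
    [set pq : int * nat | (1 <= pq.2)%N /\
       `|lambda - pq.1%:~R / pq.2%:R| <= pq.2%:R ^- m].

Definition liouville (lambda : R) :=
  irrational lambda /\
  forall n : nat, exists p q : int,
    1 < q /\ 0 < `|lambda - p%:~R / q%:~R| < q%:~R ^- n.

(* X(t,x) = x + t zeta(x) + O(1), uniformly in t >= 0 and x *)
Definition fine_expansion X (zeta : R * R -> R * R) :=
  exists C : R, forall (t : R) (x : R * R), 0 <= t ->
    `|X t x - (x + t *: zeta x)| <= C.

End TorusFlows.

(* Main.v *)
Require Import Defs.
From HB Require Import structures.
From mathcomp Require Import all_boot all_order all_algebra.
From mathcomp Require Import all_classical all_reals all_analysis.
From mathcomp Require Import measurable_realfun.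
From mathcomp Require Import ring lra.
Import Order.TTheory GRing.Theory Num.Theory.
Import numFieldNormedType.Exports.
Set Implicit Arguments.
Unset Strict Implicit.
Unset Printing Implicit Defensive.
Local Open Scope classical_set_scope.
Local Open Scope ring_scope.

(** Part (I).  Write c for the mean of sigma b.  Invariance of sigma(x)dx makes
    sigma b divergence free, so sigma b is, up to a quarter turn, the gradient of
    a stream function psi that is periodic up to the linear form of direction
    (-c.2, c.1) ([stream_function]).  As psi is constant along orbits, the
    displacement X(t,x) - x stays bounded in the direction orthogonal to c, and
    what remains is to compare its component along c with t |c|^2.

    The first step straightens the flow.  A level set of psi is connected, being
    the image of a line under a continuous retraction ([retract]), and orbits are
    open in it ([flow_box]); hence it is a single orbit ([level_orbit]).  The
    level sets run to infinity along c, so no orbit is periodic, and compactness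
    gives one time T after which every orbit has advanced by at least 1 along c,
    or every orbit along -c ([flow_drift]).  Averaging the linear form of
    direction c along the orbit segments of length T then yields a function h,
    affine modulo periodic functions, that increases along the flow.  The flow is
    replaced there by its Euler scheme, whose maps are visibly as smooth as b
    ([transversal_function]).  From psi and h one builds a pair Phi = (P1, P2)
    with Phi(x + k) = Phi(x) + k, injective, and with derivative kappa c along b
    for some kappa > 0: in the coordinates Phi the orbits are straight lines of
    direction c, run through at speed kappa |c|.

    It remains to show that the clock c.Phi/|c|^2, whose derivative along b is
    kappa, advances by t + O(1).  This asks for a bounded corrector W with
    derivative 1 - kappa along b, that is, for a solution of the cohomological
    equation of the linear flow with right-hand side 1/kappa - 1.  The Fourier
    coefficients of 1/kappa in the coordinates Phi are the means of
    sigma cos(2 pi j.Phi) and sigma sin(2 pi j.Phi); they decay fast by repeated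
    integration by parts ([fourier_decay]), and the Diophantine condition bounds
    the divisors c.j from below by a power of |j| ([diophantine_bound]).  To avoid
    inverting Phi and proving convergence of Fourier series, the coefficients are
    combined with Fejer weights.  The Fejer kernel is positive and the mean of
    kappa sigma against it is computed by orthogonality, because derivatives along
    b have mean zero against sigma; so the Fejer means of 1/kappa converge
    uniformly, by Korovkin's argument ([smoothed_approx]), while the
    corresponding correctors are bounded independently of the order
    ([corrector_bound]).  Given t, an order large enough for that t gives a bound
    that does not depend on t ([clock_flow]).

    Part (II).  Let q, p be approximants of xi_1/xi_2 of rapidly growing quality,
    k = (q, -p), and w = k.xi, which is tiny compared with any power of 1/q.  Take
    1/a = 1 + sum of e sgn(w) sin(2 pi k.x) with weights e = q^-(n+2): they decay
    fast enough for a to be smooth, but e/|w| is unbounded.  Orbits are lines, and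
    the time needed to travel the distance s from the origin is s + G(s), where
    G(s) is the sum of the nonnegative terms e (1 - cos(2 pi w s)) / (2 pi |w|).
    Each term is bounded and at most e s, so G(s) = o(s) and the rotation vector
    at 0, if there is one, is xi; but then G would be bounded, whereas its n-th
    term reaches e/(pi |w|) at s = 1/(2|w|) ([stepanoff_no_expansion]). *)

(** * Calculus in the plane *)

Section Calculus.
Variable R : realType.
Implicit Types (f g : R * R -> R) (x y : R * R) (e : R).

(** This form lets derivatives be computed by explicit remainder estimates. *)
Lemma is_derive_epsP (f : R -> R) (t l : R) :
  is_derive t 1 f l <->
  (forall e, 0 < e -> exists2 d, 0 < d &
     forall h, `|h| < d -> `|f (t + h) - f t - h * l| <= e * `|h|).
Proof.
split=> [[df <-] e e0|H].
  have /cvgrPdist_le/(_ _ e0) := df.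
  rewrite near_withinE /= => -[d /= d0 Hd]; exists d => // h hd.
  have [->|h0] := eqVneq h 0; first by rewrite addr0 subrr mul0r subr0 normr0 mulr0.
  have := Hd h; rewrite /= sub0r normrN => /(_ hd h0).
  move=> H1; rewrite -[f (t + h) - _ - _]opprK normrN.
  rewrite (_ : - (f (t + h) - f t - h * 'D_1 f t) = h * ('D_1 f t - h^-1 *: (f (h *: 1 + t) - f t))).
    by rewrite normrM mulrC ler_wpM2r.
  by rewrite /GRing.scale /= mulr1 [h + t]addrC; field.
have cv : h^-1 *: (f (h *: (1:R) + t) - f t) @[h --> 0^'] --> l.
  apply/cvgrPdist_le => e e0; have [d d0 Hd] := H _ e0.
  rewrite near_withinE /=; exists d => // h; rewrite /= sub0r normrN => hd h0.
  rewrite (_ : l - _ = - (h^-1 * (f (t + h) - f t - h * l))).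
    by rewrite normrN normrM normfV mulrC ler_pdivrMr ?normr_gt0 // Hd.
  by rewrite /GRing.scale /= mulr1 [h + t]addrC; field.
by split; [apply/cvg_ex; exists l | apply/cvg_lim].
Qed.

Lemma continuous_epsP (U V : normedModType R) (f : U -> V) (x : U) :
  {for x, continuous f} <->
  (forall e, 0 < e -> exists2 d, 0 < d & forall y : U, `|y - x| < d -> `|f y - f x| < e).
Proof.
split=> [/cvgrPdist_lt H e e0|H].
  have /nbhs_ballP[d /= d0 Hd] := H _ e0; exists d => // y yx.
  by rewrite distrC; apply: Hd; rewrite -ball_normE /ball_ /= distrC.
apply/cvgrPdist_lt => e e0; have [d d0 Hd] := H _ e0.
apply/nbhs_ballP; exists d => //= y; rewrite -ball_normE /ball_ /= distrC => yx.
by rewrite distrC; exact: Hd.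
Qed.

Lemma norm2_le x e : (`|x| <= e) = (`|x.1| <= e) && (`|x.2| <= e).
Proof. by rewrite prod_normE ge_max. Qed.

Lemma norm2_lt x e : (`|x| < e) = (`|x.1| < e) && (`|x.2| < e).
Proof. by rewrite prod_normE gt_max. Qed.

Lemma shift_e1 h x : (h *: (1 : R) + x.1, x.2) = h *: ((1, 0) : R * R) + x.
Proof. by case: x => a b; congr pair; rewrite /= scaler0 add0r. Qed.

Lemma shift_e2 h x : (x.1, h *: (1 : R) + x.2) = h *: ((0, 1) : R * R) + x.
Proof. by case: x => a b; congr pair; rewrite /= scaler0 add0r. Qed.

Lemma derive_slice1 f x : derivable f x (1, 0) ->
  is_derive x.1 1 (fun s => f (s, x.2)) ('D_(1, 0) f x).
Proof.
move=> df; have E : (fun h : R => h^-1 *: (((fun s => f (s, x.2)) \o shift x.1) (h *: 1) - f (x.1, x.2)))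
   = (fun h => h^-1 *: ((f \o shift x) (h *: (1, 0)) - f x)).
  apply/funext => h /=; congr (_ *: (f _ - f _)); last by case: x {df}.
  exact: shift_e1.
by split; rewrite /derivable /derive E.
Qed.

Lemma derive_slice2 f x : derivable f x (0, 1) ->
  is_derive x.2 1 (fun s => f (x.1, s)) ('D_(0, 1) f x).
Proof.
move=> df; have E : (fun h : R => h^-1 *: (((fun s => f (x.1, s)) \o shift x.2) (h *: 1) - f (x.1, x.2)))
   = (fun h => h^-1 *: ((f \o shift x) (h *: (0, 1)) - f x)).
  apply/funext => h /=; congr (_ *: (f _ - f _)); last by case: x {df}.
  exact: shift_e2.
by split; rewrite /derivable /derive E.
Qed.

Lemma slice1_derive f x l : is_derive x.1 1 (fun s => f (s, x.2)) l ->
  is_derive x (1, 0) f l.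
Proof.
move=> [df dl]; have E : (fun h : R => h^-1 *: (((fun s => f (s, x.2)) \o shift x.1) (h *: 1) - f (x.1, x.2)))
   = (fun h => h^-1 *: ((f \o shift x) (h *: (1, 0)) - f x)).
  apply/funext => h /=; congr (_ *: (f _ - f _)); last by case: x {df dl}.
  exact: shift_e1.
by split; rewrite /derivable /derive -E.
Qed.

Lemma slice2_derive f x l : is_derive x.2 1 (fun s => f (x.1, s)) l ->
  is_derive x (0, 1) f l.
Proof.
move=> [df dl]; have E : (fun h : R => h^-1 *: (((fun s => f (x.1, s)) \o shift x.2) (h *: 1) - f (x.1, x.2)))
   = (fun h => h^-1 *: ((f \o shift x) (h *: (0, 1)) - f x)).
  apply/funext => h /=; congr (_ *: (f _ - f _)); last by case: x {df dl}.
  exact: shift_e2.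
by split; rewrite /derivable /derive -E.
Qed.

(** The end points may come in either order; the location of c is recorded as a
    distance, which is the form in which it is used. *)
Lemma MVT_any (f df : R -> R) (a b : R) :
  (forall z : R, is_derive z 1 f (df z)) ->
  exists2 c, `|c - a| <= `|b - a| & f b - f a = df c * (b - a).
Proof.
move=> H; have cf : continuous f.
  by move=> z; apply: differentiable_continuous; apply/derivable1_diffP; case: (H z).
have [ab|/ltW ba] := leP a b.
  have [c] := MVT_segment ab (fun z _ => H z) (continuous_subspaceT cf).
  rewrite in_itv /= => /andP[ac cb] ->; exists c => //.
  by rewrite !ger0_norm ?subr_ge0 // lerD2r.
have [c] := MVT_segment ba (fun z _ => H z) (continuous_subspaceT cf).
rewrite in_itv /= => /andP[bc ca] E; exists c => //.
  by rewrite !ler0_norm ?subr_le0 // lerN2 lerD2r.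
by rewrite -opprB E -mulrN opprB.
Qed.

Definition C1 f := [/\ continuous f, forall x, derivable f x (1, 0),
  forall x, derivable f x (0, 1),
  continuous (fun x => 'D_(1, 0) f x) & continuous (fun x => 'D_(0, 1) f x)].

Lemma classC_cont n f : classC n f -> continuous f.
Proof. by case: n => [|n] []. Qed.

Lemma classC_C1 n f : classC n.+1 f -> C1 f.
Proof.
move=> [cf [d1 d2 H1 H2]].
exact: (And5 cf d1 d2 (classC_cont H1) (classC_cont H2)).
Qed.

(** Moving from x to y along two segments parallel to the axes needs only the
    partial derivatives, at the price of two intermediate points. *)
Lemma mean_value2 f x y : (forall x, derivable f x (1, 0)) -> (forall x, derivable f x (0, 1)) ->
  exists p q, [/\ `|p - x| <= `|y - x|, `|q - x| <= `|y - x| &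
    f y - f x = 'D_(1, 0) f p * (y.1 - x.1) + 'D_(0, 1) f q * (y.2 - x.2)].
Proof.
move=> d1 d2.
have [c Hc Ec] := @MVT_any (fun s => f (s, y.2)) (fun s => 'D_(1, 0) f (s, y.2)) x.1 y.1
  (fun s => @derive_slice1 f (s, y.2) (d1 _)).
have [d Hd Ed] := @MVT_any (fun s => f (x.1, s)) (fun s => 'D_(0, 1) f (x.1, s)) x.2 y.2
  (fun s => @derive_slice2 f (x.1, s) (d2 _)).
have /andP[n1 n2] : (`|(y - x).1| <= `|y - x|) && (`|(y - x).2| <= `|y - x|).
  by rewrite -norm2_le.
exists (c, y.2), (x.1, d); split.
- by rewrite norm2_le /= (le_trans Hc).
- by rewrite norm2_le /= subrr normr0 normr_ge0 (le_trans Hd).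
by rewrite -Ec -Ed; case: x y {d1 d2 c Hc Ec d Hd Ed n1 n2} => x1 x2 [y1 y2] /=; ring.
Qed.

Lemma is_derive_continuous (f : R -> R) (t l : R) : is_derive t 1 f l -> {for t, continuous f}.
Proof. by move=> [df _]; apply: differentiable_continuous; apply/derivable1_diffP. Qed.

Lemma normrM_le (a b A B : R) : `|a| <= A -> `|b| <= B -> `|a * b| <= A * B.
Proof. by move=> aA bB; rewrite normrM ler_pM. Qed.

(** Follows from [mean_value2] and continuity of the partial derivatives, without
    going through a total differential. *)
Lemma chain_rule2 f (g1 g2 : R -> R) (t v1 v2 : R) : C1 f ->
  is_derive t 1 g1 v1 -> is_derive t 1 g2 v2 ->
  is_derive t 1 (fun s => f (g1 s, g2 s))
    ('D_(1, 0) f (g1 t, g2 t) * v1 + 'D_(0, 1) f (g1 t, g2 t) * v2).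
Proof.
move=> [_ d1 d2 c1 c2] D1 D2; apply/is_derive_epsP => e e0.
set x := (g1 t, g2 t); set A := 'D_(1, 0) f x; set B := 'D_(0, 1) f x.
pose K := `|A| + `|B| + `|v1| + `|v2| + 3.
have K0 : 0 < K by rewrite ltr_wpDl // !addr_ge0.
have K1 z : z <= 1 -> z + `|v1| <= K.
  by move=> z1; rewrite /K; move: (normr_ge0 A) (normr_ge0 B) (normr_ge0 v2) z1;
     move: (`|A|) (`|B|) (`|v1|) (`|v2|) => *; lra.
have K2 z : z <= 1 -> z + `|v2| <= K.
  by move=> z1; rewrite /K; move: (normr_ge0 A) (normr_ge0 B) (normr_ge0 v1) z1;
     move: (`|A|) (`|B|) (`|v1|) (`|v2|) => *; lra.
(* there are four error terms, each bounded by K e' times the increment *)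
pose e' := Num.min 1 (e / (4 * K)).
have e'0 : 0 < e' by rewrite lt_min ltr01 divr_gt0 // mulr_gt0.
have e'1 : e' <= 1 by rewrite ge_min lexx.
have e'e : 4 * K * e' <= e.
  rewrite mulrC -ler_pdivlMr ?mulr_gt0 //; by rewrite ge_min lexx orbT.
have /continuous_epsP/(_ _ e'0)[r1 r10 H1] := c1 x.
have /continuous_epsP/(_ _ e'0)[r2 r20 H2] := c2 x.
have /is_derive_epsP/(_ _ e'0)[s1 s10 S1] := D1.
have /is_derive_epsP/(_ _ e'0)[s2 s20 S2] := D2.
pose r := Num.min r1 r2 / K.
have r0 : 0 < r by rewrite divr_gt0 // lt_min r10.
exists (Num.min r (Num.min s1 s2)); first by rewrite !lt_min r0 s10.
move=> h; rewrite !lt_min => /and3P[hr hs1 hs2].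
have {S1} T1 := S1 _ hs1; have {S2} T2 := S2 _ hs2.
have B1 : `|g1 (t + h) - g1 t| <= K * `|h|.
  rewrite -[X in `|X|](subrK (h * v1)) (le_trans (ler_normD _ _)) //.
  rewrite (le_trans (lerD T1 (lexx _))) // normrM [`|h| * _]mulrC -mulrDl.
  by rewrite ler_wpM2r // K1.
have B2 : `|g2 (t + h) - g2 t| <= K * `|h|.
  rewrite -[X in `|X|](subrK (h * v2)) (le_trans (ler_normD _ _)) //.
  rewrite (le_trans (lerD T2 (lexx _))) // normrM [`|h| * _]mulrC -mulrDl.
  by rewrite ler_wpM2r // K2.
change (`|f (g1 (t + h), g2 (t + h)) - f x - h * (A * v1 + B * v2)| <= e * `|h|).
have [p [q [Hp Hq ->]]] := mean_value2 x (g1 (t + h), g2 (t + h)) d1 d2.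
rewrite /=.
have Bx : `|(g1 (t + h), g2 (t + h)) - x| <= K * `|h| by rewrite norm2_le /= B1 B2.
have Kh : K * `|h| < Num.min r1 r2 by rewrite mulrC -ltr_pdivlMr.
have Kh1 : K * `|h| < r1 by rewrite (lt_le_trans Kh) // ge_min lexx.
have Kh2 : K * `|h| < r2 by rewrite (lt_le_trans Kh) // ge_min lexx orbT.
have {}H1 := ltW (H1 p (le_lt_trans (le_trans Hp Bx) Kh1)).
have {}H2 := ltW (H2 q (le_lt_trans (le_trans Hq Bx) Kh2)).
rewrite -/A in H1; rewrite -/B in H2.
set P := 'D_(1, 0) f p in H1 *; set Q := 'D_(0, 1) f q in H2 *.
rewrite (_ : _ - _ = (P - A) * (g1 (t + h) - g1 t) + A * (g1 (t + h) - g1 t - h * v1)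
  + ((Q - B) * (g2 (t + h) - g2 t) + B * (g2 (t + h) - g2 t - h * v2))); last ring.
have AK : `|A| <= K by rewrite /K -!addrA lerDl !addr_ge0.
have BK : `|B| <= K by rewrite /K [`|A| + _]addrC -!addrA lerDl !addr_ge0.
have b1 := normrM_le H1 B1; have b2 := normrM_le H2 B2.
have b3 := normrM_le AK T1; have b4 := normrM_le BK T2.
rewrite [K * (e' * _)]mulrCA in b3; rewrite [K * (e' * _)]mulrCA in b4.
apply: (le_trans (ler_normD _ _)).
apply: (le_trans (lerD (ler_normD _ _) (ler_normD _ _))).
apply: (le_trans (lerD (lerD b1 b3) (lerD b2 b4))).
rewrite (_ : _ + _ = 4 * K * e' * `|h|); last by move: (`|h|) => z; ring.
by rewrite ler_wpM2r.
Qed.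

End Calculus.

(** * Functions with continuous partial derivatives, and periodicity *)

Section Smooth.
Variable R : realType.
Implicit Types (f g : R * R -> R) (x y : R * R) (e : R) (k : int * int).

(** Induction on the order of smoothness supplies the partial derivatives in closed
    form, so they are given here as functions f1, f2. *)
Lemma classC_intro n f f1 f2 : continuous f ->
  (forall x, is_derive x (1, 0) f (f1 x)) -> (forall x, is_derive x (0, 1) f (f2 x)) ->
  classC n f1 -> classC n f2 -> classC n.+1 f.
Proof.
move=> cf D1 D2 H1 H2; split=> //; split.
- by move=> x; case: (D1 x).
- by move=> x; case: (D2 x).
- by rewrite (_ : (fun _ => _) = f1) //; apply/funext => x; case: (D1 x).
- by rewrite (_ : (fun _ => _) = f2) //; apply/funext => x; case: (D2 x).
Qed.

Lemma classC_derive1 n f x : classC n.+1 f -> is_derive x (1, 0) f ('D_(1, 0) f x).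
Proof. by move=> [_ [d _ _ _]]; exact: derivableP. Qed.

Lemma classC_derive2 n f x : classC n.+1 f -> is_derive x (0, 1) f ('D_(0, 1) f x).
Proof. by move=> [_ [_ d _ _]]; exact: derivableP. Qed.

Lemma classC_slice1 n f (x : R * R) : classC n.+1 f -> is_derive x.1 1 (fun s => f (s, x.2)) ('D_(1, 0) f x).
Proof. by move=> [_ [d _ _ _]]; exact: derive_slice1. Qed.

Lemma classC_slice2 n f (x : R * R) : classC n.+1 f -> is_derive x.2 1 (fun s => f (x.1, s)) ('D_(0, 1) f x).
Proof. by move=> [_ [_ d _ _]]; exact: derive_slice2. Qed.

Lemma classC_d1 n f : classC n.+1 f -> classC n (fun x => 'D_(1, 0) f x).
Proof. by move=> [_ [_ _ d _]]. Qed.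

Lemma classC_d2 n f : classC n.+1 f -> classC n (fun x => 'D_(0, 1) f x).
Proof. by move=> [_ [_ _ _ d]]. Qed.

Lemma classCW n f : classC n.+1 f -> classC n f.
Proof.
elim: n f => [|n IH] f [cf [D1 D2 H1 H2]]; first exact: (conj cf I).
exact: (conj cf (And4 D1 D2 (IH _ H1) (IH _ H2))).
Qed.

Lemma classC_le m n f : (m <= n)%N -> classC n f -> classC m f.
Proof.
move=> /subnK <-; elim: (n - m)%N => // p IH; rewrite addSn => /classCW; exact: IH.
Qed.

Lemma classC_cst n (c : R) : classC n (fun=> c).
Proof.
elim: n c => [|n IH] c; first by split=> // x; exact: cvg_cst.
apply: (@classC_intro _ _ (fun=> 0) (fun=> 0)); rewrite ?IH //; first by move=> x; exact: cvg_cst.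
all: by move=> x; exact: is_derive_cst.
Qed.

Lemma classC_fst n : classC n (fun x : R * R => x.1).
Proof.
have c1 : continuous (fun x : R * R => x.1) by move=> x; exact: cvg_fst.
case: n => // n.
apply: (@classC_intro _ _ (fun=> 1) (fun=> 0)) => //; try exact: classC_cst.
- by move=> x; apply: slice1_derive; exact: is_derive_id.
- by move=> x; apply: slice2_derive; exact: is_derive_cst.
Qed.

Lemma classC_snd n : classC n (fun x : R * R => x.2).
Proof.
have c1 : continuous (fun x : R * R => x.2) by move=> x; exact: cvg_snd.
case: n => // n.
apply: (@classC_intro _ _ (fun=> 0) (fun=> 1)) => //; try exact: classC_cst.
- by move=> x; apply: slice1_derive; exact: is_derive_cst.
- by move=> x; apply: slice2_derive; exact: is_derive_id.
Qed.

Lemma classCD n f g : classC n f -> classC n g -> classC n (fun x => f x + g x).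
Proof.
elim: n f g => [|n IH] f g Hf Hg.
  by split=> // x; apply: cvgD; [exact: (classC_cont Hf)|exact: (classC_cont Hg)].
apply: (@classC_intro _ _ (fun x => 'D_(1, 0) f x + 'D_(1, 0) g x)
                          (fun x => 'D_(0, 1) f x + 'D_(0, 1) g x)).
- by move=> x; apply: cvgD; [exact: (classC_cont Hf)|exact: (classC_cont Hg)].
- by move=> x; apply: is_deriveD; apply: classC_derive1; eassumption.
- by move=> x; apply: is_deriveD; apply: classC_derive2; eassumption.
- by apply: IH; exact: classC_d1.
- by apply: IH; exact: classC_d2.
Qed.

Lemma classCM n f g : classC n f -> classC n g -> classC n (fun x => f x * g x).
Proof.
elim: n f g => [|n IH] f g Hf Hg.
  by split=> // x; apply: cvgM; [exact: (classC_cont Hf)|exact: (classC_cont Hg)].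
apply: (@classC_intro _ _ (fun x => f x * 'D_(1, 0) g x + g x * 'D_(1, 0) f x)
                          (fun x => f x * 'D_(0, 1) g x + g x * 'D_(0, 1) f x)).
- by move=> x; apply: cvgM; [exact: (classC_cont Hf)|exact: (classC_cont Hg)].
- by move=> x; apply: is_deriveM; apply: classC_derive1; eassumption.
- by move=> x; apply: is_deriveM; apply: classC_derive2; eassumption.
- by apply: classCD; apply: IH; by [exact: classCW|exact: classC_d1].
- by apply: classCD; apply: IH; by [exact: classCW|exact: classC_d2].
Qed.

Lemma classCZ n (c : R) f : classC n f -> classC n (fun x => c * f x).
Proof. by move=> Hf; apply: classCM => //; exact: classC_cst. Qed.

Lemma classCN n f : classC n f -> classC n (fun x => - f x).
Proof.
by move=> /(classCZ (-1)); rewrite (_ : (fun _ => _) = (fun x => - f x)) //;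
  apply/funext => x; rewrite mulN1r.
Qed.

Lemma classCB n f g : classC n f -> classC n g -> classC n (fun x => f x - g x).
Proof. by move=> Hf Hg; apply: classCD => //; exact: classCN. Qed.

Lemma classCV n f : (forall x, f x != 0) -> classC n f -> classC n (fun x => (f x)^-1).
Proof.
move=> f0; elim: n => [|n IH] Hf.
  by split=> // x; apply: cvgV; [exact: f0|exact: (classC_cont Hf)].
have IH' := IH (classCW Hf).
apply: (@classC_intro _ _ (fun x => - ((f x)^-1 * (f x)^-1) * 'D_(1, 0) f x)
                          (fun x => - ((f x)^-1 * (f x)^-1) * 'D_(0, 1) f x)).
- by move=> x; apply: cvgV; [exact: f0|exact: (classC_cont Hf)].
- move=> x; apply: slice1_derive.
  have := @is_deriveV R (fun s => f (s, x.2)) x.1 _ 1 (f0 _) (classC_slice1 x Hf).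
  by rewrite /= -surjective_pairing expr2 invfM.
- move=> x; apply: slice2_derive.
  have := @is_deriveV R (fun s => f (x.1, s)) x.2 _ 1 (f0 _) (classC_slice2 x Hf).
  by rewrite /= -surjective_pairing expr2 invfM.
- by apply: classCM; [apply: classCN; exact: classCM|exact: classC_d1].
- by apply: classCM; [apply: classCN; exact: classCM|exact: classC_d2].
Qed.

Lemma classC_cos_sin n f : classC n f ->
  classC n (fun x => cos (f x)) /\ classC n (fun x => sin (f x)).
Proof.
elim: n => [|n IH] Hf.
  by split; split=> // x; apply: continuous_comp; [exact: (classC_cont Hf)|
   exact: continuous_cos|exact: (classC_cont Hf)|exact: continuous_sin].
have [IHc IHs] := IH (classCW Hf).
have cc : continuous (fun x => cos (f x)).
  by move=> x; apply: continuous_comp; [exact: (classC_cont Hf)|exact: continuous_cos].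
have cs : continuous (fun x => sin (f x)).
  by move=> x; apply: continuous_comp; [exact: (classC_cont Hf)|exact: continuous_sin].
split.
- apply: (@classC_intro _ _ (fun x => - sin (f x) * 'D_(1, 0) f x)
                          (fun x => - sin (f x) * 'D_(0, 1) f x)) => //.
  + move=> x; apply: slice1_derive.
    have := @is_derive1_comp R cos (fun s => f (s, x.2)) x.1 _ _ (is_derive_cos _) (classC_slice1 x Hf).
    by rewrite /= -surjective_pairing.
  + move=> x; apply: slice2_derive.
    have := @is_derive1_comp R cos (fun s => f (x.1, s)) x.2 _ _ (is_derive_cos _) (classC_slice2 x Hf).
    by rewrite /= -surjective_pairing.
  + by apply: classCM; [exact: classCN|exact: classC_d1].
  + by apply: classCM; [exact: classCN|exact: classC_d2].
- apply: (@classC_intro _ _ (fun x => cos (f x) * 'D_(1, 0) f x)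
                          (fun x => cos (f x) * 'D_(0, 1) f x)) => //.
  + move=> x; apply: slice1_derive.
    have := @is_derive1_comp R sin (fun s => f (s, x.2)) x.1 _ _ (is_derive_sin _) (classC_slice1 x Hf).
    by rewrite /= -surjective_pairing.
  + move=> x; apply: slice2_derive.
    have := @is_derive1_comp R sin (fun s => f (x.1, s)) x.2 _ _ (is_derive_sin _) (classC_slice2 x Hf).
    by rewrite /= -surjective_pairing.
  + by apply: classCM => //; exact: classC_d1.
  + by apply: classCM => //; exact: classC_d2.
Qed.

Lemma continuous_pair (T : topologicalType) (g1 g2 : T -> R) :
  continuous g1 -> continuous g2 -> continuous (fun x : T => (g1 x, g2 x)).
Proof. by move=> c1 c2 x; exact: (cvg_pair (c1 x) (c2 x)). Qed.

Lemma continuous_comp2 (T : topologicalType) f (g1 g2 : T -> R) : continuous f ->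
  continuous g1 -> continuous g2 -> continuous (fun x : T => f (g1 x, g2 x)).
Proof.
move=> cf c1 c2 x; apply: (@continuous_comp _ _ _ (fun x : T => (g1 x, g2 x)) f).
  exact: (continuous_pair c1 c2).
exact: cf.
Qed.

Lemma is_derive_comp1 n f g1 g2 x : classC n.+1 f -> classC n.+1 g1 -> classC n.+1 g2 ->
  is_derive x (1, 0) (fun x => f (g1 x, g2 x))
   ('D_(1, 0) f (g1 x, g2 x) * 'D_(1, 0) g1 x + 'D_(0, 1) f (g1 x, g2 x) * 'D_(1, 0) g2 x).
Proof.
move=> Hf H1 H2; apply: slice1_derive.
by have := chain_rule2 (classC_C1 Hf) (classC_slice1 x H1) (classC_slice1 x H2); rewrite -!surjective_pairing.
Qed.

Lemma is_derive_comp2 n f g1 g2 x : classC n.+1 f -> classC n.+1 g1 -> classC n.+1 g2 ->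
  is_derive x (0, 1) (fun x => f (g1 x, g2 x))
   ('D_(1, 0) f (g1 x, g2 x) * 'D_(0, 1) g1 x + 'D_(0, 1) f (g1 x, g2 x) * 'D_(0, 1) g2 x).
Proof.
move=> Hf H1 H2; apply: slice2_derive.
by have := chain_rule2 (classC_C1 Hf) (classC_slice2 x H1) (classC_slice2 x H2); rewrite -!surjective_pairing.
Qed.

Lemma classC_comp n f g1 g2 : classC n f -> classC n g1 -> classC n g2 ->
  classC n (fun x => f (g1 x, g2 x)).
Proof.
elim: n f => [|n IH] f Hf H1 H2.
  exact: (conj (continuous_comp2 (classC_cont Hf) (classC_cont H1) (classC_cont H2)) I).
apply: (classC_intro _ (fun x => is_derive_comp1 x Hf H1 H2) (fun x => is_derive_comp2 x Hf H1 H2)).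
- exact: (continuous_comp2 (classC_cont Hf) (classC_cont H1) (classC_cont H2)).
- exact: (classCD (classCM (IH _ (classC_d1 Hf) (classCW H1) (classCW H2)) (classC_d1 H1))
    (classCM (IH _ (classC_d2 Hf) (classCW H1) (classCW H2)) (classC_d1 H2))).
- exact: (classCD (classCM (IH _ (classC_d1 Hf) (classCW H1) (classCW H2)) (classC_d2 H1))
    (classCM (IH _ (classC_d2 Hf) (classCW H1) (classCW H2)) (classC_d2 H2))).
Qed.

Lemma periodic_derive f v : Z2periodic f -> Z2periodic (fun x => 'D_v f x).
Proof.
move=> pf x k; have E : (fun h : R => h^-1 *: ((f \o shift (x + lattice R k)) (h *: v)
      - f (x + lattice R k))) = (fun h => h^-1 *: ((f \o shift x) (h *: v) - f x)).
  by apply/funext => h /=; rewrite addrA !pf.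
by rewrite /derive E.
Qed.

Lemma lattice_reduce x : exists k, unit_square (x + lattice R k).
Proof.
exists (- Num.floor x.1, - Num.floor x.2); split; rewrite /= in_itv /= mulrNz subr_ge0.
  by rewrite Num.Theory.ge_floor ltrBlDr addrC -intrD1 Num.Theory.floorD1_gt.
by rewrite Num.Theory.ge_floor ltrBlDr addrC -intrD1 Num.Theory.floorD1_gt.
Qed.

(** The compact set on which all periodic functions are controlled. *)
Let closed_square : set (R * R) := `[0, 1] `*` `[0, 1].

Lemma closed_square_reduce x : exists k, closed_square (x + lattice R k).
Proof.
have [k [/= k1 k2]] := lattice_reduce x; exists k; split=> /=.
  by move: k1; rewrite !in_itv /= => /andP[-> /ltW].
by move: k2; rewrite !in_itv /= => /andP[-> /ltW].
Qed.

Lemma closed_square_compact : compact closed_square.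
Proof. by apply: compact_setX; exact: segment_compact. Qed.

Lemma periodic_max f : continuous f -> Z2periodic f -> exists x0, forall x, f x <= f x0.
Proof.
move=> cf pf; have [||x0 _ H] := @compact_EVT_max _ _ f closed_square _ closed_square_compact.
- by exists (0, 0); split; rewrite /= in_itv /= lexx ler01.
- exact: continuous_subspaceT.
exists x0 => x; have [k xk] := closed_square_reduce x; rewrite -(pf x k); apply: H.
by rewrite inE.
Qed.

Lemma periodic_bounded f : continuous f -> Z2periodic f ->
  exists2 M, 0 <= M & forall x, `|f x| <= M.
Proof.
move=> cf pf; have [||x0 H] := @periodic_max (fun x => `|f x|).
- by move=> x; apply: cvg_norm; exact: cf.
- by move=> x k; rewrite pf.
by exists `|f x0|.
Qed.

Lemma periodic_pos f : continuous f -> Z2periodic f -> (forall x, 0 < f x) ->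
  exists2 m, 0 < m & forall x, m <= f x.
Proof.
move=> cf pf f0; have [||x0 H] := @periodic_max (fun x => - f x).
- by move=> x; apply: cvgN; exact: cf.
- by move=> x k; rewrite pf.
by exists (f x0) => // x; rewrite -lerN2.
Qed.

Definition Lip (V : normedModType R) (f : R * R -> V) :=
  exists2 K, 0 <= K & forall x y, `|f y - f x| <= K * `|y - x|.

Lemma C1_Lip f M : (forall x, derivable f x (1, 0)) -> (forall x, derivable f x (0, 1)) ->
  (forall x, `|'D_(1, 0) f x| <= M) -> (forall x, `|'D_(0, 1) f x| <= M) ->
  forall x y, `|f y - f x| <= 2 * M * `|y - x|.
Proof.
move=> d1 d2 b1 b2 x y; have [p [q [_ _ ->]]] := mean_value2 x y d1 d2.
have /andP[n1 n2] : (`|(y - x).1| <= `|y - x|) && (`|(y - x).2| <= `|y - x|).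
  by rewrite -norm2_le.
rewrite (le_trans (ler_normD _ _)) // (le_trans (lerD (normrM_le (b1 _) n1) (normrM_le (b2 _) n2))) //.
by rewrite -mulrA mulr_natl.
Qed.

Lemma periodic_Lip n f : classC n.+1 f -> Z2periodic f -> Lip f.
Proof.
move=> Hf pf.
have [M M0 HM] := periodic_bounded (classC_cont (classC_d1 Hf)) (periodic_derive (1, 0) pf).
have [N N0 HN] := periodic_bounded (classC_cont (classC_d2 Hf)) (periodic_derive (0, 1) pf).
exists (2 * (M + N)); first by rewrite mulr_ge0 // addr_ge0.
case: Hf => _ [d1 d2 _ _]; apply: (C1_Lip d1 d2) => x.
  by rewrite (le_trans (HM x)) // lerDl.
by rewrite (le_trans (HN x)) // lerDr.
Qed.

Definition grad f x (v : R * R) := 'D_(1, 0) f x * v.1 + 'D_(0, 1) f x * v.2.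

Lemma norm_fst (x : R * R) : `|x.1| <= `|x|.
Proof. by have := lexx `|x|; rewrite {1}norm2_le => /andP[]. Qed.

Lemma norm_snd (x : R * R) : `|x.2| <= `|x|.
Proof. by have := lexx `|x|; rewrite {1}norm2_le => /andP[]. Qed.

Lemma Taylor_Lip f : (forall x, derivable f x (1, 0)) -> (forall x, derivable f x (0, 1)) ->
  Lip (fun x => 'D_(1, 0) f x) -> Lip (fun x => 'D_(0, 1) f x) ->
  exists2 K, 0 <= K & forall x y, `|f y - f x - grad f x (y - x)| <= K * `|y - x| ^+ 2.
Proof.
move=> d1 d2 [K1 K10 L1] [K2 K20 L2]; exists (K1 + K2); first exact: addr_ge0.
move=> x y; have [p [q [Hp Hq ->]]] := mean_value2 x y d1 d2.
rewrite /grad /= (_ : _ - _ = ('D_(1, 0) f p - 'D_(1, 0) f x) * (y - x).1 +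
   ('D_(0, 1) f q - 'D_(0, 1) f x) * (y - x).2); last by rewrite /=; ring.
have A1 := le_trans (L1 x p) (ler_wpM2l K10 Hp).
have A2 := le_trans (L2 x q) (ler_wpM2l K20 Hq).
rewrite (le_trans (ler_normD _ _)) //.
rewrite (le_trans (lerD (normrM_le A1 (norm_fst _)) (normrM_le A2 (norm_snd _)))) //.
by rewrite expr2 -!mulrA -mulrDl.
Qed.

End Smooth.

(** * Flows of Lipschitz fields *)

Section FlowTheory.
Variable R : realType.
Implicit Types (x y : R * R) (t s e : R) (k : int * int).

Lemma is_derive_fst (g : R -> R * R) t v : is_derive t 1 g v ->
  is_derive t 1 (fun s => (g s).1) v.1.
Proof.
move=> [dg <-].
have c : ((h^-1 *: (g (h *: (1 : R) + t) - g t)).1 @[h --> 0^']) --> ('D_1 g t).1.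
  exact: (cvg_comp _ _ dg (@classC_cont _ 0 _ (classC_fst R 0) _)).
by split; [apply/cvg_ex; exists ('D_1 g t).1 | apply/cvg_lim].
Qed.

Lemma is_derive_snd (g : R -> R * R) t v : is_derive t 1 g v ->
  is_derive t 1 (fun s => (g s).2) v.2.
Proof.
move=> [dg <-].
have c : ((h^-1 *: (g (h *: (1 : R) + t) - g t)).2 @[h --> 0^']) --> ('D_1 g t).2.
  exact: (cvg_comp _ _ dg (@classC_cont _ 0 _ (classC_snd R 0) _)).
by split; [apply/cvg_ex; exists ('D_1 g t).2 | apply/cvg_lim].
Qed.

Lemma is_derive_pair (g : R -> R * R) t (v : R * R) :
  is_derive t 1 (fun s => (g s).1) v.1 -> is_derive t 1 (fun s => (g s).2) v.2 ->
  is_derive t 1 g v.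
Proof.
case: v => v1 v2 /= [d1 e1] [d2 e2].
have c : (h^-1 *: (g (h *: (1 : R) + t) - g t) @[h --> 0^']) --> (v1, v2).
  rewrite -e1 -e2; rewrite (_ : (fun h => _) = (fun h : R =>
    (h^-1 *: ((g (h *: (1 : R) + t)).1 - (g t).1), h^-1 *: ((g (h *: (1 : R) + t)).2 - (g t).2)))).
    exact: (cvg_pair d1 d2).
  by apply/funext => h.
by split; [apply/cvg_ex; exists (v1, v2) | apply/cvg_lim].
Qed.

Lemma is_derive_shift (V : normedModType R) (g : R -> V) (a t : R) v : is_derive (t + a) 1 g v ->
  is_derive t 1 (fun s => g (s + a)) v.
Proof.
move=> [dg <-]; have E : (fun h : R => h^-1 *: (((fun s => g (s + a)) \o shift t) (h *: 1) - g (t + a)))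
  = (fun h : R => h^-1 *: ((g \o shift (t + a)) (h *: 1) - g (t + a))).
  by apply/funext => h /=; rewrite addrA.
by split; rewrite /derivable /derive E.
Qed.

Lemma is_derive_trans (V : normedModType R) (g : R -> V) (a : V) t v : is_derive t 1 g v ->
  is_derive t 1 (fun s => g s + a) v.
Proof.
move=> [dg <-]; have E : (fun h : R => h^-1 *: (((fun s => g s + a) \o shift t) (h *: 1) - (g t + a)))
  = (fun h : R => h^-1 *: ((g \o shift t) (h *: 1) - g t)).
  by apply/funext => h /=; rewrite opprD addrACA subrr addr0.
by split; rewrite /derivable /derive E.
Qed.

Lemma is_derive_lin (c t : R) : is_derive t 1 (fun s => c * s) c.
Proof.
apply/is_derive_epsP => e e0; exists 1 => // h _.
by rewrite (_ : _ - _ - _ = 0) ?normr0 ?mulr_ge0 // ?ltW //; ring.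
Qed.

Lemma Gronwall_pos (E dE : R -> R) (C t : R) : (forall s, is_derive s 1 E (dE s)) ->
  (forall s, dE s <= C * E s) -> 0 <= t -> E t <= expR (C * t) * E 0.
Proof.
move=> HE HC t0.
pose F s := E s * expR (- C * s).
have DF s : is_derive s 1 F (E s * (expR (- C * s) * - C) + expR (- C * s) * dE s).
  apply: is_deriveM.
  exact: (@is_derive1_comp R expR (fun s => - C * s) s _ _ (is_derive_expR _)
    (is_derive_lin _ _)).
have [c _] := MVT_any 0 t DF; rewrite subr0 => EF.
have : F t <= F 0.
  rewrite -subr_le0 EF mulr_le0_ge0 //.
  rewrite (_ : _ + _ = expR (- C * c) * (dE c - C * E c)); last by ring.
  by rewrite mulr_ge0_le0 ?expR_ge0 // subr_le0.
rewrite /F mulr0 expR0 mulr1 mulNr expRN ler_pdivrMr ?expR_gt0 //.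
by rewrite mulrC.
Qed.

(** The bound holds for both signs of t because it constrains the absolute value of
    the derivative. *)
Lemma Gronwall (E dE : R -> R) (C t : R) : (forall s, is_derive s 1 E (dE s)) ->
  (forall s, `|dE s| <= C * E s) -> E t <= expR (C * `|t|) * E 0.
Proof.
move=> HE HC; have [t0|t0] := leP 0 t.
  rewrite ger0_norm //; apply: (Gronwall_pos HE) => // s.
  by rewrite (le_trans (ler_norm _)).
rewrite ltr0_norm //.
have := @Gronwall_pos (fun s => E (- s)) (fun s => - dE (- s)) C (- t).
rewrite opprK oppr0; apply.
- move=> s.
  have := @is_derive1_comp R E (fun s => - s) s _ _ (HE _) (is_deriveN (is_derive_id s 1)).
  by rewrite mulrN1.
- by move=> s; rewrite (le_trans (ler_norm _)) // normrN.
- by rewrite oppr_ge0 ltW.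
Qed.

Section Flow.
Variables (b : R * R -> R * R) (X : R -> R * R -> R * R) (K B : R).
Hypothesis K0 : 0 <= K.
Hypothesis LK : forall x y, `|b y - b x| <= K * `|y - x|.
Hypothesis pb : Z2periodic b.
Hypothesis HB : forall x, `|b x| <= B.
Hypothesis HX : is_flow b X.

Definition is_sol (y : R -> R * R) := forall t, is_derive t 1 y (b (y t)).

Lemma flow_sol x : is_sol (fun t => X t x).
Proof. by move=> t; have [_] := HX x. Qed.

Lemma flow0 x : X 0 x = x.
Proof. by have [] := HX x. Qed.

(** Gronwall applied to the squared Euclidean distance, since the max norm is not
    differentiable; the factor 2 is the cost of going back to the max norm. *)
Lemma sol_dist (y z : R -> R * R) t : is_sol y -> is_sol z ->
  `|y t - z t| <= 2 * expR (2 * K * `|t|) * `|y 0 - z 0|.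
Proof.
move=> Hy Hz; pose u s := y s - z s.
pose E s := (u s).1 * (u s).1 + (u s).2 * (u s).2.
pose d s := b (y s) - b (z s).
pose dE s := ((u s).1 * (d s).1 + (u s).1 * (d s).1) + ((u s).2 * (d s).2 + (u s).2 * (d s).2).
have HE s : is_derive s 1 E (dE s).
  have D1 : is_derive s 1 (fun s => (u s).1) (d s).1.
    by apply: is_deriveB; apply: is_derive_fst.
  have D2 : is_derive s 1 (fun s => (u s).2) (d s).2.
    by apply: is_deriveB; apply: is_derive_snd.
  by apply: is_deriveD; apply: is_deriveM.
have modeE s : `|u s| ^+ 2 <= E s.
  rewrite {1}prod_normE /E -!expr2 -[(u s).1 ^+ 2]real_normK ?num_real //.
  rewrite -[(u s).2 ^+ 2]real_normK ?num_real // /Num.max.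
  by case: ifP => _; rewrite (lerDl, lerDr) sqr_ge0.
have HC s : `|dE s| <= 4 * K * E s.
  have d1 : `|d s| <= K * `|u s| by exact: LK.
  have n1 := normrM_le (norm_fst (u s)) (le_trans (norm_fst (d s)) d1).
  have n2 := normrM_le (norm_snd (u s)) (le_trans (norm_snd (d s)) d1).
  rewrite (le_trans (ler_normD _ _)) //.
  rewrite (le_trans (lerD (ler_normD _ _) (ler_normD _ _))) //.
  rewrite (le_trans (lerD (lerD n1 n1) (lerD n2 n2))) //.
  rewrite (_ : _ + _ = 4 * K * `|u s| ^+ 2); last by move: (`|u s|) => w; ring.
  by rewrite ler_wpM2l // mulr_ge0.
have := Gronwall t HE HC => G.
have E0 : E 0 <= 2 * `|u 0| ^+ 2.
  rewrite /E -!expr2 -[(u 0).1 ^+ 2]real_normK ?num_real //.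
  rewrite -[(u 0).2 ^+ 2]real_normK ?num_real // mulr_natl mulr2n.
  by rewrite lerD // lerXn2r ?nnegrE ?normr_ge0 ?norm_fst ?norm_snd.
rewrite -(@ler_pXn2r _ 2) ?nnegrE ?normr_ge0 ?mulr_ge0 ?expR_ge0 ?normr_ge0 //.
rewrite (le_trans (modeE t)) // (le_trans G) // !exprMn -expRM_natl.
rewrite (_ : 2%:R * (2 * K * `|t|) = 4 * K * `|t|); last by ring.
apply: (le_trans (ler_wpM2l (expR_ge0 _) E0)).
have : 0 <= expR (4 * K * `|t|) * `|u 0| ^+ 2 by rewrite mulr_ge0 ?expR_ge0 ?sqr_ge0. change (y 0 - z 0) with (u 0); move: (expR _ : R) (`|u 0| ^+ 2 : R) => p q pq.
by rewrite [p * _]mulrCA -[2 ^+ 2 * p * q]mulrA ler_wpM2r // expr2; lra.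
Qed.

Lemma sol_unique (y z : R -> R * R) t : is_sol y -> is_sol z -> y 0 = z 0 -> y t = z t.
Proof.
move=> Hy Hz yz; apply/eqP; rewrite -subr_eq0 -normr_le0.
by rewrite (le_trans (sol_dist t Hy Hz)) // yz subrr normr0 mulr0.
Qed.

Lemma flow_lip t x y : `|X t x - X t y| <= 2 * expR (2 * K * `|t|) * `|x - y|.
Proof.
by have := sol_dist t (flow_sol x) (flow_sol y); rewrite !flow0.
Qed.

Lemma flowD s t x : X (s + t) x = X s (X t x).
Proof.
apply: (@sol_unique (fun s => X (s + t) x) (fun s => X s (X t x))).
- by move=> r; exact: (is_derive_shift (flow_sol x (r + t))).
- exact: flow_sol.
- by rewrite add0r flow0.
Qed.

Lemma flowK t x : X (- t) (X t x) = x.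
Proof. by rewrite -flowD addNr flow0. Qed.

Lemma flowNK t x : X t (X (- t) x) = x.
Proof. by rewrite -flowD subrr flow0. Qed.

(** Both sides solve the same equation with the same initial value. *)
Lemma flow_lattice t x k : X t (x + lattice R k) = X t x + lattice R k.
Proof.
apply: (@sol_unique (fun t => X t (x + lattice R k)) (fun t => X t x + lattice R k)).
- exact: flow_sol.
- by move=> r; rewrite pb; exact: (is_derive_trans _ (flow_sol x r)).
- by rewrite !flow0.
Qed.

Lemma flow_speed s t x : `|X s x - X t x| <= B * `|s - t|.
Proof.
have [c _ E1] := MVT_any t s (fun r => is_derive_fst (flow_sol x r)).
have [d _ E2] := MVT_any t s (fun r => is_derive_snd (flow_sol x r)).
rewrite norm2_le /= E1 E2 !normrM !ler_wpM2r ?normr_ge0 //.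
  exact: le_trans (norm_snd _) (HB _).
exact: le_trans (norm_fst _) (HB _).
Qed.

Lemma flow_continuous t : continuous (X t).
Proof.
move=> x; apply/continuous_epsP => e e0.
have L0 : 0 < 2 * expR (2 * K * `|t|) by rewrite mulr_gt0 // expR_gt0.
exists (e / (2 * expR (2 * K * `|t|))); first by rewrite divr_gt0.
move=> y; rewrite ltr_pdivlMr // mulrC => h; exact: le_lt_trans (flow_lip _ _ _) h.
Qed.

Lemma flow_path (f : R * R -> R) x t : C1 f ->
  is_derive t 1 (fun s => f (X s x)) (grad f (X t x) (b (X t x))).
Proof.
move=> Hf; have := chain_rule2 Hf (is_derive_fst (flow_sol x t)) (is_derive_snd (flow_sol x t)).
rewrite -surjective_pairing (_ : (fun s => _) = (fun s => f (X s x))) //.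
by apply/funext => s; rewrite -surjective_pairing.
Qed.

End Flow.
End FlowTheory.

(** * Means over the torus *)

Section Mean.
Variable R : realType.
Implicit Types (f g : R * R -> R) (x y : R * R) (t s e : R) (k : int * int).
Local Notation mu2 := (@lebesgue_measure R \x @lebesgue_measure R)%E.
Local Notation sq := (@unit_square R).

(** An open set is a countable union of squares with rational centres, hence lies in
    the product sigma-algebra. *)
Lemma open_measurable_plane (U : set (R * R)) : open U -> measurable U.
Proof.
move=> oU.
pose I (q : rat) (n : nat) : set R := ball (ratr q : R) n.+1%:R^-1.
pose G p q n := if `[< I p n `*` I q n `<=` U >] then I p n `*` I q n else set0.
have -> : U = \bigcup_p \bigcup_q \bigcup_n G p q n.
  apply/seteqP; split=> [x Ux|x [p _ [q _ [n _]]]]; last first.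
    by rewrite /G; case: ifPn => // /asboolP; exact.
  have [r /= r0 Hr] : exists2 r, 0 < r & ball x r `<=` U by apply/nbhs_ballP; exact: oU.
  have [n nr] : exists n : nat, n.+1%:R^-1 < r / 2.
    have [n _ /(_ _ (leqnn _))] := near_infty_natSinv_lt (PosNum (divr_gt0 r0 (ltr0Sn R 1))).
    by exists n.
  have nr2 : n.+1%:R^-1 + n.+1%:R^-1 < r by move: nr; move: (n.+1%:R^-1) => z; lra.
  have n0 : 0 < n.+1%:R^-1 :> R by rewrite invr_gt0.
  have [|p] := @rat_in_itvoo R (x.1 - n.+1%:R^-1) (x.1 + n.+1%:R^-1).
    by rewrite ltrD2l (lt_trans _ n0) // oppr_lt0.
  rewrite in_itv /= => /andP[p1 p2].
  have [|q] := @rat_in_itvoo R (x.2 - n.+1%:R^-1) (x.2 + n.+1%:R^-1).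
    by rewrite ltrD2l (lt_trans _ n0) // oppr_lt0.
  rewrite in_itv /= => /andP[q1 q2].
  have px : `|ratr p - x.1| < n.+1%:R^-1 by rewrite ltr_distl p1 p2.
  have qx : `|ratr q - x.2| < n.+1%:R^-1 by rewrite ltr_distl q1 q2.
  exists p => //; exists q => //; exists n => //; rewrite /G ifT.
    by split; rewrite /I -ball_normE.
  apply/asboolP => y [y1 y2]; apply: Hr; rewrite -ball_normE /ball_ /= norm2_lt /=.
  move: y1 y2; rewrite /I -ball_normE /ball_ /= => y1 y2.
  apply/andP; split.
    rewrite -[x.1](subrK (ratr p)) -addrA (le_lt_trans (ler_normD _ _)) //.
    by rewrite distrC (lt_trans (ltrD px y1)) //.
  rewrite -[x.2](subrK (ratr q)) -addrA (le_lt_trans (ler_normD _ _)) //.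
  by rewrite distrC (lt_trans (ltrD qx y2)) //.
apply: bigcupT_measurable_rat => p; apply: bigcupT_measurable_rat => q.
apply: bigcupT_measurable => n; rewrite /G; case: ifPn => // _.
by apply: measurableX; rewrite /I ball_itv; exact: measurable_itv.
Qed.

Lemma continuous_measurable2 f : continuous f -> measurable_fun setT f.
Proof.
move=> /continuousP cf; apply: (measurability _ (@mathcomp.analysis.measurable_realfun.RGenOpens.measurableE R)).
move=> _ [_ [a [b ->] <-]]; rewrite setTI; apply: open_measurable_plane.
exact/cf/interval_open.
Qed.

Lemma measurable_unit_square : measurable sq.
Proof. by apply: measurableX; exact: measurable_itv. Qed.

Lemma measure_unit_square : mu2 sq = 1%E.
Proof.
rewrite /unit_square product_measure1E; try exact: measurable_itv.
by rewrite /= lebesgue_measure_itv /= lte01 oppr0 adde0 mule1.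
Qed.

(** On this class the mean is linear and monotone. *)
Definition bmeas f := measurable_fun setT f /\ exists M, forall x, `|f x| <= M.

Lemma bmeas_periodic f : continuous f -> Z2periodic f -> bmeas f.
Proof.
move=> cf pf; split; first exact: continuous_measurable2.
by have [M _ HM] := periodic_bounded cf pf; exists M.
Qed.

Lemma bmeas_integrable f : bmeas f -> mu2.-integrable sq (EFin \o f).
Proof.
move=> [mf [M HM]]; apply: measurable_bounded_integrable.
- exact: measurable_unit_square.
- by rewrite [X in (X < _)%E]measure_unit_square ltry.
- exact: measurable_funTS.
- exists M; split; first exact: num_real.
  by move=> z Mz x _; exact: (le_trans (HM x) (ltW Mz)).
Qed.

Lemma bmeasD f g : bmeas f -> bmeas g -> bmeas (fun x => f x + g x).
Proof.
move=> [mf [M HM]] [mg [N HN]]; split; first exact: measurable_funD.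
by exists (M + N) => x; rewrite (le_trans (ler_normD _ _)) // lerD.
Qed.

Lemma bmeasM f g : bmeas f -> bmeas g -> bmeas (fun x => f x * g x).
Proof.
move=> [mf [M HM]] [mg [N HN]]; split; first exact: measurable_funM.
by exists (M * N) => x; exact: normrM_le.
Qed.

Lemma bmeas_cst c : bmeas (fun=> c).
Proof. by split; [exact: measurable_cst|exists `|c|]. Qed.

Lemma mean_eq f g : (forall x, f x = g x) -> mean f = mean g.
Proof. by move=> fg; congr mean; exact/funext. Qed.

Lemma meanD f g : bmeas f -> bmeas g -> mean (fun x => f x + g x) = mean f + mean g.
Proof. by move=> bf bg; apply: RintegralD; [exact: measurable_unit_square|exact: bmeas_integrable|exact: bmeas_integrable]. Qed.

Lemma meanZ (c : R) f : bmeas f -> mean (fun x => c * f x) = c * mean f.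
Proof. by move=> bf; apply: RintegralZl; [exact: measurable_unit_square|exact: bmeas_integrable]. Qed.

Lemma mean_cst (c : R) : mean (fun=> c) = c.
Proof.
rewrite /mean Rintegral_cst; last exact: measurable_unit_square.
by rewrite [X in fine X]measure_unit_square /= mulr1.
Qed.

Lemma meanN f : bmeas f -> mean (fun x => - f x) = - mean f.
Proof.
by move=> bf; rewrite -mulN1r -meanZ //; apply: mean_eq => x; rewrite mulN1r.
Qed.

Lemma bmeasN f : bmeas f -> bmeas (fun x => - f x).
Proof.
move=> bf; have := bmeasM (bmeas_cst (-1)) bf; rewrite (_ : (fun _ => _) = (fun x => - f x)) //.
by apply/funext => x; rewrite mulN1r.
Qed.

Lemma meanB f g : bmeas f -> bmeas g -> mean (fun x => f x - g x) = mean f - mean g.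
Proof. by move=> bf bg; rewrite meanD ?meanN //; exact: bmeasN. Qed.

Lemma bmeas_sum (I : Type) (r : seq I) (P : pred I) (F : I -> R * R -> R) : (forall i, bmeas (F i)) ->
  bmeas (fun x => \sum_(i <- r | P i) F i x).
Proof.
move=> bF; elim: r => [|i r IH].
  rewrite (_ : (fun _ => _) = fun=> 0); first exact: bmeas_cst.
  by apply/funext => x; rewrite big_nil.
case Pi: (P i).
  rewrite (_ : (fun _ => _) = fun x => F i x + \sum_(i <- r | P i) F i x); first exact: bmeasD.
  by apply/funext => x; rewrite big_cons Pi.
rewrite (_ : (fun _ => _) = fun x => \sum_(i <- r | P i) F i x) //.
by apply/funext => x; rewrite big_cons Pi.
Qed.

Lemma mean_sum (I : Type) (r : seq I) (P : pred I) (F : I -> R * R -> R) : (forall i, bmeas (F i)) ->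
  mean (fun x => \sum_(i <- r | P i) F i x) = \sum_(i <- r | P i) mean (F i).
Proof.
move=> bF; elim: r => [|i r IH].
  by rewrite big_nil -[RHS](mean_cst 0); apply: mean_eq => x; rewrite big_nil.
rewrite big_cons; case Pi: (P i).
  rewrite -IH -meanD //; last exact: bmeas_sum.
  by apply: mean_eq => x; rewrite big_cons Pi.
by rewrite -IH; apply: mean_eq => x; rewrite big_cons Pi.
Qed.

Lemma mean_le f g : bmeas f -> bmeas g -> (forall x, f x <= g x) -> mean f <= mean g.
Proof.
by move=> bf bg fg; apply: le_Rintegral => //; [exact: measurable_unit_square|exact: bmeas_integrable|exact: bmeas_integrable].
Qed.

Lemma mean_ge0 f : (forall x, 0 <= f x) -> 0 <= mean f.
Proof. by move=> f0; apply: Rintegral_ge0. Qed.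

Lemma mean_norm f (M : R) : bmeas f -> (forall x, `|f x| <= M) -> `|mean f| <= M.
Proof.
move=> bf fM; rewrite ler_norml -[in X in X && _](mean_cst (- M)) -[in X in _ && X](mean_cst M).
by rewrite !mean_le //; try exact: bmeas_cst; move=> x; have := fM x; rewrite ler_norml => /andP[].
Qed.

Lemma bmeas_indic (A : set (R * R)) : measurable A -> bmeas (\1_A).
Proof.
move=> mA; split; first exact: measurable_indic.
by exists 1 => x; rewrite indicE; case: (_ \in _); rewrite ?normr1 // normr0.
Qed.

Lemma torus_measureE sigma A : bmeas sigma -> measurable A ->
  torus_measure sigma A = (mean (fun x => sigma x * \1_A x))%:E.
Proof.
move=> bs mA; rewrite /torus_measure /mean /Rintegral fineK.
  rewrite integral_mkcondr; apply: eq_integral => x _.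
  by rewrite /patch indicE; case: (_ \in _); rewrite ?mulr1 ?mulr0.
apply: integrable_fin_num; first exact: measurable_unit_square.
exact: (bmeas_integrable (bmeasM bs (bmeas_indic mA))).
Qed.

(** A positive value persists on a small square, which contributes to the mean. *)
Lemma mean_eq0 f : continuous f -> Z2periodic f -> (forall x, 0 <= f x) -> mean f = 0 ->
  forall x, f x = 0.
Proof.
move=> cf pf f0 mf x; apply/eqP/negPn/negP => fx.
have [k] := lattice_reduce x; rewrite -(pf x k) in fx; move: (x + _) fx => {}x fx.
move=> [/= +]; rewrite !in_itv /= => /andP[x10 x11] /andP[x20 x21].
have {}fx : 0 < f x by rewrite lt_neqAle eq_sym fx f0.
have /continuous_epsP/(_ _ (divr_gt0 fx (ltr0Sn R 1)))[d d0 Hd] := cf x.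
pose r := Num.min d (Num.min (1 - x.1) (1 - x.2)).
have r0 : 0 < r by rewrite !lt_min d0 !subr_gt0 x11.
have [rd [r1 r2]] : r <= d /\ r <= 1 - x.1 /\ r <= 1 - x.2.
  have := lexx r; rewrite {2}/r !le_min => /and3P[a b c]; by split.
pose A : set (R * R) := `[x.1, x.1 + r[ `*` `[x.2, x.2 + r[.
have mA : measurable A by apply: measurableX; exact: measurable_itv.
have H y : f x / 2 * \1_A y <= f y.
  rewrite indicE; case: (boolP (y \in A)) => /= [|_]; last by rewrite mulr0.
  rewrite inE => -[/= +]; rewrite !in_itv /= => /andP[a1 a2] /andP[b1 b2].
  have : `|f y - f x| < f x / 2.
    by apply: Hd; rewrite norm2_lt /= !ltr_norml; lra.
  rewrite mulr1 ltr_norml => /andP[+ _]; lra.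
have : f x / 2 * mean (\1_A) <= mean f.
  rewrite -meanZ; last exact: bmeas_indic.
  by apply: mean_le => //; [exact: (bmeasM (bmeas_cst _) (bmeas_indic mA))|exact: bmeas_periodic].
rewrite mf; apply/negP; rewrite -ltNge mulr_gt0 // ?divr_gt0 //.
rewrite /mean /Rintegral.
have -> : (\int[mu2]_(x0 in sq) (\1_A x0)%:E)%E = (r * r)%:E.
  rewrite integral_indic //; last exact: measurable_unit_square.
  rewrite (_ : A `&` sq = A); last first.
    apply/setIidPl => y [/= +]; rewrite !in_itv /= => /andP[a1 a2] /andP[b1 b2].
    by split; rewrite /= in_itv /=; lra.
  transitivity (mu2 (`[x.1, x.1 + r[ `*` `[x.2, x.2 + r[)); first by [].
  rewrite product_measure1E; try exact: measurable_itv.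
  rewrite /= !lebesgue_measure_itv /= !lte_fin !ltrDl r0 -!EFinD -EFinM.
  by rewrite ![_ + r - _]addrAC !subrr !add0r.
by rewrite /= mulr_gt0.
Qed.

End Mean.

(** * Means of derivatives; layer-cake approximation *)

Section Mean2.
Variable R : realType.
Implicit Types (f g : R * R -> R) (t s e : R) (k : int * int).
Local Notation mu := (@lebesgue_measure R).
Local Notation mu2 := (@lebesgue_measure R \x @lebesgue_measure R)%E.
Local Notation sq := (@unit_square R).

Lemma FTC2_derive (F f : R -> R) (a b : R) : (forall t : R, is_derive t 1 F (f t)) ->
  continuous f -> a < b -> (\int[mu]_(t in `[a, b]) (f t)%:E = (F b - F a)%:E)%E.
Proof.
move=> DF cf ab; have cF t : {for t, continuous F} := is_derive_continuous (DF t).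
rewrite (@continuous_FTC2 R f F a b ab) ?EFinB //.
- exact: continuous_subspaceT.
- split.
  + by move=> z _; case: (DF z).
  + by apply: cvg_at_right_filter; exact: cF.
  + by apply: cvg_at_left_filter; exact: cF.
- by move=> z _; rewrite derive1E; case: (DF z).
Qed.

Lemma continuous_slice1 g (y : R) : continuous g -> continuous (fun t : R => g (t, y)).
Proof.
move=> cg; apply: (@continuous_comp2 R R g (fun t => t) (fun=> y) cg) => z.
  exact: cvg_id.
exact: cvg_cst.
Qed.

Lemma continuous_slice2 g (y : R) : continuous g -> continuous (fun t : R => g (y, t)).
Proof.
move=> cg; apply: (@continuous_comp2 R R g (fun=> y) (fun t => t) cg) => z.
  exact: cvg_cst.
exact: cvg_id.
Qed.

Lemma integral_slice_derive1 n f (y : R) : classC n.+1 f -> Z2periodic f ->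
  (\int[mu]_(x in `[0%R, 1%R[) ('D_(1, 0) f (x, y))%:E = 0)%E.
Proof.
move=> Hf pf; have cg := @continuous_slice1 _ y (classC_cont (classC_d1 Hf)).
rewrite integral_itv_bndo_bndc; last first.
  by apply: measurable_funTS; apply/measurable_EFinP; exact: continuous_measurable_fun.
rewrite (@FTC2_derive (fun t => f (t, y)) _ 0 1 (fun t => classC_slice1 (t, y) Hf) cg ltr01).
rewrite (_ : (1, y) = (0, y) + lattice R (1, 0)) ?pf ?subrr //.
by congr pair; rewrite /= ?add0r ?addr0.
Qed.

Lemma mean_derive1 n f : classC n.+1 f -> Z2periodic f -> mean (fun x => 'D_(1, 0) f x) = 0.
Proof.
move=> Hf pf; have cg := classC_cont (classC_d1 Hf); set g := fun x => _ in cg *.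
have bg : bmeas g by apply: bmeas_periodic => //; exact: periodic_derive.
have ig : mu2.-integrable setT ((EFin \o g) \_ sq).
  by rewrite -integrable_mkcond; [exact: bmeas_integrable|exact: measurable_unit_square].
rewrite /mean /Rintegral integral_mkcond -(integral21_prod_meas1 ig).
rewrite (eq_integral (cst 0%E)) ?integral0 // => y _; rewrite /fubini_G.
have [y01|y01] := boolP (y \in `[0, 1[).
  rewrite -[RHS](integral_slice_derive1 y Hf pf) [RHS]integral_mkcond; apply: eq_integral => x _.
  rewrite /patch /unit_square; congr (if _ then _ else _).
  apply/idP/idP; rewrite !inE /=; first by case.
  by move=> x01; split.
rewrite (eq_integral (cst 0%E)) ?integral0 // => x _.
rewrite /patch ifF //; apply/negP; rewrite inE => -[/= h1 h2]; by rewrite h2 in y01.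
Qed.

Lemma integral_slice_derive2 n f (y : R) : classC n.+1 f -> Z2periodic f ->
  (\int[mu]_(x in `[0%R, 1%R[) ('D_(0, 1) f (y, x))%:E = 0)%E.
Proof.
move=> Hf pf; have cg := @continuous_slice2 _ y (classC_cont (classC_d2 Hf)).
rewrite integral_itv_bndo_bndc; last first.
  by apply: measurable_funTS; apply/measurable_EFinP; exact: continuous_measurable_fun.
rewrite (@FTC2_derive (fun t => f (y, t)) _ 0 1 (fun t => classC_slice2 (y, t) Hf) cg ltr01).
rewrite (_ : (y, 1) = (y, 0) + lattice R (0, 1)) ?pf ?subrr //.
by congr pair; rewrite /= ?add0r ?addr0.
Qed.

Lemma mean_derive2 n f : classC n.+1 f -> Z2periodic f -> mean (fun x => 'D_(0, 1) f x) = 0.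
Proof.
move=> Hf pf; have cg := classC_cont (classC_d2 Hf); set g := fun x => _ in cg *.
have bg : bmeas g by apply: bmeas_periodic => //; exact: periodic_derive.
have ig : mu2.-integrable setT ((EFin \o g) \_ sq).
  by rewrite -integrable_mkcond; [exact: bmeas_integrable|exact: measurable_unit_square].
rewrite /mean /Rintegral integral_mkcond -(integral12_prod_meas1 ig).
rewrite (eq_integral (cst 0%E)) ?integral0 // => y _; rewrite /fubini_F.
have [y01|y01] := boolP (y \in `[0, 1[).
  rewrite -[RHS](integral_slice_derive2 y Hf pf) [RHS]integral_mkcond; apply: eq_integral => x _.
  rewrite /patch /unit_square; congr (if _ then _ else _).
  apply/idP/idP; rewrite !inE /=; first by case.
  by move=> x01; split.
rewrite (eq_integral (cst 0%E)) ?integral0 // => x _.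
rewrite /patch ifF //; apply/negP; rewrite inE => -[/= h1 h2]; by rewrite h1 in y01.
Qed.

Lemma staircase (w : R) (N : nat) : 0 <= w <= N%:R ->
  `|\sum_(i < N) (i%:R < w)%R%:R - w| <= 1 :> R.
Proof.
elim: N w => [|N IH] w /andP[w0 wN].
  by rewrite big_ord0 (le_anti (introT andP (conj wN w0))) subrr normr0.
rewrite big_ord_recr /=; case: (ltP N%:R w) => Nw; last first.
  by rewrite addr0; apply: IH; rewrite w0.
rewrite (eq_bigr (fun=> 1)); last first.
  move=> i _; rewrite (lt_trans _ Nw) // ltr_nat //.
rewrite sumr_const card_ord /= natr1 ger0_norm ?subr_ge0 //.
by rewrite lerBlDr -natr1 addrC lerD2l ltW.
Qed.

(** Invariance of a density speaks of sets only; a continuous function is uniformly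
    approximated by sums of indicators of its open superlevel sets. *)
Lemma layer_cake g sigma (M S : R) (n : nat) : (0 < n)%N ->
  continuous g -> Z2periodic g -> bmeas sigma -> (forall x, `|g x| <= M) -> (forall x, `|sigma x| <= S) ->
  0 <= M ->
  exists N : nat, forall N', (N <= N')%N ->
  `|mean (fun x => g x * sigma x) - (- M * mean sigma + n%:R^-1 *
     \sum_(i < N') mean (fun x => sigma x * \1_[set x | i%:R < (g x + M) * n%:R] x))| <= S / n%:R.
Proof.
move=> n0 cg pg bs gM sS M0.
have n0' : 0 < n%:R :> R by rewrite ltr0n.
have [N HN] : exists N : nat, 2 * M * n%:R <= N%:R.
  by exists (Num.bound (2 * M * n%:R)); rewrite ltW // archi_boundP // !mulr_ge0 // ler0n.
exists N => N' NN'.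
have bA i : bmeas (\1_[set x : R * R | i%:R < (g x + M) * n%:R] : R * R -> R).
  apply: bmeas_indic; rewrite (_ : [set _ | _] = [set x | i%:R / n%:R - M < g x]).
    apply: open_measurable_plane; have /continuousP := cg => /(_ _ (@open_gt R (i%:R / n%:R - M))).
    by [].
  by apply/seteqP; split => x /=; rewrite -ltr_pdivrMr // ltrBlDr.
rewrite -mean_sum; last by move=> i; exact: bmeasM.
rewrite -!meanZ //; last by apply: bmeas_sum => i; exact: bmeasM.
have bgs : bmeas (fun x => g x * sigma x) by apply: bmeasM => //; exact: bmeas_periodic.
have bS : bmeas (fun x => n%:R^-1 * \sum_(i < N') sigma x * \1_[set x | i%:R < (g x + M) * n%:R] x).
  by apply: bmeasM; [exact: bmeas_cst|apply: bmeas_sum => i; exact: bmeasM].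
rewrite -meanD //; last exact: bmeasM (bmeas_cst _) bs.
rewrite -meanB //; last by apply: bmeasD => //; exact: bmeasM (bmeas_cst _) bs.
apply: mean_norm.
  by apply: bmeasD => //; apply: bmeasN; apply: bmeasD => //; exact: bmeasM (bmeas_cst _) bs.
move=> x; rewrite -mulr_sumr mulrCA [- M * _]mulrC -mulrDr mulrC -mulrBr.
apply: normrM_le => //.
rewrite (eq_bigr (fun i : 'I_N' => (i%:R < (g x + M) * n%:R)%R%:R)); last first.
  by move=> i _; rewrite indicE; congr (nat_of_bool _)%:R; apply/idP/idP => [/set_mem //|h]; exact/mem_set.
have /staircase : 0 <= (g x + M) * n%:R <= N'%:R.
  have := gM x; rewrite ler_norml => /andP[g1 g2].
  rewrite mulr_ge0 ?ler0n //=; last by rewrite -lerBlDr sub0r.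
  rewrite (le_trans _ (le_trans HN _)) ?ler_nat // ler_wpM2r ?ler0n //.
  by rewrite mulr_natl mulr2n lerD2r.
set T := \sum_(i < N') _ => HT.
rewrite (_ : g x - _ = - (n%:R^-1 * (T - (g x + M) * n%:R))); last first.
  by field; rewrite lt0r_neq0.
by rewrite normrN normrM gtr0_norm ?invr_gt0 // ler_pdivrMl // mulfV ?lt0r_neq0.
Qed.

End Mean2.

(** * Invariant densities are divergence free *)

Section DerRules.
Variable R : realType.
Implicit Types (f g : R * R -> R).

Lemma deriveM_e1 n m f g x : classC n.+1 f -> classC m.+1 g ->
  'D_(1, 0) (fun x => f x * g x) x = f x * 'D_(1, 0) g x + g x * 'D_(1, 0) f x.
Proof. by move=> Hf Hg; have [_ ->] := is_deriveM (classC_derive1 x Hf) (classC_derive1 x Hg). Qed.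

Lemma deriveM_e2 n m f g x : classC n.+1 f -> classC m.+1 g ->
  'D_(0, 1) (fun x => f x * g x) x = f x * 'D_(0, 1) g x + g x * 'D_(0, 1) f x.
Proof. by move=> Hf Hg; have [_ ->] := is_deriveM (classC_derive2 x Hf) (classC_derive2 x Hg). Qed.

Lemma periodicM f g : Z2periodic f -> Z2periodic g -> Z2periodic (fun x => f x * g x).
Proof. by move=> pf pg x k; rewrite pf pg. Qed.


Lemma arbitrarily_small_eq0 (a C : R) : 0 <= C -> (forall t, 0 < t -> `|a| <= C * t) -> a = 0.
Proof.
move=> C0 H; apply/eqP; rewrite -normr_le0; apply/ler_addgt0Pl => e e0.
rewrite addr0; have C1 : 0 < C + 1 by rewrite ltr_wpDl.
rewrite (le_trans (H (e / (C + 1)) _)) ?divr_gt0 //.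
by rewrite mulrA ler_pdivrMr // mulrC ler_wpM2l ?ltW // ltrDl.
Qed.

End DerRules.

Section Invariance.
Variable R : realType.
Implicit Types (f g : R * R -> R) (k : int * int).
Variables (b : R * R -> R * R) (X : R -> R * R -> R * R) (sigma : R * R -> R) (r : nat).
Hypothesis Hb : Csharp2 r.+3 b.
Hypothesis HX : is_flow b X.
Hypothesis Hs : Csharp r.+3 sigma.
Hypothesis inv : invariant_density X sigma.

Let b1 x := (b x).1.
Let b2 x := (b x).2.
Let cb1 : classC r.+3 b1. Proof. by case: Hb => [[]]. Qed.
Let cb2 : classC r.+3 b2. Proof. by case: Hb => [_ []]. Qed.
Let pb1 : Z2periodic b1. Proof. by case: Hb => [[]]. Qed.
Let pb2 : Z2periodic b2. Proof. by case: Hb => [_ []]. Qed.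
Let cs : classC r.+3 sigma. Proof. by case: Hs. Qed.
Let ps : Z2periodic sigma. Proof. by case: Hs. Qed.

Lemma b_periodic : Z2periodic b.
Proof.
move=> x k; rewrite [LHS]surjective_pairing [RHS]surjective_pairing; congr pair.
  exact: pb1.
exact: pb2.
Qed.

Lemma b_Lip : exists2 K, 0 <= K & forall x y, `|b y - b x| <= K * `|y - x|.
Proof.
have [K K0 HK] := periodic_Lip cb1 pb1; have [L L0 HL] := periodic_Lip cb2 pb2.
exists (K + L); first exact: addr_ge0.
move=> x y; rewrite norm2_le; apply/andP; split.
  by rewrite (le_trans (HK x y)) // ler_wpM2r // lerDl.
by rewrite (le_trans (HL x y)) // ler_wpM2r // lerDr.
Qed.

Lemma b_bounded : exists2 B, 0 <= B & forall x, `|b x| <= B.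
Proof.
have [K K0 HK] := periodic_bounded (classC_cont cb1) pb1.
have [L L0 HL] := periodic_bounded (classC_cont cb2) pb2.
exists (K + L); first exact: addr_ge0.
move=> x; rewrite norm2_le; apply/andP; split.
  by rewrite (le_trans (HK x)) // lerDl.
by rewrite (le_trans (HL x)) // lerDr.
Qed.

(** Both means are approximated by the same combination of measures of superlevel
    sets, since X t maps those of g \o X t onto those of g. *)
Lemma mean_invariant (t : R) g : 0 <= t -> continuous g -> Z2periodic g ->
  mean (fun x => g (X t x) * sigma x) = mean (fun x => g x * sigma x).
Proof.
move=> t0 cg pg; have [K K0 LK] := b_Lip.
have cX : continuous (X t) by move=> z; exact: (flow_continuous K0 LK HX).
have pX := flow_lattice K0 LK b_periodic HX t.
have cgX : continuous (fun x => g (X t x)).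
  by move=> x; apply: (@continuous_comp _ _ _ (X t) g); [exact: cX|exact: cg].
have pgX : Z2periodic (fun x => g (X t x)) by move=> x k; rewrite pX pg.
have [M M0 HM] := periodic_bounded cg pg.
have [S S0 HS] := periodic_bounded (classC_cont cs) ps.
have bs := bmeas_periodic (classC_cont cs) ps.
apply/eqP; rewrite -subr_eq0; apply/eqP.
suff H n : (0 < n)%N -> `|mean (fun x => g (X t x) * sigma x) - mean (fun x => g x * sigma x)|
   <= (S + S) / n%:R.
  apply: (@arbitrarily_small_eq0 _ _ (S + S)); first exact: addr_ge0.
  move=> e e0; pose n := (Num.bound e^-1).+1.
  rewrite (le_trans (H n _)) // ler_wpM2l ?addr_ge0 //.
  rewrite -[leRHS]invrK lef_pV2 ?posrE ?ltr0n ?invr_gt0 //.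
  by rewrite (le_trans (ltW (archi_boundP _))) ?invr_ge0 ?ltW // ltr_nat.
move=> n0.
have [N1 H1] := layer_cake n0 cgX pgX bs (fun x => HM _) HS M0.
have [N2 H2] := layer_cake n0 cg pg bs HM HS M0.
have := H1 _ (leq_maxl N1 N2); have := H2 _ (leq_maxr N1 N2).
set N := maxn N1 N2.
rewrite (eq_bigr (fun i : 'I_N => mean (fun x => sigma x *
    \1_[set x | i%:R < (g (X t x) + M) * n%:R] x))); last first.
  move=> i _; set A := [set _ | _]; set B := [set x | _ < (g (X t x) + _) * _].
  have oA : open A.
    rewrite (_ : A = [set x | i%:R / n%:R - M < g x]).
      by have /continuousP := cg => /(_ _ (@open_gt R (i%:R / n%:R - M))).
    by apply/seteqP; split => x; rewrite /A /= -ltr_pdivrMr ?ltr0n // ltrBlDr.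
  have oB : open B.
    rewrite (_ : B = [set x | i%:R / n%:R - M < g (X t x)]).
      by have /continuousP := cgX => /(_ _ (@open_gt R (i%:R / n%:R - M))).
    by apply/seteqP; split => x; rewrite /B /= -ltr_pdivrMr ?ltr0n // ltrBlDr.
  have mA := open_measurable_plane oA; have mB := open_measurable_plane oB.
  have XB : X t @` B = A.
    apply/seteqP; split=> [_ [x Bx <-] //|x Ax].
    by exists (X (- t) x); rewrite /B /= (flowNK K0 LK HX).
  have := @inv t B t0; rewrite XB => /(_ _).
  rewrite !torus_measureE // => E; apply: EFin_inj; apply: E.
  by split=> // x k; rewrite /B /= pX pg.
move=> h2 h1; rewrite mulrDl.
set P := mean _ in h1 *; set Q := mean _ in h2 *; set T := - M * mean sigma + _ in h1 h2.
rewrite (_ : P - Q = (P - T) + (T - Q)); last by ring.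
by rewrite (le_trans (ler_normD _ _)) // lerD // distrC.
Qed.

(** The derivative of g along the flow. *)
Definition Lie g x := grad g x (b x).

Lemma Lie_periodic g : Z2periodic g -> Z2periodic (Lie g).
Proof.
by move=> pg x k; rewrite /Lie /grad !(periodic_derive _ pg) b_periodic.
Qed.

Lemma Lie_classC n g : (n <= r.+3)%N -> classC n.+1 g -> classC n (Lie g).
Proof.
move=> nr Hg; apply: classCD; apply: classCM.
- exact: classC_d1.
- exact: classC_le cb1.
- exact: classC_d2.
- exact: classC_le cb2.
Qed.

(** The difference quotient (g(X t x) - g(x)) / t has mean zero against sigma, and
    for g of class C^2 it differs from the derivative along b by O(t), uniformly. *)
Lemma mean_Lie_C2 g : classC 2 g -> Z2periodic g -> mean (fun x => Lie g x * sigma x) = 0.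
Proof.
move=> Hg pg; have [K K0 LK] := b_Lip; have [B B0 HB] := b_bounded.
have cX u : continuous (X u) by move=> z; exact: (flow_continuous K0 LK HX).
have pX := flow_lattice K0 LK b_periodic HX.
have cu : classC 1 (Lie g) by exact: Lie_classC.
have pu := Lie_periodic pg.
have [C C0 HC] := periodic_Lip cu pu.
have [S S0 HS] := periodic_bounded (classC_cont cs) ps.
have bs := bmeas_periodic (classC_cont cs) ps.
have bu := bmeas_periodic (classC_cont cu) pu.
have bg := bmeas_periodic (classC_cont Hg) pg.
apply: (@arbitrarily_small_eq0 _ _ (C * B * S)); first by rewrite !mulr_ge0.
move=> t t0.
have bgX : bmeas (fun x => g (X t x)).
  apply: bmeas_periodic; last by move=> x k; rewrite pX pg.
  by move=> x; apply: (@continuous_comp _ _ _ (X t) g); [exact: cX|exact: (classC_cont Hg)].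
have E0 : mean (fun x => g (X t x) * sigma x - g x * sigma x) = 0.
  rewrite meanB; [|exact: bmeasM|exact: bmeasM].
  by rewrite mean_invariant ?subrr ?ltW //; exact: (classC_cont Hg).
rewrite -(ler_pM2l t0) -{1}(gtr0_norm t0) -normrM -meanZ; last exact: bmeasM.
rewrite -[mean _](subr0) -E0 -meanB; last 2 first.
- by apply: bmeasM; [exact: bmeas_cst|exact: bmeasM].
- by apply: bmeasD; [exact: bmeasM|apply: bmeasN; exact: bmeasM].
apply: mean_norm.
  apply: bmeasD; first by apply: bmeasM; [exact: bmeas_cst|exact: bmeasM].
  by apply: bmeasN; apply: bmeasD; [exact: bmeasM|apply: bmeasN; exact: bmeasM].
move=> x; have [c hc E] := MVT_any 0 t (fun s => flow_path HX x s (classC_C1 Hg)).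
rewrite subr0 (flow0 HX) -/(Lie g _) in E.
rewrite !subr0 in hc.
rewrite -mulrBl E (_ : _ - _ = (Lie g x - Lie g (X c x)) * (t * sigma x)); last by ring.
rewrite (_ : t * (C * B * S * t) = (C * (B * t)) * (t * S)); last by ring.
apply: normrM_le; last by apply: normrM_le; [rewrite gtr0_norm|exact: HS].
rewrite (le_trans (HC _ _)) // ler_wpM2l // distrC.
have := flow_speed HB HX c 0 x; rewrite (flow0 HX) => /le_trans; apply.
by rewrite subr0 ler_wpM2l // (le_trans hc) // gtr0_norm.
Qed.

Let F1 x := sigma x * b1 x.
Let F2 x := sigma x * b2 x.
Let cF1 : classC r.+3 F1. Proof. exact: classCM. Qed.
Let cF2 : classC r.+3 F2. Proof. exact: classCM. Qed.
Let pF1 : Z2periodic F1. Proof. exact: periodicM. Qed.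
Let pF2 : Z2periodic F2. Proof. exact: periodicM. Qed.

Let dv x := 'D_(1, 0) F1 x + 'D_(0, 1) F2 x.

Lemma mean_ibp g : classC 1 g -> Z2periodic g ->
  mean (fun x => Lie g x * sigma x) + mean (fun x => g x * dv x) = 0.
Proof.
move=> Hg pg.
have cF1' : classC 1 F1 by exact: classC_le cF1.
have cF2' : classC 1 F2 by exact: classC_le cF2.
have cG1 : classC 1 (fun x => g x * F1 x) by exact: classCM.
have cG2 : classC 1 (fun x => g x * F2 x) by exact: classCM.
have := mean_derive1 cG1 (periodicM pg pF1); have := mean_derive2 cG2 (periodicM pg pF2).
move=> E2 E1.
have bd f v n : classC n.+1 f -> Z2periodic f -> continuous (fun x => 'D_v f x) ->
  bmeas (fun x => 'D_v f x).
  by move=> _ pf c; apply: bmeas_periodic => //; exact: periodic_derive.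
have bcp n f : classC n f -> Z2periodic f -> bmeas f by move=> /classC_cont; exact: bmeas_periodic.
have cL : classC 0 (Lie g) by exact: Lie_classC.
have cdv : classC 0 dv.
  apply: classCD; [exact: (classC_le _ (classC_d1 cF1'))|exact: (classC_le _ (classC_d2 cF2'))].
have pdv : Z2periodic dv.
  by move=> x k; rewrite /dv !periodic_derive.
rewrite -meanD; last 2 first.
- by apply: bmeasM; [exact: (bcp _ _ cL (Lie_periodic pg))|exact: (bcp _ _ cs ps)].
- by apply: bmeasM; [exact: (bcp _ _ Hg pg)|exact: (bcp _ _ cdv pdv)].
rewrite -[RHS](_ : mean (fun x => 'D_(1, 0) (fun x => g x * F1 x) x) +
  mean (fun x => 'D_(0, 1) (fun x => g x * F2 x) x) = 0); last by rewrite E1 E2 addr0.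
rewrite -meanD; last 2 first.
- exact: (bcp _ _ (classC_d1 cG1) (periodic_derive _ (periodicM pg pF1))).
- exact: (bcp _ _ (classC_d2 cG2) (periodic_derive _ (periodicM pg pF2))).
apply: mean_eq => x; rewrite (deriveM_e1 x Hg cF1') (deriveM_e2 x Hg cF2').
by rewrite /Lie /grad /dv /F1 /F2 /b1 /b2; ring.
Qed.

(** By [mean_Lie_C2] and integration by parts, the divergence of sigma b is
    orthogonal to every C^2 periodic function, in particular to itself. *)
Lemma divergence_free x : 'D_(1, 0) F1 x + 'D_(0, 1) F2 x = 0.
Proof.
have cdv : classC 2 dv.
  apply: classCD; [exact: (classC_le _ (classC_d1 cF1))|exact: (classC_le _ (classC_d2 cF2))].
have pdv : Z2periodic dv by move=> y k; rewrite /dv !periodic_derive.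
have := mean_ibp (classCW cdv) pdv; rewrite mean_Lie_C2 // add0r => H.
apply/eqP; rewrite -sqrf_eq0 expr2; apply/eqP.
apply: (@mean_eq0 _ (fun x => dv x * dv x)) => //.
- exact: (classC_cont (classCM cdv cdv)).
- exact: periodicM.
- by move=> y; rewrite -expr2 sqr_ge0.
Qed.

(** Once the divergence vanishes, integration by parts needs one derivative only. *)
Lemma mean_Lie g : classC 1 g -> Z2periodic g -> mean (fun x => Lie g x * sigma x) = 0.
Proof.
move=> Hg pg; rewrite -[RHS](mean_ibp Hg pg).
rewrite [X in _ = _ + X](_ : _ = 0) ?addr0 //.
rewrite -[RHS](mean_cst 0); apply: mean_eq => x.
by rewrite /dv divergence_free mulr0.
Qed.

End Invariance.

(** * The Poincare lemma *)

Section Poincare.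
Variable R : realType.
Local Notation mu := (@lebesgue_measure R).

Lemma integrable_continuous01 (f : R -> R) : continuous f -> mu.-integrable `[0, 1] (EFin \o f).
Proof.
move=> cf; apply: continuous_compact_integrable; first exact: segment_compact.
exact: continuous_subspaceT.
Qed.

(** The derivative in s of the integrand s P(us, uy) + y Q(us, uy) is, for a closed
    form, the u-derivative of u P(us, uy). *)
Lemma poincare_slice (P P1 Q Q1 : R -> R -> R) (a y M : R) :
  (forall s t : R, is_derive s 1 (P^~ t) (P1 s t)) ->
  (forall s t : R, is_derive s 1 (Q^~ t) (Q1 s t)) ->
  (forall u : R, is_derive u 1 (fun u => P (u * a) (u * y))
     (a * P1 (u * a) (u * y) + y * Q1 (u * a) (u * y))) ->
  (forall s : R, continuous (fun u : R => P (u * s) (u * y))) ->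
  (forall s : R, continuous (fun u : R => Q (u * s) (u * y))) ->
  (forall s : R, continuous (fun u : R => P1 (u * s) (u * y))) ->
  (forall s : R, continuous (fun u : R => Q1 (u * s) (u * y))) ->
  (forall s t, `|P s t| <= M) -> (forall s t, `|P1 s t| <= M) -> (forall s t, `|Q1 s t| <= M) ->
  is_derive a 1 (fun s => \int[mu]_(u in `[0, 1])
      (s * P (u * s) (u * y) + y * Q (u * s) (u * y))) (P a y).
Proof.
move=> dP dQ dU cP cQ cP1 cQ1 bP bP1 bQ1.
have M0 : 0 <= M by exact: le_trans (normr_ge0 _) (bP 0 0).
pose f (s u : R) : R := s * P (u * s) (u * y) + y * Q (u * s) (u * y).
pose f1 (s u : R) : R := P (u * s) (u * y) + u * (s * P1 (u * s) (u * y) + y * Q1 (u * s) (u * y)).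
have df (s u : R) : is_derive s 1 (f^~ u) (f1 s u).
  have e1 : is_derive s 1 (fun s => P (u * s) (u * y)) (P1 (u * s) (u * y) * u).
    exact: (@is_derive1_comp R (P^~ (u * y)) (fun s => u * s) s _ _ (dP _ _) (is_derive_lin u s)).
  have e2 : is_derive s 1 (fun s => Q (u * s) (u * y)) (Q1 (u * s) (u * y) * u).
    exact: (@is_derive1_comp R (Q^~ (u * y)) (fun s => u * s) s _ _ (dQ _ _) (is_derive_lin u s)).
  have := is_deriveD (is_deriveM (is_derive_id s (1:R)) e1) (is_deriveM (is_derive_cst y s (1:R)) e2).
  rewrite (_ : _ + _ = f1 s u) //.
  by rewrite /f1 /cst /GRing.scale /=; ring.
have cf (s : R) : continuous (f s).
  move=> u; apply: cvgD; apply: cvgM; try exact: cvg_cst.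
    exact: cP.
  exact: cQ.
have cf1 (s : R) : continuous (f1 s).
  move=> u; apply: cvgD; first exact: cP.
  apply: cvgM; first exact: cvg_id.
  apply: cvgD; apply: cvgM; try exact: cvg_cst.
    exact: cP1.
  exact: cQ1.
pose G := M + ((`|a| + 1) * M + `|y| * M).
have G0 : 0 <= G by rewrite /G !addr_ge0 ?mulr_ge0 ?addr_ge0.
have Ea : a \in `]a - 1, a + 1[ by rewrite in_itv /= ltrDl ltr01 andbT ltrBlDr ltrDl ltr01.
have bd (s u : R) : `]a - 1, a + 1[%classic s -> `[0, 1]%classic u -> `|partial1of2 f s u| <= G.
  rewrite /= !in_itv /= => /andP[s1 s2] /andP[u0 u1].
  rewrite /partial1of2 derive1E; have [_ ->] := df s u.
  have sa : `|s| <= `|a| + 1.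
    by rewrite -[s](subrK a) (le_trans (ler_normD _ _)) // addrC lerD2l ltW // ltr_distl s1 s2.
  rewrite /f1 (le_trans (ler_normD _ _)) // lerD //.
  rewrite normrM ger0_norm // -[leRHS]mul1r ler_pM //.
  by rewrite (le_trans (ler_normD _ _)) // lerD // normrM_le.
have mB : measurable (`[0, 1]%classic : set R) by exact: measurable_itv.
have I1 : forall s, `]a - 1, a + 1[%classic s -> mu.-integrable `[0, 1] (EFin \o f s).
  by move=> s _; exact: integrable_continuous01.
have I2 : forall s u, `]a - 1, a + 1[%classic s -> `[0, 1]%classic u -> derivable (f^~ u) s 1.
  by move=> s u _ _; case: (df s u).
have IG : mu.-integrable `[0, 1] (EFin \o (fun _ : R => G)).
  by apply: integrable_continuous01 => u; exact: cvg_cst.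
have D1 := @derivable_under_integral R _ _ mu f _ mB a (a - 1) (a + 1) Ea I1 I2 (fun=> G) (fun=> G0) IG bd.
have D2 := @differentiation_under_integral R _ _ mu f _ mB a (a - 1) (a + 1) Ea I1 I2 (fun=> G) (fun=> G0) IG bd.
split; first exact: D1.
rewrite -derive1E D2.
have -> : \int[mu]_(u in `[0, 1]) partial1of2 f a u = \int[mu]_(u in `[0, 1]) f1 a u.
  by apply: eq_Rintegral => u _; rewrite /partial1of2 derive1E; case: (df a u).
have DU (u : R) : is_derive u 1 (fun u => u * P (u * a) (u * y)) (f1 a u).
  have := is_deriveM (is_derive_id u (1 : R)) (dU u).
  rewrite (_ : _ + _ = f1 a u) //.
  by rewrite /f1 /GRing.scale /=; ring.
by rewrite /Rintegral (FTC2_derive DU (cf1 a) ltr01) /= !mul1r mul0r subr0.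
Qed.

Lemma continuous_ray (g : R * R -> R) (s y : R) : continuous g -> continuous (fun u : R => g (u * s, u * y)).
Proof.
by move=> cg; apply: (@continuous_comp2 R R g (fun u => u * s) (fun u => u * y) cg) => z;
  apply: cvgM; first [exact: cvg_id|exact: cvg_cst].
Qed.

Lemma is_derive_linr (c t : R) : is_derive t 1 (fun s => s * c) c.
Proof.
have := is_derive_lin c t; rewrite (_ : (fun _ => _) = (fun s => s * c)) //.
by apply/funext => s; rewrite mulrC.
Qed.

(** The potential is the integral of the form along the ray from the origin. *)
Lemma poincare n (G1 G2 : R * R -> R) : classC n.+1 G1 -> classC n.+1 G2 ->
  Z2periodic G1 -> Z2periodic G2 -> (forall x, 'D_(0, 1) G1 x = 'D_(1, 0) G2 x) ->
  exists psi : R * R -> R, classC n.+2 psi /\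
   (forall x : R * R, is_derive x (1, 0) psi (G1 x)) /\ (forall x : R * R, is_derive x (0, 1) psi (G2 x)).
Proof.
move=> C1 C2 p1 p2 E.
have b (g : R * R -> R) : classC n.+1 g -> Z2periodic g -> exists M : R, forall x : R * R, [/\ `|g x| <= M,
   `|'D_(1, 0) g x| <= M & `|'D_(0, 1) g x| <= M].
  move=> cg pg; have [A A0 HA] := periodic_bounded (classC_cont cg) pg.
  have [B B0 HB] := periodic_bounded (classC_cont (classC_d1 cg)) (periodic_derive (1, 0) pg).
  have [C C0 HC] := periodic_bounded (classC_cont (classC_d2 cg)) (periodic_derive (0, 1) pg).
  exists (A + B + C) => x; split.
  - by rewrite (le_trans (HA x)) // -addrA lerDl addr_ge0.
  - by rewrite (le_trans (HB x)) // addrAC lerDr addr_ge0.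
  - by rewrite (le_trans (HC x)) // lerDr addr_ge0.
have [M1 HM1] := b _ C1 p1; have [M2 HM2] := b _ C2 p2.
pose psi (x : R * R) : R := \int[mu]_(u in `[0, 1])
   (x.1 * G1 (u * x.1, u * x.2) + x.2 * G2 (u * x.1, u * x.2)).
have D1 (x : R * R) : is_derive x (1, 0) psi (G1 x).
  apply: slice1_derive; case: x => a y /=.
  apply: (@poincare_slice (fun s t => G1 (s, t)) (fun s t => 'D_(1, 0) G1 (s, t))
    (fun s t => G2 (s, t)) (fun s t => 'D_(1, 0) G2 (s, t)) a y (`|M1| + `|M2|)).
  - by move=> s t; exact: (classC_slice1 (s, t) C1).
  - by move=> s t; exact: (classC_slice1 (s, t) C2).
  - move=> u; have := chain_rule2 (classC_C1 C1) (is_derive_linr a u) (is_derive_linr y u).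
    by rewrite E /= [a * _]mulrC [y * _]mulrC.
  - by move=> s; exact: (continuous_ray (classC_cont C1)).
  - by move=> s; exact: (continuous_ray (classC_cont C2)).
  - by move=> s; exact: (continuous_ray (classC_cont (classC_d1 C1))).
  - by move=> s; exact: (continuous_ray (classC_cont (classC_d1 C2))).
  - by move=> s t; have [h _ _] := HM1 (s, t); rewrite (le_trans h) // (le_trans (ler_norm _)) // lerDl.
  - by move=> s t; have [_ h _] := HM1 (s, t); rewrite (le_trans h) // (le_trans (ler_norm _)) // lerDl.
  - by move=> s t; have [_ h _] := HM2 (s, t); rewrite (le_trans h) // (le_trans (ler_norm _)) // lerDr.
have D2 (x : R * R) : is_derive x (0, 1) psi (G2 x).
  apply: slice2_derive; case: x => a y /=.
  rewrite (_ : (fun s => psi (a, s)) = (fun s => \int[mu]_(u in `[0, 1])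
      (s * G2 (u * a, u * s) + a * G1 (u * a, u * s)))); last first.
    apply/funext => s; rewrite /psi /=; congr (Rintegral _ _ _); apply/funext => u.
    by rewrite addrC.
  apply: (@poincare_slice (fun s t => G2 (t, s)) (fun s t => 'D_(0, 1) G2 (t, s))
    (fun s t => G1 (t, s)) (fun s t => 'D_(0, 1) G1 (t, s)) y a (`|M1| + `|M2|)).
  - by move=> s t; exact: (classC_slice2 (t, s) C2).
  - by move=> s t; exact: (classC_slice2 (t, s) C1).
  - move=> u; have := chain_rule2 (classC_C1 C2) (is_derive_linr a u) (is_derive_linr y u).
    by rewrite -E /= [a * _]mulrC [y * _]mulrC addrC.
  - by move=> s; exact: (continuous_ray (classC_cont C2)).
  - by move=> s; exact: (continuous_ray (classC_cont C1)).
  - by move=> s; exact: (continuous_ray (classC_cont (classC_d2 C2))).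
  - by move=> s; exact: (continuous_ray (classC_cont (classC_d2 C1))).
  - by move=> s t; have [h _ _] := HM2 (t, s); rewrite (le_trans h) // (le_trans (ler_norm _)) // lerDr.
  - by move=> s t; have [_ _ h] := HM2 (t, s); rewrite (le_trans h) // (le_trans (ler_norm _)) // lerDr.
  - by move=> s t; have [_ _ h] := HM1 (t, s); rewrite (le_trans h) // (le_trans (ler_norm _)) // lerDl.
exists psi; split=> //.
have L := @C1_Lip _ psi (`|M1| + `|M2|) (fun x => @ex_derive _ _ _ _ _ _ _ (D1 x))
   (fun x => @ex_derive _ _ _ _ _ _ _ (D2 x)).
have {}L x y : `|psi y - psi x| <= 2 * (`|M1| + `|M2|) * `|y - x|.
  apply: L => z.
    by have [_ ->] := D1 z; have [h _ _] := HM1 z; rewrite (le_trans h) // (le_trans (ler_norm _)) // lerDl.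
  by have [_ ->] := D2 z; have [h _ _] := HM2 z; rewrite (le_trans h) // (le_trans (ler_norm _)) // lerDr.
apply: (classC_intro _ D1 D2 C1 C2).
move=> x; apply/continuous_epsP => e e0.
have K0 : 0 < 2 * (`|M1| + `|M2|) + 1 by rewrite ltr_wpDl // mulr_ge0 // addr_ge0.
exists (e / (2 * (`|M1| + `|M2|) + 1)); first by rewrite divr_gt0.
move=> y; rewrite ltr_pdivlMr // => h; rewrite (le_lt_trans (L x y)) // (le_lt_trans _ h) //.
by rewrite mulrC ler_wpM2l // lerDl.
Qed.

End Poincare.

(** * Elementary tools: drift, signs, geometric sequences *)

Section Tools.
Variable R : realType.
Implicit Types (x y z p v w : R * R).

Definition dot p v : R := p.1 * v.1 + p.2 * v.2.

Lemma dotD p v w : dot p (v + w) = dot p v + dot p w.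
Proof. by rewrite /dot /=; ring. Qed.

Lemma dotB p v w : dot p (v - w) = dot p v - dot p w.
Proof. by rewrite /dot /=; ring. Qed.

Lemma dotZ p (a : R) v : dot p (a *: v) = a * dot p v.
Proof. by rewrite /dot /= /GRing.scale /=; ring. Qed.

Lemma dot_le p v : `|dot p v| <= 2 * `|p| * `|v|.
Proof.
rewrite /dot (le_trans (ler_normD _ _)) // -mulrA mulr_natl mulr2n.
by rewrite lerD // normrM_le ?norm_fst ?norm_snd.
Qed.

Lemma geometric_limit (u : nat -> R) (A rho : R) : 0 <= A -> 0 <= rho < 1 ->
  (forall n, `|u n.+1 - u n| <= A * rho ^+ n) ->
  exists L, forall n, `|L - u n| <= A * rho ^+ n / (1 - rho).
Proof.
move=> A0 /andP[r0 r1] H; have r1' : 0 < 1 - rho by rewrite subr_gt0.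
pose d n := A * rho ^+ n / (1 - rho).
have d0 n : 0 <= d n by rewrite /d !mulr_ge0 ?exprn_ge0 ?invr_ge0 ?(ltW r1').
have dS n : d n - d n.+1 = A * rho ^+ n.
  by rewrite /d exprS; field; rewrite lt0r_neq0.
have step n : u n - d n <= u n.+1 - d n.+1 /\ u n.+1 + d n.+1 <= u n + d n.
  have := H n; rewrite -dS ler_norml => /andP[h1 h2]; split; lra.
have lo m n : (m <= n)%N -> u m - d m <= u n - d n /\ u n + d n <= u m + d m.
  move=> /subnK <-; elim: (n - m)%N => [|k [h1 h2]]; first by rewrite add0n; split.
  have [s1 s2] := step (k + m)%N; rewrite addSn; split; first exact: le_trans h1 s1.
  exact: le_trans s2 h2.
have cross m n : u m - d m <= u n + d n.
  have [l1 _] := lo m (maxn m n) (leq_maxl _ _).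
  have [_ l2] := lo n (maxn m n) (leq_maxr _ _).
  have := d0 (maxn m n); lra.
pose E := [set u n - d n | n in [set: nat]].
have hE : has_sup E.
  split; first by exists (u 0%N - d 0%N); exists 0%N.
  by exists (u 0%N + d 0%N) => _ [n _ <-]; exact: cross.
exists (sup E) => n.
have l1 : u n - d n <= sup E by apply: ub_le_sup; [case: hE|exists n].
have l2 : sup E <= u n + d n.
  by apply: ge_sup; [case: hE|move=> _ [m _ <-]; exact: cross].
by rewrite -/(d n) ler_norml; lra.
Qed.

Lemma geometric_small (rho e : R) : 0 <= rho < 1 -> 0 < e -> exists n, rho ^+ n < e.
Proof.
move=> /andP[r0 r1] e0.
have : (fun n => rho ^+ n) @ \oo --> (0 : R) by apply: cvg_expr; rewrite ger0_norm.
move=> /cvgrPdist_lt/(_ _ e0)[n _ /(_ n (leqnn _))] /=.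
by rewrite sub0r normrN ger0_norm ?exprn_ge0 // => h; exists n.
Qed.

(** The intermediate value theorem on the segment between two points. *)
Lemma nonvanishing_sign (f : R * R -> R) : continuous f -> (forall x, f x != 0) ->
  (forall x, 0 < f x) \/ (forall x, f x < 0).
Proof.
move=> cf f0.
suff H x y : 0 < f x -> 0 < f y.
  have [h|h] := ltP 0 (f (0, 0)); [left=> y; exact: H h|right=> y].
  rewrite lt_neqAle f0 /= leNgt; apply/negP => h'.
  by have := H y (0, 0) h'; rewrite ltNge h.
move=> fx; rewrite ltNge; apply/negP => fy.
pose g (u : R) := f (x + u *: (y - x)).
have cg : continuous g.
  move=> u; apply: (@continuous_comp _ _ _ (fun u : R => x + u *: (y - x)) f); last exact: cf.
  apply: cvgD; first exact: cvg_cst.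
  by apply: cvgZr_tmp; exact: cvg_id.
have [||c _ gc] := @IVT R g 0 1 0 ler01.
- exact: continuous_subspaceT.
- by rewrite /g scale0r addr0 scale1r addrC subrK ge_min le_max fy (ltW fx) orbT.
by have := f0 (x + c *: (y - x)); rewrite -/(g c) gc eqxx.
Qed.

(** Chaining the local advances reaches a time in [T - Ts, T] with an advance of at
    least (T - Ts)/Ts; the motion during the remaining time can destroy at most
    C Ts of it, where C bounds the speed along p.  The number of advances that fit in
    [0, T] is bounded because each is worth 1 and the total is at most C T. *)
Lemma drift_iter (Y : R -> R * R -> R * R) (B Ts : R) p : 0 <= B -> 0 < Ts ->
  (forall x, Y 0 x = x) -> (forall s t x, Y (s + t) x = Y s (Y t x)) ->
  (forall s t x, `|Y s x - Y t x| <= B * `|s - t|) ->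
  (forall x, exists2 t, 0 < t <= Ts & 1 <= dot p (Y t x - x)) ->
  exists2 T, 0 < T & forall x, 1 <= dot p (Y T x - x).
Proof.
move=> B0 Ts0 Y0 YD YB adv.
pose C := 2 * `|p| * B.
have C0 : 0 <= C by rewrite /C !mulr_ge0.
have dB s t x : `|dot p (Y s x - Y t x)| <= C * `|s - t|.
  by rewrite (le_trans (dot_le _ _)) // /C -!mulrA ler_wpM2l // ler_wpM2l.
pose T := Ts * (2 + C * Ts).
have T0 : 0 < T by rewrite mulr_gt0 // ltr_wpDr // mulr_ge0 // ltW.
exists T => // x.
have claim (n : nat) : exists s, [/\ 0 <= s <= T, s / Ts <= dot p (Y s x - x) &
   (T - s <= Ts) \/ n%:R <= dot p (Y s x - x)].
  elim: n => [|n [s [/andP[s0 sT] hs h]]].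
    exists 0; rewrite lexx ltW // Y0 subrr /dot /= mulr0 mulr0 addr0 mul0r.
    by split=> //; right.
  have [Tsmall|Tbig] := leP (T - s) Ts; first by exists s; rewrite s0 sT; split=> //; left.
  case: h => [|h]; first by rewrite leNgt Tbig.
  have [t /andP[t0 tT] ht] := adv (Y s x).
  exists (t + s); rewrite YD.
  have E : dot p (Y t (Y s x) - x) = dot p (Y t (Y s x) - Y s x) + dot p (Y s x - x).
    by rewrite -dotD addrA subrK.
  rewrite E; split.
  - by apply/andP; split; [rewrite addr_ge0 // ltW|lra].
  - by rewrite mulrDl lerD // (le_trans _ ht) // ler_pdivrMr // mul1r.
  - by right; rewrite -natr1 addrC lerD.
have [s [/andP[s0 sT] hs h]] := claim (Num.bound (C * T)).
have CT0 : 0 <= C * T by rewrite mulr_ge0 // ltW.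
case: h => [h|h]; last first.
  have : dot p (Y s x - x) <= C * T.
    have := dB s 0 x; rewrite Y0 subr0 => /(le_trans (ler_norm _))/le_trans; apply.
    by rewrite ler_wpM2l // ger0_norm.
  by rewrite leNgt (lt_le_trans _ h) // archi_boundP.
have E : dot p (Y T x - x) = dot p (Y T x - Y s x) + dot p (Y s x - x).
  by rewrite -dotD addrA subrK.
have h1 : - (C * Ts) <= dot p (Y T x - Y s x).
  have := dB T s x; rewrite ler_norml => /andP[h1 _]; rewrite (le_trans _ h1) // lerN2.
  by rewrite ler_wpM2l // ger0_norm ?subr_ge0.
have h2 : 1 + C * Ts <= s / Ts.
  rewrite ler_pdivlMr //; move: h; rewrite /T; nra.
rewrite E; lra.
Qed.

End Tools.

(** * Retraction of the plane onto level sets *)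

Section Levels.
Variable R : realType.
Implicit Types (x y z p v w : R * R).
Variables (psi : R * R -> R) (V C : R) (v : R * R -> R * R).
Hypothesis C0 : 0 <= C.
Hypothesis taylor : forall x y, `|psi y - psi x - grad psi x (y - x)| <= C * `|y - x| ^+ 2.
Hypothesis cv : continuous v.
Hypothesis V0 : 0 <= V.
Hypothesis vV : forall x, `|v x| <= V.
Hypothesis gv : forall x, grad psi x (v x) = 1.
Hypothesis cpsi : continuous psi.

Lemma gradZ x (a : R) w : grad psi x (a *: w) = a * grad psi x w.
Proof. by rewrite /grad /= /GRing.scale /=; ring. Qed.

(** A damped Newton iteration z := z + eps (S - psi z) v(z): with eps small compared
    with 1/E0 it contracts any error up to E0 by the factor 1 - eps/2, and its limit
    depends continuously on the parameter as a uniform limit.  Points that are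
    already on the right level are not moved. *)
Lemma retract (T : normedModType R) (S : T -> R) (q : T -> R * R) (E0 : R) : continuous S ->
  continuous q -> (forall u, `|S u - psi (q u)| <= E0) ->
  exists r : T -> R * R, [/\ continuous r, forall u, psi (r u) = S u,
    forall u, `|r u - q u| <= 2 * V * E0 & forall u, S u = psi (q u) -> r u = q u].
Proof.
move=> cS cq HE.
have E00 : 0 <= E0 by exact: le_trans (normr_ge0 _) (HE 0).
(* chosen so that the quadratic error of a step is at most half of its gain *)
pose D := 2 * (C * V ^+ 2 * E0) + 1.
have D1 : 1 <= D by rewrite lerDr !mulr_ge0 ?sqr_ge0.
have D0 : 0 < D by exact: lt_le_trans ltr01 D1.
pose eps := D^-1.
have e0 : 0 < eps by rewrite invr_gt0.
have e1 : eps <= 1 by rewrite invf_le1.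
have eD : C * V ^+ 2 * E0 * eps <= 2^-1.
  rewrite ler_pdivrMr // ler_pdivlMl // /D; move: (C * _ * _) => a; lra.
pose rho := 1 - eps / 2.
have rho01 : 0 <= rho < 1 by rewrite /rho; apply/andP; split; lra.
have [rho0 rho1] := andP rho01.
pose step (s : R) z := z + (eps * (s - psi z)) *: v z.
pose Z n (u : T) := iter n (step (S u)) (q u).
have stepE s z : `|s - psi z| <= E0 -> `|s - psi (step s z)| <= rho * `|s - psi z|.
  move=> h; set e := s - psi z in h *.
  have Ez : step s z - z = (eps * e) *: v z by rewrite /step addrAC subrr add0r.
  have := taylor z (step s z); rewrite Ez gradZ gv mulr1 /step -/e.
  rewrite normrZ exprMn.
  have hv : C * (`|eps * e| ^+ 2 * `|v z| ^+ 2) <= eps / 2 * `|e|.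
    rewrite normrM (gtr0_norm e0).
    have v2 : `|v z| ^+ 2 <= V ^+ 2 by rewrite lerXn2r ?nnegrE.
    rewrite (le_trans (ler_wpM2l C0 (ler_wpM2l (sqr_ge0 _) v2))) //.
    rewrite (_ : C * _ = (eps * `|e|) * ((C * V ^+ 2) * `|e| * eps)); last by ring.
    rewrite [eps / 2 * _]mulrAC; apply: ler_wpM2l; first by rewrite mulr_ge0 // ltW.
    apply: le_trans eD; rewrite ler_wpM2r ?(ltW e0) // ler_wpM2l ?mulr_ge0 ?sqr_ge0 //.
  move=> /le_trans/(_ hv) h2.
  rewrite (_ : s - _ = (1 - eps) * e - (psi (z + (eps * e) *: v z) - psi z - eps * e)); last first.
    by rewrite /e; ring.
  rewrite (le_trans (ler_normB _ _)) // normrM (ger0_norm (_ : 0 <= 1 - eps)) ?subr_ge0 //.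
  rewrite (le_trans (lerD (lexx _) h2)) // /rho -mulrDl ler_wpM2r //; lra.
have ZE n u : `|S u - psi (Z n u)| <= rho ^+ n * `|S u - psi (q u)|.
  elim: n => [|n IH]; first by rewrite expr0 mul1r.
  have h : `|S u - psi (Z n u)| <= E0.
    rewrite (le_trans IH) // -[leRHS]mul1r ler_pM ?exprn_ge0 //.
    by rewrite exprn_ile1 // ltW.
  by rewrite /= (le_trans (stepE _ _ h)) // exprS -mulrA ler_wpM2l.
have Zd n u : `|Z n.+1 u - Z n u| <= eps * V * `|S u - psi (q u)| * rho ^+ n.
  rewrite /= {1}/step addrAC subrr add0r normrZ normrM (gtr0_norm e0).
  rewrite (_ : eps * V * _ * _ = eps * (rho ^+ n * `|S u - psi (q u)|) * V); last by ring.
  by rewrite ler_pM ?mulr_ge0 ?(ltW e0) // ler_wpM2l ?(ltW e0) //; exact: ZE.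
have lim u : exists r : R * R, forall n, `|r - Z n u| <= 2 * V * `|S u - psi (q u)| * rho ^+ n.
  have A0 : 0 <= eps * V * `|S u - psi (q u)| by rewrite !mulr_ge0 // ltW.
  have [L1 H1] := @geometric_limit R (fun n => (Z n u).1) _ rho A0 rho01
    (fun n => le_trans (norm_fst (Z n.+1 u - Z n u)) (Zd n u)).
  have [L2 H2] := @geometric_limit R (fun n => (Z n u).2) _ rho A0 rho01
    (fun n => le_trans (norm_snd (Z n.+1 u - Z n u)) (Zd n u)).
  exists (L1, L2) => n; rewrite norm2_le /=.
  have E : eps * V * `|S u - psi (q u)| * rho ^+ n / (1 - rho) =
           2 * V * `|S u - psi (q u)| * rho ^+ n.
    by rewrite (_ : 1 - rho = eps / 2) /rho; [field; rewrite lt0r_neq0|ring].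
  by rewrite -E H1 H2.
have [r Hr] := choice lim.
have Hr' n u : `|r u - Z n u| <= 2 * V * E0 * rho ^+ n.
  by rewrite (le_trans (Hr u n)) // ler_wpM2r ?exprn_ge0 // ler_wpM2l ?mulr_ge0.
have cZ n : continuous (Z n).
  elim: n => [|n IH] // u /=.
  apply: cvgD; first exact: IH.
  apply: cvgZ; last by apply: (@continuous_comp _ _ _ (Z n) v); [exact: IH|exact: cv].
  apply: cvgM; first exact: cvg_cst.
  apply: cvgB; first exact: cS.
  by apply: (@continuous_comp _ _ _ (Z n) psi); [exact: IH|exact: cpsi].
have cr : continuous r.
  move=> u; apply/continuous_epsP => e e0'.
  pose K := 2 * V * E0 + 1.
  have K0 : 0 < K by rewrite ltr_wpDl // !mulr_ge0.
  have [n hn] := @geometric_small R rho (e / 3 / K) rho01 (divr_gt0 (divr_gt0 e0' (ltr0Sn R 2)) K0).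
  have sm u' : `|r u' - Z n u'| < e / 3.
    rewrite (le_lt_trans (Hr' n u')) //; move: hn; rewrite ltr_pdivlMr // => hn.
    by rewrite (le_lt_trans _ hn) // mulrC ler_wpM2l ?exprn_ge0 // lerDl.
  have /continuous_epsP/(_ _ (divr_gt0 e0' (ltr0Sn R 2)))[d d0 Hd] := cZ n u.
  exists d => // u' /Hd h.
  rewrite (_ : r u' - r u = (r u' - Z n u') + (Z n u' - Z n u) - (r u - Z n u)); last first.
    by rewrite addrA subrK opprB addrA subrK.
  rewrite (le_lt_trans (ler_normB _ _)) // (le_lt_trans (lerD (ler_normD _ _) (lexx _))) //.
  have := sm u; have := sm u'; move: h; lra.
exists r; split=> //.
- move=> u; apply/eqP; rewrite eq_sym -subr_eq0 -normr_le0; apply/ler_addgt0Pl => e e0'; rewrite addr0.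
  have /continuous_epsP/(_ _ (divr_gt0 e0' (ltr0Sn R 1)))[d d0 Hd] := @cpsi (r u).
  pose K := 2 * V * E0 + E0 + 1.
  have K0 : 0 < K by rewrite ltr_wpDl // addr_ge0 // !mulr_ge0.
  have m0 : 0 < Num.min d (e / 2) by rewrite lt_min d0 divr_gt0.
  have [n hn] := @geometric_small R rho (Num.min d (e / 2) / K) rho01 (divr_gt0 m0 K0).
  move: hn; rewrite ltr_pdivlMr // lt_min => /andP[h1 h2].
  have h3 : `|Z n u - r u| < d.
    rewrite distrC (le_lt_trans (Hr' n u)) // (le_lt_trans _ h1) // mulrC ler_wpM2l ?exprn_ge0 //.
    by rewrite /K -addrA lerDl addr_ge0.
  have h4 : `|S u - psi (Z n u)| <= e / 2.
    rewrite (le_trans (ZE n u)) // ltW // (le_lt_trans _ h2) // ler_wpM2l ?exprn_ge0 //.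
    by rewrite (le_trans (HE u)) // /K addrAC lerDr addr_ge0 // !mulr_ge0.
  have h5 := ltW (Hd _ h3).
  rewrite (_ : S u - _ = (S u - psi (Z n u)) + (psi (Z n u) - psi (r u))); last by ring.
  by rewrite (le_trans (ler_normD _ _)) // (le_trans (lerD h4 h5)) // -splitr.
- by move=> u; have := Hr' 0%N u; rewrite expr0 mulr1.
- move=> u Su; have := Hr u 0%N; rewrite Su subrr normr0 mulr0 mul0r normr_le0 subr_eq0.
  by move=> /eqP.
Qed.

End Levels.

(** * Level sets of the stream function are single orbits *)

Section Orbits.
Variable R : realType.
Implicit Types (x y z p w : R * R).
Variables (b : R * R -> R * R) (X : R -> R * R -> R * R) (K B : R).
Hypothesis K0 : 0 <= K.
Hypothesis LK : forall x y, `|b y - b x| <= K * `|y - x|.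
Hypothesis pb : Z2periodic b.
Hypothesis B0 : 0 <= B.
Hypothesis HB : forall x, `|b x| <= B.
Hypothesis HX : is_flow b X.
Variables (beta s0 : R) (sigma psi : R * R -> R).
Hypothesis beta0 : 0 < beta.
Hypothesis Hbeta : forall x, beta <= dot (b x) (b x).
Hypothesis s00 : 0 < s0.
Hypothesis Hs0 : forall x, s0 <= sigma x.
Hypothesis Cpsi : C1 psi.
Hypothesis psi1 : forall x, 'D_(1, 0) psi x = - (sigma x * (b x).2).
Hypothesis psi2 : forall x, 'D_(0, 1) psi x = sigma x * (b x).1.
Variables (C G L V M : R) (c : R * R).
Hypothesis C0 : 0 <= C.
Hypothesis taylor : forall x y, `|psi y - psi x - grad psi x (y - x)| <= C * `|y - x| ^+ 2.
Hypothesis G0 : 0 <= G.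
Hypothesis LG : forall x y w, `|grad psi y w - grad psi x w| <= G * `|y - x| * `|w|.
Hypothesis L0 : 0 <= L.
Hypothesis LL : forall x y, `|psi y - psi x| <= L * `|y - x|.
Hypothesis V0 : 0 <= V.
Hypothesis ret : forall (T : normedModType R) (S : T -> R) (q : T -> R * R) (E0 : R), continuous S ->
  continuous q -> (forall u, `|S u - psi (q u)| <= E0) ->
  exists r : T -> R * R, [/\ continuous r, forall u, psi (r u) = S u,
    forall u, `|r u - q u| <= 2 * V * E0 & forall u, S u = psi (q u) -> r u = q u].
Hypothesis M0 : 0 <= M.
Hypothesis psiM : forall x, `|psi x - dot (- c.2, c.1) x| <= M.
Hypothesis c0 : c != 0.

(** The gradient of psi is orthogonal to b. *)
Lemma psi_flow t x : psi (X t x) = psi x.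
Proof.
have [s _] := MVT_any 0 t (fun r => flow_path HX x r Cpsi).
have -> y : grad psi y (b y) = 0 by rewrite /grad psi1 psi2; ring.
rewrite (flow0 HX) mul0r.
by move=> /eqP; rewrite subr_eq0 => /eqP.
Qed.

Lemma psi_continuous : continuous psi.
Proof. by case: Cpsi. Qed.

(** Some t makes X t z - z' orthogonal to b z.  Being on the same level, the two points
    also differ by a vector that the gradient of psi annihilates up to second
    order; as b z and that gradient span the plane, the difference vanishes. *)
Lemma flow_box : exists rho D, [/\ 0 < rho, 0 < D & forall z z', `|z - z'| < rho ->
  psi z = psi z' -> exists2 t, `|t| <= D * `|z - z'| & X t z = z'].
Proof.
have B1 : 0 < B.
  rewrite lt_neqAle B0 andbT; apply/eqP => E; have := Hbeta 0.
  have := dot_le (b 0) (b 0); have := HB 0; rewrite -E normr_le0 => /eqP ->.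
  by rewrite normr0 mulr0 normr_le0 => /eqP ->; rewrite leNgt beta0.
have db x w : `|dot (b x) w| <= 2 * B * `|w|.
  by rewrite (le_trans (dot_le _ _)) // ler_wpM2r // ler_wpM2l.
(* a time during which b varies little enough for f to keep a slope of beta / 2 *)
pose tau := beta / (4 * B ^+ 2 * K + 1).
have den : 0 < 4 * B ^+ 2 * K + 1 by rewrite ltr_wpDl // !mulr_ge0 // sqr_ge0.
have tau0 : 0 < tau by rewrite divr_gt0.
pose D := 4 * B / beta.
have D0 : 0 < D by rewrite divr_gt0 // mulr_gt0.
pose E := B * D + 1.
have E0 : 0 < E by rewrite ltr_wpDl // mulr_ge0 // ltW.
have sb0 : 0 < s0 ^+ 2 * beta by rewrite mulr_gt0 // exprn_gt0.
pose kap := Num.sqrt (s0 ^+ 2 * beta).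
have kap0 : 0 < kap by rewrite sqrtr_gt0.
pose rho := Num.min (tau / (2 * D)) (kap / (2 * (C * E + G + 1))).
have CEG : 0 < C * E + G + 1 by rewrite ltr_wpDl // addr_ge0 // mulr_ge0 // ltW.
have rho0 : 0 < rho by rewrite lt_min !divr_gt0 // mulr_gt0.
exists rho, D; split=> // z z' zz' Ez.
pose d := `|z - z'|; have d0 : 0 <= d := normr_ge0 _.
have D20 : 0 < 2 * D by apply: mulr_gt0.
have F20 : 0 < 2 * (C * E + G + 1) by apply: mulr_gt0.
have d1 : D * d <= tau.
  have : d <= tau / (2 * D) by move: zz'; rewrite lt_min => /andP[/ltW].
  rewrite (ler_pdivlMr _ _ D20) => h; rewrite mulrC (le_trans _ h) //.
  by apply: ler_wpM2l => //; rewrite ler_peMl ?(ltW D0) // ler1n.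
have d2 : (C * E + G + 1) * d <= kap / 2.
  have : d <= kap / (2 * (C * E + G + 1)) by move: zz'; rewrite lt_min => /andP[_ /ltW].
  by rewrite (ler_pdivlMr _ _ F20) ler_pdivlMr // [d * _]mulrC -mulrA [_ * 2]mulrC.
pose f (t : R) := dot (b z) (X t z - z').
have Df (t : R) : is_derive t 1 f (dot (b z) (b (X t z))).
  have D1 := is_derive_fst (flow_sol HX z t); have D2 := is_derive_snd (flow_sol HX z t).
  apply/is_derive_epsP => e e0.
  have e0' : 0 < e / (2 * B) by rewrite divr_gt0 // mulr_gt0.
  have /is_derive_epsP/(_ _ e0')[r1 r10 H1] := D1.
  have /is_derive_epsP/(_ _ e0')[r2 r20 H2] := D2.
  exists (Num.min r1 r2); first by rewrite lt_min r10.
  move=> h; rewrite lt_min => /andP[h1 h2]; rewrite /f.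
  rewrite -dotB -dotZ -dotB (le_trans (db _ _)) // -ler_pdivlMl ?mulr_gt0 //.
  rewrite mulrA [_^-1 * _]mulrC norm2_le /=; apply/andP; split.
    rewrite (le_trans _ (H1 _ h1)) // [X in `|X|](_ : _ = (X (t + h) z).1 - (X t z).1 - h * (b (X t z)).1) //.
    by rewrite opprB addrA subrK.
  rewrite (le_trans _ (H2 _ h2)) // [X in `|X|](_ : _ = (X (t + h) z).2 - (X t z).2 - h * (b (X t z)).2) //.
  by rewrite opprB addrA subrK.
have cf : continuous f by move=> t; exact: (is_derive_continuous (Df t)).
have dfl t : `|t| <= D * d -> beta / 2 <= dot (b z) (b (X t z)).
  move=> td; have h : `|b (X t z) - b z| <= K * (B * tau).
    rewrite (le_trans (LK _ _)) // ler_wpM2l //.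
    have := flow_speed HB HX t 0 z; rewrite (flow0 HX) subr0 => /le_trans; apply.
    by rewrite ler_wpM2l // (le_trans td).
  have h2 : `|dot (b z) (b (X t z) - b z)| <= beta / 2.
    rewrite (le_trans (db _ _)) // (le_trans (ler_wpM2l _ h)) ?mulr_ge0 //.
    rewrite /tau (_ : 2 * B * (K * (B * (beta / (4 * B ^+ 2 * K + 1)))) = beta / 2 * (4 * B ^+ 2 * K / (4 * B ^+ 2 * K + 1))); last first.
      by field; rewrite lt0r_neq0.
    rewrite -[leRHS]mulr1 ler_wpM2l ?divr_ge0 ?(ltW beta0) // ler_pdivrMr // mul1r lerDl //.
  have := Hbeta z; move: h2; rewrite dotB ler_norml => /andP[h2 _] h3; lra.
have f0 : `|f 0| <= 2 * B * d by rewrite /f (flow0 HX); exact: db.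
have Dd0 : 0 <= D * d by rewrite mulr_ge0 // ltW.
have bDd : beta / 2 * (D * d) = 2 * B * d by rewrite /D; field; rewrite lt0r_neq0.
have fp : 0 <= f (D * d).
  have [t ht E1] := MVT_any 0 (D * d) Df; rewrite !subr0 (ger0_norm Dd0) in ht E1.
  have := ler_wpM2r Dd0 (dfl t ht); rewrite -E1 bDd.
  by move: f0; rewrite ler_norml => /andP[h _]; lra.
have fm : f (- (D * d)) <= 0.
  have [t ht E1] := MVT_any 0 (- (D * d)) Df; rewrite !subr0 normrN (ger0_norm Dd0) in ht E1.
  have := ler_wpM2r Dd0 (dfl t ht); rewrite bDd => h1.
  have : f (- (D * d)) - f 0 <= - (2 * B * d) by rewrite E1 mulrN lerN2.
  by move: f0; rewrite ler_norml => /andP[_ h]; lra.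
have [|||t] := @IVT R f (- (D * d)) (D * d) 0.
- by rewrite (le_trans _ Dd0) // oppr_le0.
- exact: continuous_subspaceT.
- by rewrite ge_min fm le_max fp orbT.
rewrite in_itv /= -ler_norml => td ft; exists t => //.
pose w := X t z - z'.
have wd : `|w| <= E * d.
  rewrite /w (_ : _ - _ = (X t z - z) + (z - z')); last by rewrite addrA subrK.
  rewrite (le_trans (ler_normD _ _)) // /E mulrDl mul1r lerD //.
  have := flow_speed HB HX t 0 z; rewrite (flow0 HX) subr0 => /le_trans; apply.
  by rewrite -mulrA ler_wpM2l.
have g1 : `|grad psi z' w| <= C * `|w| ^+ 2.
  have := taylor z' (X t z); rewrite psi_flow Ez subrr sub0r normrN.
  by [].
have g2 : `|grad psi z w| <= kap / 2 * `|w|.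
  rewrite (_ : grad psi z w = (grad psi z w - grad psi z' w) + grad psi z' w); last by rewrite subrK.
  rewrite (le_trans (ler_normD _ _)) // (le_trans (lerD (LG _ _ _) g1)) //.
  rewrite -/d expr2 mulrA -mulrDl ler_wpM2r //.
  rewrite (le_trans _ d2) // addrC !mulrDl mul1r -addrA lerD //; last by rewrite lerDl.
  by rewrite -mulrA ler_wpM2l.
have g3 : s0 ^+ 2 * beta * `|w| ^+ 2 <= grad psi z w ^+ 2.
  have E2 : grad psi z w ^+ 2 = sigma z ^+ 2 * (dot (b z) (b z) * dot w w - dot (b z) w ^+ 2).
    by rewrite /grad psi1 psi2 /dot; ring.
  rewrite E2 /w -/(f t) ft expr0n /= subr0 mulrA ler_pM ?sqr_ge0 ?(ltW sb0) //.
    rewrite ler_pM ?sqr_ge0 ?(ltW beta0) ?Hbeta // lerXn2r ?nnegrE ?(ltW s00) //.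
    exact: (le_trans (ltW s00)).
  rewrite -/w {1}prod_normE /dot -!expr2 -[w.1 ^+ 2]real_normK ?num_real //.
  rewrite -[w.2 ^+ 2]real_normK ?num_real // /Num.max.
  by case: ifP => _; rewrite (lerDl, lerDr) sqr_ge0.
apply/eqP; rewrite -subr_eq0 -/w -normr_le0; rewrite leNgt; apply/negP => w0.
have : s0 ^+ 2 * beta * `|w| ^+ 2 <= (kap / 2 * `|w|) ^+ 2.
  apply: (le_trans g3); rewrite -[leLHS]real_normK ?num_real // lerXn2r ?nnegrE //.
  by rewrite mulr_ge0 // divr_ge0 // ltW.
rewrite exprMn ler_pM2r ?exprn_gt0 // exprMn sqr_sqrtr ?(ltW sb0) //.
rewrite -[leLHS]mulr1 ler_pM2l //; apply/negP; rewrite -ltNge expr2; lra.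
Qed.


(** Join the two points by a path and retract it onto their common level.  By
    [flow_box] the parameters whose image lies on the orbit of z form an open set,
    and so do the others; the line is connected. *)
Lemma level_orbit z z' : psi z = psi z' -> exists t, X t z = z'.
Proof.
move=> Ez; have [rho [D [rho0 _ box]]] := flow_box.
(* a path defined on the whole line, with bounded image, from z at 0 to z' at pi/2 *)
pose q (u : R) := z + (sin u ^+ 2) *: (z' - z).
have cq : continuous q.
  move=> u; apply: cvgD; first exact: cvg_cst.
  apply: cvgZr_tmp; apply: cvgM; exact: continuous_sin.
have hq u : `|psi z - psi (q u)| <= L * `|z' - z|.
  rewrite (le_trans (LL _ _)) // ler_wpM2l // /q opprD addrA subrr sub0r normrN normrZ.
  by rewrite ler_piMl // normrX expr_le1 // ler_norml sin_geN1 sin_le1.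
have cst : continuous (fun _ : R => psi z) by move=> u; exact: cvg_cst.
have [r [cr psir _ rq]] := ret cst cq hq.
have q0 : q 0 = z by rewrite /q sin0 expr0n /= scale0r addr0.
have q1 : q (pi / 2) = z' by rewrite /q sin_pihalf expr1n scale1r addrC subrK.
have r0 : r 0 = z by rewrite rq ?q0.
have r1 : r (pi / 2) = z' by rewrite rq ?q1.
pose P u := exists t, X t z = r u.
apply: contrapT => nP.
(* a continuous function with values in {0, 1}, by openness of both alternatives *)
pose chi (u : R) : R := if pselect (P u) then 0 else 1.
have cchi : continuous chi.
  move=> u; apply/continuous_epsP => e e0.
  have /continuous_epsP/(_ _ rho0)[d d0 Hd] := cr u.
  exists d => // u' /Hd h; suff -> : chi u' = chi u by rewrite subrr normr0.
  have [t _ Ht] : exists2 t, `|t| <= D * `|r u' - r u| & X t (r u') = r u.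
    by apply: box => //; rewrite !psir.
  rewrite /chi; case: pselect => [[s Hs]|n1]; case: pselect => [[s' Hs']|n2] //.
    by exfalso; apply: n2; exists (t + s); rewrite (flowD K0 LK HX) Hs.
  exfalso; apply: n1; exists (- t + s'); rewrite (flowD K0 LK HX) Hs' -Ht.
  exact: (flowK K0 LK HX).
have c0' : chi 0 = 0.
  by rewrite /chi; case: pselect => // n; exfalso; apply: n; exists 0; rewrite (flow0 HX) r0.
have c1' : chi (pi / 2) = 1.
  by rewrite /chi; case: pselect => // -[t Ht]; exfalso; apply: nP; exists t; rewrite Ht.
have [|||u _] := @IVT R chi 0 (pi / 2) (1 / 2).
- by rewrite divr_ge0 // pi_ge0.
- exact: continuous_subspaceT.
- rewrite c0' c1' ge_min le_max; lra.
have : chi u = 0 \/ chi u = 1 by rewrite /chi; case: pselect => ?; [left|right].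
by move=> [] -> ?; lra.
Qed.

(** Moving along c changes psi by a bounded amount, which the retraction corrects by
    a bounded displacement. *)
Lemma shift_level (w : R) : exists z : R * R -> R * R, [/\ continuous z,
  forall x, psi (z x) = psi x & forall x, `|z x - (x + w *: c)| <= 4 * V * M].
Proof.
have cq : continuous (fun x => x + w *: c).
  by move=> x; apply: cvgD; [exact: cvg_id|exact: cvg_cst].
have hq x : `|psi x - psi (x + w *: c)| <= 2 * M.
  rewrite (_ : psi x - _ = (psi x - dot (- c.2, c.1) x) -
      (psi (x + w *: c) - dot (- c.2, c.1) (x + w *: c))); last first.
    by rewrite dotD dotZ {3}/dot /=; ring.
  by rewrite (le_trans (ler_normB _ _)) // mulr_natl mulr2n lerD.
have [z [cz psiz zq _]] := ret psi_continuous cq hq.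
exists z; split=> // x; rewrite (le_trans (zq x)) //.
by rewrite (_ : 2 * V * (2 * M) = 4 * V * M) //; ring.
Qed.

Lemma dotcc : 0 < dot c c.
Proof.
rewrite lt_neqAle eq_sym /dot -!expr2 addr_ge0 ?sqr_ge0 // andbT.
rewrite paddr_eq0 ?sqr_ge0 // !sqrf_eq0; apply: contra c0 => /andP[/eqP h1 /eqP h2].
by rewrite [c]surjective_pairing h1 h2.
Qed.

(** A periodic orbit would be bounded, yet it fills its level set, which is unbounded. *)
Lemma no_periodic_orbit x t : X t x = x -> t = 0.
Proof.
move=> Xt; apply/eqP/negPn/negP => t0.
have Xn (n : nat) : X (n%:R * t) x = x.
  elim: n => [|n IH]; first by rewrite mul0r (flow0 HX).
  by rewrite -natr1 mulrDl mul1r (flowD K0 LK HX) Xt IH.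
have Xz (m : int) : X (m%:~R * t) x = x.
  case: m => n; first by rewrite -pmulrn Xn.
  by rewrite NegzE mulrNz mulNr -{1}(Xn n.+1) -pmulrn (flowK K0 LK HX).
have bd y : psi y = psi x -> `|y - x| <= B * `|t|.
  move=> /esym /level_orbit[s <-].
  (* reduce the time modulo the period t *)
  pose m := Num.floor (s / t); pose s' := s - m%:~R * t.
  have -> : X s x = X s' x.
    by rewrite -[in LHS](subrK (m%:~R * t) s) (flowD K0 LK HX) Xz.
  have := flow_speed HB HX s' 0 x; rewrite (flow0 HX) subr0 => /le_trans; apply.
  apply: ler_wpM2l => //; rewrite /s' -[s in s - _](divfK t0) -mulrBl normrM.
  rewrite -[leRHS]mul1r ler_wpM2r // ger0_norm ?subr_ge0 ?Num.Theory.floor_le //.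
  by rewrite lerBlDr addrC -intrD1 ltW // Num.Theory.floorD1_gt.
pose N := B * `|t| + 4 * V * M + 1.
have N0 : 0 <= N by rewrite !addr_ge0 // !mulr_ge0.
have [z [_ psiz zw]] := shift_level (N / `|c|).
have := bd (z x) (psiz x); have := zw x.
have nc : `|N / `|c| *: c| = N.
  by rewrite normrZ normrM normfV normr_id mulfVK ?normr_eq0 // ger0_norm.
have : `|N / `|c| *: c| <= `|z x - x| + `|z x - (x + N / `|c| *: c)|.
  rewrite -[X in `|X|](_ : (z x - x) - (z x - (x + N / `|c| *: c)) = _) ?ler_normB //.
  by rewrite opprB addrC subrKA addrAC subrr add0r.
rewrite nc => h1 h2 h3; have := le_trans h1 (lerD h3 h2).
by rewrite /N leNgt ltrDl ltr01.
Qed.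

(** For large w the point z x on the level of x near x + w c is reached at a unique
    nonzero time tm x.  Uniqueness and [flow_box] make tm continuous, hence of
    constant sign, and bounded since only one period matters. *)
Lemma flow_drift : exists2 T, 0 < T & exists2 s : R, s = 1 \/ s = - 1 &
  forall x, 1 <= dot (s *: c) (X T x - x).
Proof.
have [rho [D [rho0 D0 box]]] := flow_box.
(* large enough for the advance to exceed 1 despite the error 4 V M of the retraction *)
pose w := (1 + 8 * `|c| * V * M) / dot c c.
have [z [cz psiz zw]] := shift_level w.
have za x : 1 <= dot c (z x - x).
  rewrite (_ : z x - x = (z x - (x + w *: c)) + w *: c); last first.
    by rewrite opprD addrA subrK.
  rewrite dotD dotZ /w divfK ?gt_eqF ?dotcc //.
  have : `|dot c (z x - (x + w *: c))| <= 2 * `|c| * (4 * V * M).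
    by rewrite (le_trans (dot_le _ _)) // ler_wpM2l // mulr_ge0.
  rewrite ler_norml => /andP[h _]; move: h; rewrite /w.
  rewrite (_ : 2 * `|c| * (4 * V * M) = 8 * `|c| * V * M); last by ring.
  lra.
have lvl x : exists t, X t x = z x by exact: (level_orbit (esym (psiz x))).
have [tm Ht] := choice lvl.
have tm0 x : tm x != 0.
  apply/eqP => E; have := za x; rewrite -Ht E (flow0 HX) subrr /dot /= mulr0 mulr0 addr0.
  by rewrite ler10.
have ctm : continuous tm.
  move=> x; apply/continuous_epsP => e e0.
  pose e' := Num.min rho (e / (2 * D)).
  have D20 : 0 < 2 * D by apply: mulr_gt0.
  have e'0 : 0 < e' / 2 by rewrite divr_gt0 // lt_min rho0 divr_gt0.
  have cX := @flow_continuous R b X K K0 LK HX (tm x) x.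
  have /continuous_epsP/(_ _ e'0)[d1 d10 H1] := cX.
  have /continuous_epsP/(_ _ e'0)[d2 d20 H2] := cz x.
  exists (Num.min d1 d2); first by rewrite lt_min d10.
  move=> y; rewrite lt_min => /andP[/H1 h1 /H2 h2].
  have h3 : `|X (tm x) y - z y| < e'.
    rewrite (_ : _ - _ = (X (tm x) y - X (tm x) x) + (z x - z y)); last first.
      by rewrite Ht addrA subrK.
    rewrite (le_lt_trans (ler_normD _ _)) // [`|z x - _|]distrC [e']splitr.
    exact: ltrD.
  have [h4 h5] : `|X (tm x) y - z y| < rho /\ `|X (tm x) y - z y| < e / (2 * D).
    by move: h3; rewrite lt_min => /andP[].
  have [|s sd Xs] := box _ _ h4; first by rewrite psi_flow psiz.
  have : X (- tm y + (s + tm x)) y = y.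
    by rewrite (flowD K0 LK HX) (flowD K0 LK HX s) Xs -Ht (flowK K0 LK HX).
  move=> /no_periodic_orbit E; rewrite (_ : tm y - tm x = s); last by lra.
  rewrite (le_lt_trans sd) //; move: h5; rewrite ltr_pdivlMr // => h5.
  by apply: le_lt_trans h5; rewrite mulrC ler_wpM2l // ler_peMl ?(ltW D0) // ler1n.
have ccs : compact (`[0, 1]%classic `*` `[0, 1]%classic : set (R * R)) := @closed_square_compact R.
have [||xm _ Hm] := @compact_EVT_max _ _ (fun x => `|tm x|) _ _ ccs.
- by exists (0, 0); split; rewrite /= in_itv /= lexx ler01.
- by apply: continuous_subspaceT; move=> ?; apply: cvg_norm; exact: ctm.
pose Ts := `|tm xm|.
have Ts0 : 0 < Ts by rewrite normr_gt0.
have red x : exists k, `|tm (x + lattice R k)| <= Ts /\ X (tm (x + lattice R k)) x - x = z (x + lattice R k) - (x + lattice R k).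
  have [k kx] := closed_square_reduce x; exists k; split; first by apply: Hm; rewrite inE.
  by rewrite -Ht (flow_lattice K0 LK pb HX) opprD addrACA subrr addr0.
have [tpos|tneg] := nonvanishing_sign ctm tm0.
  have [||||T T0 HT] := @drift_iter R X B Ts c B0 Ts0.
  - exact: (flow0 HX).
  - by move=> s t x; exact: (flowD K0 LK HX).
  - by move=> s t x; exact: (flow_speed HB HX).
  - move=> x; have [k [k1 k2]] := red x; exists (tm (x + lattice R k)).
      by rewrite tpos (le_trans (ler_norm _)).
    by rewrite k2.
  exists T => //; exists 1; first by left.
  by move=> x; rewrite scale1r.
have [||||T T0 HT] := @drift_iter R (fun s => X (- s)) B Ts c B0 Ts0.
- by move=> x; rewrite oppr0 (flow0 HX).
- by move=> s t x; rewrite opprD (flowD K0 LK HX).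
- move=> s t x; rewrite (le_trans (flow_speed HB HX _ _ _)) //.
  by rewrite -opprD normrN.
- move=> x; have [k [k1 k2]] := red x; exists (- tm (x + lattice R k)).
    by rewrite oppr_gt0 tneg (le_trans (ler_norm _)) // normrN.
  by rewrite opprK k2.
exists T => //; exists (-1); first by right.
move=> x; have := HT (X T x); rewrite (flowK K0 LK HX).
by rewrite (_ : dot c _ = dot (-1 *: c) (X T x - x)) // /dot /= /GRing.scale /=; ring.
Qed.

End Orbits.

(** * A smooth function increasing along the flow *)

Section Grad.
Variable R : realType.
Implicit Types (f g : R * R -> R) (x y z p v w : R * R).

Lemma gradD n m f g x v : classC n.+1 f -> classC m.+1 g ->
  grad (fun x => f x + g x) x v = grad f x v + grad g x v.
Proof.
move=> Hf Hg; rewrite /grad.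
have [_ ->] := is_deriveD (classC_derive1 x Hf) (classC_derive1 x Hg).
have [_ ->] := is_deriveD (classC_derive2 x Hf) (classC_derive2 x Hg).
move: ('D_(1, 0) f x) ('D_(1, 0) g x) ('D_(0, 1) f x) ('D_(0, 1) g x) => *; ring.
Qed.

Lemma gradM n m f g x v : classC n.+1 f -> classC m.+1 g ->
  grad (fun x => f x * g x) x v = f x * grad g x v + g x * grad f x v.
Proof. by move=> Hf Hg; rewrite /grad (deriveM_e1 x Hf Hg) (deriveM_e2 x Hf Hg);
  move: ('D_(1, 0) f x) ('D_(1, 0) g x) ('D_(0, 1) f x) ('D_(0, 1) g x) => *; ring. Qed.

Lemma grad_cst (a : R) x v : grad (fun=> a) x v = 0.
Proof.
rewrite /grad; have [_ ->] := is_derive_cst a x ((1, 0) : R * R).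
by have [_ ->] := is_derive_cst a x ((0, 1) : R * R); rewrite !mul0r addr0.
Qed.

Lemma gradCM n (a : R) f x v : classC n.+1 f -> grad (fun x => a * f x) x v = a * grad f x v.
Proof.
by move=> Hf; rewrite (gradM x v (classC_cst 1 a) Hf) grad_cst mulr0 addr0.
Qed.

Lemma grad_fst x v : grad (fun x : R * R => x.1) x v = v.1.
Proof.
rewrite /grad.
have [_ ->] : is_derive x (1, 0) (fun x : R * R => x.1) 1.
  by apply: slice1_derive; exact: is_derive_id.
have [_ ->] : is_derive x (0, 1) (fun x : R * R => x.1) 0.
  by apply: slice2_derive; exact: is_derive_cst.
by rewrite mul1r mul0r addr0.
Qed.

Lemma grad_snd x v : grad (fun x : R * R => x.2) x v = v.2.
Proof.
rewrite /grad.
have [_ ->] : is_derive x (1, 0) (fun x : R * R => x.2) 0.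
  by apply: slice1_derive; exact: is_derive_cst.
have [_ ->] : is_derive x (0, 1) (fun x : R * R => x.2) 1.
  by apply: slice2_derive; exact: is_derive_id.
by rewrite mul1r mul0r add0r.
Qed.

Lemma grad_comp n f g1 g2 x v : classC n.+1 f -> classC n.+1 g1 -> classC n.+1 g2 ->
  grad (fun x => f (g1 x, g2 x)) x v = grad f (g1 x, g2 x) (grad g1 x v, grad g2 x v).
Proof.
move=> Hf H1 H2; rewrite /grad /=.
have [_ ->] := is_derive_comp1 x Hf H1 H2; have [_ ->] := is_derive_comp2 x Hf H1 H2.
set a := 'D_(1, 0) f _; set a' := 'D_(0, 1) f _.
move: a a' ('D_(1, 0) g1 x) ('D_(0, 1) g1 x) ('D_(1, 0) g2 x) ('D_(0, 1) g2 x) => *; ring.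
Qed.


Lemma gradB f x v w : grad f x (v - w) = grad f x v - grad f x w.
Proof. by rewrite /grad /=; move: ('D_(1, 0) f x) ('D_(0, 1) f x) => *; ring. Qed.


Lemma grad_bound n f : classC n.+1 f -> Z2periodic f ->
  exists2 G, 0 <= G & forall x v, `|grad f x v| <= G * `|v|.
Proof.
move=> Hf pf.
have [A A0 HA] := periodic_bounded (classC_cont (classC_d1 Hf)) (periodic_derive (1, 0) pf).
have [B B0 HB] := periodic_bounded (classC_cont (classC_d2 Hf)) (periodic_derive (0, 1) pf).
exists (A + B); first exact: addr_ge0.
move=> x v; rewrite (le_trans (ler_normD _ _)) // mulrDl.
by rewrite lerD // normrM_le ?norm_fst ?norm_snd.
Qed.

Lemma Taylor_periodic n f : classC n.+2 f -> Z2periodic f ->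
  exists2 C, 0 <= C & forall x y, `|f y - f x - grad f x (y - x)| <= C * `|y - x| ^+ 2.
Proof.
move=> Hf pf; have [_ [d1 d2 c1 c2]] := Hf.
apply: Taylor_Lip d1 d2 _ _.
  exact: (periodic_Lip c1 (periodic_derive (1, 0) pf)).
exact: (periodic_Lip c2 (periodic_derive (0, 1) pf)).
Qed.

End Grad.

Section Euler.
Variable R : realType.
Implicit Types (f g : R * R -> R) (x y z p v w : R * R).

Lemma discrete_Gronwall (a : nat -> R) (G C delta : R) : 0 <= G -> 0 <= C -> 0 <= delta ->
  a 0%N <= 0 -> (forall m, a m.+1 <= (1 + delta * G) * a m + C * delta ^+ 2) ->
  forall m, a m <= m%:R * (C * delta ^+ 2) * expR (m%:R * (delta * G)).
Proof.
move=> G0 C0 d0 a0 step; elim=> [|m IH]; first by rewrite mul0r mul0r.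
have dG : 0 <= delta * G by rewrite mulr_ge0.
have Cd : 0 <= C * delta ^+ 2 by rewrite mulr_ge0 ?sqr_ge0.
have e1 : 1 + delta * G <= expR (delta * G) by exact: expR_ge1Dx.
apply: (le_trans (step m)); rewrite -natr1 [(m%:R + 1) * (delta * G)]mulrDl mul1r expRD.
set E := expR (m%:R * _) in IH *; set e := expR (delta * G) in e1 *.
set q := C * delta ^+ 2 in Cd IH *.
have E1 : 1 <= E by rewrite -expR0 ler_expR mulr_ge0.
have e11 : 1 <= e by rewrite (le_trans _ e1) // lerDl.
have h1 : (1 + delta * G) * a m <= e * (m%:R * q * E).
  rewrite (le_trans (ler_wpM2l (addr_ge0 ler01 dG) IH)) // ler_wpM2r // !mulr_ge0 ?ler0n //.
  exact: le_trans ler01 E1.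
have h2 : q <= q * (E * e) by rewrite ler_peMr // (le_trans e11) // ler_peMl // (le_trans ler01).
by rewrite (le_trans (lerD h1 h2)) // (_ : (m%:R + 1) * q * _ = e * (m%:R * q * E) + q * (E * e)) //; ring.
Qed.

Variables (b : R * R -> R * R) (X : R -> R * R -> R * R) (r : nat).
Hypothesis Hb : Csharp2 r.+3 b.
Hypothesis HX : is_flow b X.

Let b1 x := (b x).1.
Let b2 x := (b x).2.
Let cb1 : classC r.+3 b1. Proof. by case: Hb => [[]]. Qed.
Let cb2 : classC r.+3 b2. Proof. by case: Hb => [_ []]. Qed.
Let pb1 : Z2periodic b1. Proof. by case: Hb => [[]]. Qed.
Let pb2 : Z2periodic b2. Proof. by case: Hb => [_ []]. Qed.

(** Stands in for the flow: smoothness of these maps is immediate from that of b,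
    whereas differentiating X with respect to x would need the variational equation. *)
Definition euler (delta : R) m x := iter m (fun y => y + delta *: b y) x.

Lemma euler_classC delta m : classC r.+3 (fun x => (euler delta m x).1) /\
  classC r.+3 (fun x => (euler delta m x).2).
Proof.
elim: m => [|m [IH1 IH2]]; first by split; [exact: classC_fst|exact: classC_snd].
have E : (fun x => euler delta m x) = (fun x => ((euler delta m x).1, (euler delta m x).2)).
  by apply/funext => x; rewrite -surjective_pairing.
split.
- rewrite (_ : (fun _ => _) = (fun x => (euler delta m x).1 +
    delta * b1 ((euler delta m x).1, (euler delta m x).2))).
    exact: (classCD IH1 (classCZ _ (classC_comp cb1 IH1 IH2))).
  by apply/funext => x; rewrite -surjective_pairing.
- rewrite (_ : (fun _ => _) = (fun x => (euler delta m x).2 +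
    delta * b2 ((euler delta m x).1, (euler delta m x).2))).
    exact: (classCD IH2 (classCZ _ (classC_comp cb2 IH1 IH2))).
  by apply/funext => x; rewrite -surjective_pairing.
Qed.

Lemma euler_lattice delta m x k : euler delta m (x + lattice R k) = euler delta m x + lattice R k.
Proof.
elim: m => // m IH; rewrite /euler !iterS -!/(euler _ _ _) IH (b_periodic Hb).
by rewrite addrAC.
Qed.

(** The differential of a flow map carries b to b; that of the Euler map does so up to
    an error proportional to the step. *)
Lemma euler_push (T : R) : 0 < T -> exists2 A, 0 <= A & forall (delta : R) m x, 0 <= delta ->
  m%:R * delta <= T ->
  `|(grad (fun x => (euler delta m x).1) x (b x), grad (fun x => (euler delta m x).2) x (b x))
    - b (euler delta m x)| <= A * delta.
Proof.
move=> T0.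
have [B B0 HB] := b_bounded Hb.
have [G1 G10 HG1] := grad_bound cb1 pb1; have [G2 G20 HG2] := grad_bound cb2 pb2.
have [C1 C10 HC1] := Taylor_periodic cb1 pb1; have [C2 C20 HC2] := Taylor_periodic cb2 pb2.
pose G := G1 + G2; pose C := (C1 + C2) * B ^+ 2.
have G0 : 0 <= G by exact: addr_ge0.
have C0 : 0 <= C by rewrite mulr_ge0 ?sqr_ge0 ?addr_ge0.
exists (T * C * expR (T * G)); first by apply: mulr_ge0; [apply: mulr_ge0; [exact: ltW|]|exact: expR_ge0].
move=> delta m x d0 mT.
pose D m := (grad (fun x => (euler delta m x).1) x (b x), grad (fun x => (euler delta m x).2) x (b x)).
pose a m := `|D m - b (euler delta m x)|.
have DS n : D n.+1 = (( D n).1 + delta * grad b1 (euler delta n x) (D n),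
                      ( D n).2 + delta * grad b2 (euler delta n x) (D n)).
  have [e1 e2] := euler_classC delta n.
  rewrite /D; congr pair.
  - rewrite (_ : (fun _ => _) = (fun x => (euler delta n x).1 +
      delta * b1 ((euler delta n x).1, (euler delta n x).2))); last first.
      by apply/funext => y; rewrite -surjective_pairing.
    rewrite (gradD _ _ e1 (classCZ _ (classC_comp cb1 e1 e2))).
    by rewrite (gradCM _ _ _ (classC_comp cb1 e1 e2)) (grad_comp _ _ cb1 e1 e2) -surjective_pairing.
  - rewrite (_ : (fun _ => _) = (fun x => (euler delta n x).2 +
      delta * b2 ((euler delta n x).1, (euler delta n x).2))); last first.
      by apply/funext => y; rewrite -surjective_pairing.
    rewrite (gradD _ _ e2 (classCZ _ (classC_comp cb2 e1 e2))).
    by rewrite (gradCM _ _ _ (classC_comp cb2 e1 e2)) (grad_comp _ _ cb2 e1 e2) -surjective_pairing.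
have step n : a n.+1 <= (1 + delta * G) * a n + C * delta ^+ 2.
  rewrite /a DS; set y := euler delta n x; set d := D n.
  have -> : euler delta n.+1 x = y + delta *: b y by [].
  have ny : `|y + delta *: b y - y| ^+ 2 <= B ^+ 2 * delta ^+ 2.
    rewrite addrAC subrr add0r normrZ ger0_norm // exprMn mulrC ler_wpM2r ?sqr_ge0 //.
    by rewrite lerXn2r ?nnegrE.
  have key (bi : R * R -> R) (di Gi Ci : R) : 0 <= Gi -> 0 <= Ci -> Gi <= G -> Ci <= C1 + C2 ->
    (forall x v, `|grad bi x v| <= Gi * `|v|) ->
    (forall x y, `|bi y - bi x - grad bi x (y - x)| <= Ci * `|y - x| ^+ 2) ->
    `|di - bi y| <= `|d - b y| ->
    `|di + delta * grad bi y d - bi (y + delta *: b y)| <= (1 + delta * G) * `|d - b y| + C * delta ^+ 2.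
    move=> Gi0 Ci0 GiG CiC HG HC hd.
    have h1 := HC y (y + delta *: b y).
    rewrite [X in grad bi y X](_ : _ = delta *: b y) in h1; last by rewrite addrAC subrr add0r.
    rewrite gradZ in h1.
    have h2 : `|grad bi y (d - b y)| <= G * `|d - b y|.
      by rewrite (le_trans (HG _ _)) // ler_wpM2r.
    have h3 : Ci * `|y + delta *: b y - y| ^+ 2 <= C * delta ^+ 2.
      rewrite (le_trans (ler_wpM2l Ci0 ny)) // /C mulrA ler_wpM2r ?sqr_ge0 //.
      by rewrite ler_wpM2r ?sqr_ge0.
    rewrite gradB in h2.
    rewrite (_ : _ - _ = (di - bi y) + delta * (grad bi y d - grad bi y (b y))
      - (bi (y + delta *: b y) - bi y - delta * grad bi y (b y))); last by ring.
    rewrite (le_trans (ler_normB _ _)) // lerD //; last exact: le_trans h1 h3.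
    rewrite (le_trans (ler_normD _ _)) // mulrDl mul1r lerD // -mulrA.
    by rewrite normrM (ger0_norm d0) ler_wpM2l.
  rewrite norm2_le; apply/andP; split.
  - apply: (key b1 _ G1 C1) => //; rewrite ?lerDl //.
    exact: (norm_fst (d - b y)).
  - apply: (key b2 _ G2 C2) => //; rewrite ?lerDr //.
    exact: (norm_snd (d - b y)).
have a0 : a 0%N <= 0.
  by rewrite /a /D /euler /= grad_fst grad_snd -surjective_pairing subrr normr0.
have := discrete_Gronwall G0 C0 d0 a0 step m => /le_trans; apply.
rewrite expr2 (_ : m%:R * (C * (delta * delta)) = (m%:R * delta) * (C * delta)); last by ring.
rewrite (_ : T * C * expR (T * G) * delta = T * (C * delta) * expR (T * G)); last by ring.
have Cd := mulr_ge0 C0 d0; have md := mulr_ge0 (ler0n R m) d0.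
apply: ler_pM; [exact: mulr_ge0|exact: expR_ge0|exact: ler_wpM2r|].
by rewrite ler_expR mulrA; exact: ler_wpM2r.
Qed.

Lemma euler_flow (T : R) : 0 < T -> exists2 A, 0 <= A & forall (delta : R) m x, 0 <= delta ->
  m%:R * delta <= T -> `|euler delta m x - X (m%:R * delta) x| <= A * delta.
Proof.
move=> T0.
have [B B0 HB] := b_bounded Hb; have [K K0 LK] := b_Lip Hb.
have C0 : 0 <= K * B by rewrite mulr_ge0.
exists (T * (K * B) * expR (T * K)); first by rewrite !mulr_ge0 ?expR_ge0 ?(ltW T0).
move=> delta m x d0 mT.
pose a m := `|euler delta m x - X (m%:R * delta) x|.
have loc y : `|X delta y - y - delta *: b y| <= K * B * delta ^+ 2.
  have bnd c : `|c - 0| <= `|delta - 0| -> `|b (X c y) - b y| <= K * (B * delta).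
    rewrite !subr0 => hc; rewrite (le_trans (LK _ _)) // ler_wpM2l //.
    have := flow_speed HB HX c 0 y; rewrite (flow0 HX) subr0 => /le_trans; apply.
    by rewrite ler_wpM2l // (le_trans hc) // ger0_norm.
  have [c hc E1] := MVT_any 0 delta (fun s => is_derive_fst (flow_sol HX y s)).
  have [d hd E2] := MVT_any 0 delta (fun s => is_derive_snd (flow_sol HX y s)).
  rewrite (flow0 HX) subr0 in E1; rewrite (flow0 HX) subr0 in E2.
  have KB : K * B * delta ^+ 2 = (K * (B * delta)) * delta by rewrite expr2 !mulrA.
  rewrite norm2_le; apply/andP; split; rewrite /= ?E1 ?E2 KB.
    rewrite [X in `|X|](_ : _ = ((b (X c y)).1 - (b y).1) * delta); last by rewrite mulrBl [(b y).1 * _]mulrC.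
    apply: normrM_le; last by rewrite ger0_norm.
    exact: (le_trans (norm_fst (b (X c y) - b y)) (bnd c hc)).
  rewrite [X in `|X|](_ : _ = ((b (X d y)).2 - (b y).2) * delta); last by rewrite mulrBl [(b y).2 * _]mulrC.
  apply: normrM_le; last by rewrite ger0_norm.
  exact: (le_trans (norm_snd (b (X d y) - b y)) (bnd d hd)).
have step n : a n.+1 <= (1 + delta * K) * a n + K * B * delta ^+ 2.
  have -> : a n.+1 = `|euler delta n.+1 x - X (delta + n%:R * delta) x|.
    by rewrite /a -natr1 mulrDl mul1r [delta + _]addrC.
  rewrite (flowD K0 LK HX).
  have -> : euler delta n.+1 x = euler delta n x + delta *: b (euler delta n x) by [].
  set y := euler delta n x; set z := X _ x.
  rewrite [X in `|X|](_ : _ = (y - z) + delta *: (b y - b z) - (X delta z - z - delta *: b z)); last first.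
    rewrite scalerBr; move: y z (X delta z) (delta *: b y) (delta *: b z).
    by move=> [y1 y2] [z1 z2] [q1 q2] [u1 u2] [w1 w2]; congr pair; rewrite /=; ring.
  rewrite (le_trans (ler_normB _ _)) // lerD // (le_trans (ler_normD _ _)) //.
  by rewrite mulrDl mul1r lerD // normrZ ger0_norm // -mulrA ler_wpM2l.
have a0 : a 0%N <= 0 by rewrite /a /euler /= mul0r (flow0 HX) subrr normr0.
have := discrete_Gronwall K0 C0 d0 a0 step m => /le_trans; apply.
rewrite expr2 (_ : m%:R * (K * B * (delta * delta)) = (m%:R * delta) * (K * B * delta)); last by ring.
rewrite (_ : T * (K * B) * expR (T * K) * delta = T * (K * B * delta) * expR (T * K)); last by ring.
have Cd := mulr_ge0 C0 d0; have md := mulr_ge0 (ler0n R m) d0.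
apply: ler_pM; [exact: mulr_ge0|exact: expR_ge0|exact: ler_wpM2r|].
by rewrite ler_expR mulrA; exact: ler_wpM2r.
Qed.

(** Along exact orbits the average of the linear form of p over a time T has
    derivative p.(X T x - x) / T, which is positive; for a fine enough Euler scheme
    the errors of [euler_push] and [euler_flow] do not spoil this. *)
Lemma transversal_function (T : R) p : 0 < T -> (forall x, 1 <= dot p (X T x - x)) ->
  exists h : R * R -> R, [/\ classC r.+3 h, forall x k, h (x + lattice R k) = h x + dot p (lattice R k)
   & forall x, 0 < grad h x (b x)].
Proof.
move=> T0 adv; have [A1 A10 H1] := euler_push T0; have [A2 A20 H2] := euler_flow T0.
pose P := 2 * `|p|; have P0 : 0 <= P by rewrite mulr_ge0.
(* the accumulated error is Q / n, to be made smaller than the advance 1 *)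
pose Q := P * (A2 + T * A1) * T.
have Q0 : 0 <= Q by rewrite !mulr_ge0 ?addr_ge0 ?mulr_ge0 // ltW.
pose n := (Num.bound Q).+1.
have n0 : 0 < n%:R :> R by rewrite ltr0n.
have Qn : Q < n%:R by rewrite (lt_le_trans (archi_boundP Q0)) // ler_nat.
pose delta := T / n%:R.
have d0 : 0 < delta by rewrite divr_gt0.
have nd : n%:R * delta = T by rewrite mulrC divfK // gt_eqF.
pose e m x := dot p (euler delta m x).
have ce m : classC r.+3 (e m).
  have [e1 e2] := euler_classC delta m.
  exact: (classCD (classCZ _ e1) (classCZ _ e2)).
pose H m x := \sum_(i < m) e i x.
have HS m : H m.+1 = (fun x => H m x + e m x).
  by apply/funext => x; rewrite /H big_ord_recr.
have cH m : classC r.+3 (H m).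
  elim: m => [|m IH].
    rewrite (_ : H 0%N = fun=> 0); first exact: classC_cst.
    by apply/funext => x; rewrite /H big_ord0.
  rewrite HS; exact: (classCD IH (ce m)).
have ge m x : m%:R * delta <= T -> `|grad (e m) x (b x) - dot p (b (euler delta m x))| <= P * (A1 * delta).
  move=> mT; have [e1 e2] := euler_classC delta m.
  rewrite (gradD _ _ (classCZ _ e1) (classCZ _ e2)) (gradCM _ _ _ e1) (gradCM _ _ _ e2).
  have := H1 delta m x (ltW d0) mT; set D := (_, _) => h.
  change (`|dot p D - dot p (b (euler delta m x))| <= P * (A1 * delta)).
  by rewrite -dotB (le_trans (dot_le _ _)) // ler_wpM2l.
have gH m x : m%:R * delta <= T ->
   `|delta * grad (H m) x (b x) - dot p (euler delta m x - x)| <= m%:R * (delta * (P * (A1 * delta))).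
  elim: m => [|m IH] mT.
    rewrite (_ : H 0%N = fun=> 0); last by apply/funext => y; rewrite /H big_ord0.
    by rewrite grad_cst mulr0 subrr mul0r /dot /= !mulr0 addr0 subr0 normr0.
  have mT' : m%:R * delta <= T.
    by rewrite (le_trans _ mT) // ler_wpM2r ?(ltW d0) // ler_nat.
  rewrite HS (gradD _ _ (cH m) (ce m)).
  have -> : euler delta m.+1 x = euler delta m x + delta *: b (euler delta m x) by [].
  rewrite (_ : _ - _ = (delta * grad (H m) x (b x) - dot p (euler delta m x - x)) +
     delta * (grad (e m) x (b x) - dot p (b (euler delta m x)))); last first.
    rewrite !dotB dotD dotZ; move: (grad (H m) x (b x)) (grad (e m) x (b x)) => *.
    by ring.
  rewrite (le_trans (ler_normD _ _)) // -natr1 mulrDl mul1r lerD ?IH //.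
  by rewrite normrM gtr0_norm // ler_wpM2l ?(ltW d0) // ge.
exists (fun x => n%:R^-1 * H n x); split.
- exact: (classCZ _ (cH n)).
- move=> x k.
  have -> : H n (x + lattice R k) = H n x + n%:R * dot p (lattice R k).
    rewrite /H mulr_natl -[n in _ *+ n]card_ord -sumr_const -big_split /=.
    by apply: eq_bigr => i _; rewrite /e euler_lattice dotD.
  by rewrite mulrDr mulrA mulVf ?mul1r // gt_eqF.
move=> x; rewrite (gradCM _ _ _ (cH n)) mulr_gt0 ?invr_gt0 //.
rewrite -(pmulr_rgt0 _ d0).
have := gH n x; rewrite nd lexx => /(_ isT); rewrite ler_norml => /andP[h1 _].
have := H2 delta n x (ltW d0); rewrite nd lexx => /(_ isT) h2.
have h3 : `|dot p (euler delta n x - X T x)| <= P * (A2 * delta).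
  by rewrite (le_trans (dot_le _ _)) // ler_wpM2l.
move: h3; rewrite ler_norml => /andP[h3 _].
have h4 := adv x.
have h5 : dot p (euler delta n x - x) = dot p (euler delta n x - X T x) + dot p (X T x - x).
  by rewrite -dotD addrA subrK.
have h6 : P * (A2 * delta) + n%:R * (delta * (P * (A1 * delta))) < 1.
  rewrite mulrA [n%:R * delta]nd (_ : _ + _ = Q / n%:R); last by rewrite /Q /delta; ring.
  by rewrite ltr_pdivrMr // mul1r.
rewrite h5 in h1; lra.
Qed.

End Euler.

(** * Trigonometric and arithmetic facts *)

Section Arith.
Variable R : realType.

Lemma cos_int (a : R) (m : int) : cos (a + 2 * pi * m%:~R) = cos a.
Proof.
have H (n : nat) (x : R) : cos (x + 2 * pi * n%:R) = cos x.
  elim: n => [|n IH]; first by rewrite mulr0 addr0.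
  have H2 y : cos (y + 2 * pi) = cos y by rewrite mulr_natl cosD2pi.
  by rewrite -[n.+1%:R]natr1 mulrDr mulr1 addrA H2.
case: m => n; first by rewrite -pmulrn H.
by rewrite NegzE mulrNz mulrN -pmulrn -(H n.+1) subrK.
Qed.

Lemma sin_int (a : R) (m : int) : sin (a + 2 * pi * m%:~R) = sin a.
Proof.
have H (n : nat) (x : R) : sin (x + 2 * pi * n%:R) = sin x.
  elim: n => [|n IH]; first by rewrite mulr0 addr0.
  have H2 y : sin (y + 2 * pi) = sin y by rewrite mulr_natl sinD2pi.
  by rewrite -[n.+1%:R]natr1 mulrDr mulr1 addrA H2.
case: m => n; first by rewrite -pmulrn H.
by rewrite NegzE mulrNz mulrN -pmulrn -(H n.+1) subrK.
Qed.

(** The half-angle formula turns this into the vanishing of sin on [0, pi[. *)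
Lemma cos_eq1_int (z : R) : cos (2 * pi * z) = 1 -> exists m : int, z = m%:~R.
Proof.
move=> H; exists (Num.floor z); set m := Num.floor z.
pose f := z - m%:~R.
have f0 : 0 <= f by rewrite subr_ge0 Num.Theory.floor_le.
have f1 : f < 1 by rewrite ltrBlDr addrC -intrD1 Num.Theory.floorD1_gt.
have cf : cos (2 * pi * f) = 1.
  have E : 2 * pi * z = 2 * pi * f + 2 * pi * m%:~R by rewrite -mulrDr subrK.
  by transitivity (cos (2 * pi * z)) => //; rewrite E cos_int.
have sf : sin (pi * f) = 0.
  have := cos_mulr2n (pi * f); rewrite (_ : pi * f *+ 2 = 2 * pi * f); last first.
    by rewrite -mulr_natl mulrA.
  rewrite cf cos2sin2 => E; apply/eqP; rewrite -sqrf_eq0; apply/eqP.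
  by move: E; move: (sin _ ^+ 2) => s; rewrite mulr2n; lra.
have : ~~ (0 < f).
  apply/negP => fp; have : 0 < sin (pi * f).
    by rewrite sin_gt0_pi // mulr_gt0 ?pi_gt0 //= gtr_pMr ?pi_gt0.
  by rewrite sf ltxx.
rewrite -leNgt => f2; have : f = 0 by apply/le_anti; rewrite f0 f2.
by move=> /eqP; rewrite subr_eq0 => /eqP.
Qed.

Lemma inv_square_telescope (d : R) : 0 <= d -> (1 + d ^+ 2)^-1 <= 4 * ((d + 1)^-1 - (d + 2)^-1).
Proof.
move=> d0; have h1 : 0 < d + 1 by lra.
have h2 : 0 < d + 2 by lra.
have h3 : 0 < 1 + d ^+ 2 by rewrite ltr_wpDr ?sqr_ge0.
rewrite (_ : (d + 1)^-1 - (d + 2)^-1 = ((d + 1) * (d + 2))^-1); last first.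
  by field; rewrite !gt_eqF.
rewrite -[leLHS]mul1r ler_pdivrMr // mulrAC ler_pdivlMr ?mulr_gt0 // mul1r expr2; nra.
Qed.

(** Comparison with a telescoping sum on each side of n; the bound is uniform in n and N. *)
Lemma sum_inv_square (N : nat) (n : nat) :
  \sum_(m < N) (1 + (n%:R - m%:R) ^+ 2)^-1 <= 8 :> R.
Proof.
pose Q (N : nat) : R := if (N <= n.+1)%N then (n%:R - N%:R + 2)^-1 else 2 - (N%:R - n%:R)^-1.
suff H : \sum_(m < N) (1 + (n%:R - m%:R) ^+ 2)^-1 <= 4 * Q N.
  rewrite (le_trans H) // (_ : 8 = 4 * 2); last by ring.
  rewrite ler_wpM2l // /Q; case: leqP => NN.
    rewrite invf_ple ?posrE //; last first.
      by have : N%:R <= n.+1%:R :> R by [rewrite ler_nat]; rewrite -natr1; lra.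
    have : N%:R <= n.+1%:R :> R by rewrite ler_nat.
    by rewrite -natr1; lra.
  rewrite lerBlDr lerDl invr_ge0 subr_ge0 ler_nat; exact: ltnW (ltnW NN).
elim: N => [|N IH].
  by rewrite big_ord0 /Q leq0n subr0 mulr_ge0 // invr_ge0 addr_ge0.
rewrite big_ord_recr /=; apply: (le_trans (lerD IH (lexx _))).
rewrite -lerBrDl -mulrBr /Q.
have [Nn|nN] := leqP N n.
  have -> : (N <= n.+1)%N by exact: leqW.
  have -> : (N.+1 <= n.+1)%N by rewrite ltnS.
  rewrite -[N.+1%:R]natr1.
  have d0 : 0 <= n%:R - N%:R :> R by rewrite subr_ge0 ler_nat.
  rewrite (le_trans (inv_square_telescope d0)) // ler_wpM2l //.
  by rewrite (_ : n%:R - (N%:R + 1) + 2 = n%:R - N%:R + 1) //; ring.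
have -> : (N.+1 <= n.+1)%N = false by rewrite ltnS leqNgt nN.
rewrite -(sqrrN (n%:R - N%:R)) opprB.
have d1 : 1 <= N%:R - n%:R :> R by rewrite lerBrDl natr1 ler_nat.
have d0 := le_trans ler01 d1.
rewrite (le_trans (inv_square_telescope d0)) // ler_wpM2l //.
have [Nn|Nn] := leqP N n.+1.
  have {Nn} -> : N = n.+1 by apply/eqP; rewrite eqn_leq Nn.
  rewrite -[n.+2%:R]natr1 -[n.+1%:R]natr1.
  rewrite (_ : n%:R + 1 - n%:R = 1); last by ring.
  rewrite (_ : n%:R + 1 + 1 - n%:R = 2); last by ring.
  rewrite (_ : n%:R - (n%:R + 1) + 2 = 1); last by ring.
  rewrite invr1; have e3 : 0 <= ((1 : R) + 2)^-1 by rewrite invr_ge0 addr_ge0.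
  have e2 : ((1 : R) + 1)^-1 = 2^-1 by [].
  rewrite e2; move: e3; move: ((1 + 2)^-1) => z z0; lra.
have EN : N.+1%:R - n%:R = N%:R - n%:R + 1 :> R by rewrite -[N.+1%:R]natr1 addrAC.
rewrite EN; set d := N%:R - n%:R in d1 d0 *.
have e1 : 0 < d by exact: lt_le_trans d1.
rewrite (_ : 2 - (d + 1)^-1 - (2 - d^-1) = (d * (d + 1))^-1); last first.
  by field; rewrite !gt_eqF // ltr_wpDl.
rewrite (_ : (d + 1)^-1 - (d + 2)^-1 = ((d + 1) * (d + 2))^-1); last first.
  by field; rewrite !gt_eqF // ltr_wpDl.
have a1 : 0 < d + 1 by rewrite ltr_wpDl.
have a2 : 0 < d + 2 by rewrite ltr_wpDl.
rewrite lef_pV2 ?posrE; [|exact: mulr_gt0|exact: mulr_gt0].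
rewrite [leLHS]mulrC; apply: ler_wpM2l; first exact: ltW.
by rewrite lerDl.
Qed.

Lemma irrational_neq (lambda : R) (p q : int) : irrational lambda -> q != 0 ->
  lambda - p%:~R / q%:~R != 0.
Proof.
move=> irr q0; apply/eqP => /eqP; rewrite subr_eq0 => /eqP E; apply: irr.
by exists (p%:Q / q%:Q) => //; rewrite E fmorph_div /= !ratr_int.
Qed.

(** The finitely many good approximations are at a positive distance from lambda,
    which the constant a absorbs; the others satisfy the opposite inequality. *)
Lemma diophantine_bound (lambda : R) (m : nat) : irrational lambda ->
  finite_set [set pq : int * nat | (1 <= pq.2)%N /\
       `|lambda - pq.1%:~R / pq.2%:R| <= pq.2%:R ^- m] ->
  exists2 a : R, 0 < a & forall j : int * int, j != 0 -> forall P : nat, (0 < P)%N ->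
    (`|j.1| <= P)%N -> a / P%:R ^+ m <= `|j.1%:~R * lambda + j.2%:~R|.
Proof.
move=> irr /finite_seqP[s Es].
have [a [a0 a1] Ha] : exists2 a : R, 0 < a /\ a <= 1 & forall pq, pq \in s -> (1 <= pq.2)%N ->
    a <= `|lambda - pq.1%:~R / pq.2%:R|.
  elim: {Es} s => [|[p q] s [a [a0 a1] Ha]]; first by exists 1.
  have [q0|q0] := posnP q.
    exists a => // pq; rewrite inE => /orP[/eqP -> /=|]; [by rewrite q0|exact: Ha].
  have e0 : 0 < `|lambda - p%:~R / q%:R|.
    by rewrite normr_gt0; have := @irrational_neq lambda p q irr; apply; rewrite eqz_nat -lt0n.
  exists (Num.min a `|lambda - p%:~R / q%:R|).
    by rewrite lt_min a0 e0 ge_min a1.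
  move=> pq; rewrite inE => /orP[/eqP -> _ /=|h1 h2]; first by rewrite ge_min lexx orbT.
  by rewrite ge_min Ha.
exists a => // j j0 P P0 jP.
have P1 : 1 <= P%:R :> R by rewrite ler1n.
have aP : a / P%:R ^+ m <= a.
  by rewrite ler_pdivrMr ?exprn_gt0 ?ltr0n // ler_peMr ?(ltW a0) // exprn_ege1.
have [j1|j1] := eqVneq j.1 0.
  rewrite j1 mul0r add0r (le_trans aP) // (le_trans a1) //.
  have : j.2 != 0 by apply: contra j0 => /eqP j2; rewrite [j]surjective_pairing j1 j2.
  by rewrite -intr_norm ler1z -gtz0_ge1 normr_gt0.
pose q := `|j.1|%N; have q0 : (0 < q)%N by rewrite absz_gt0.
have q1 : 1 <= q%:R :> R by rewrite ler1n.
pose p : int := - (sgz j.1 * j.2).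
have E : `|j.1%:~R * lambda + j.2%:~R| = q%:R * `|lambda - p%:~R / q%:R| :> R.
  have -> : q%:R * `|lambda - p%:~R / q%:R| = `|q%:R * (lambda - p%:~R / q%:R)|.
    by rewrite normrM [`|q%:R|]ger0_norm ?ler0n.
  rewrite mulrBr [q%:R * (_ / _)]mulrC divfK; last by rewrite pnatr_eq0 -lt0n.
  have qE : q%:R = (sgz j.1)%:~R * (j.1)%:~R :> R.
    by rewrite pmulrn /q abszEsg intrM.
  rewrite qE /p mulrNz opprK intrM -mulrA -mulrDr normrM.
  by rewrite -intr_norm normr_sgz j1 mul1r.
rewrite E.
have [h|h] := leP `|lambda - p%:~R / q%:R| (q%:R ^- m).
  have pqs : (p, q) \in s.
    have : [set` s] (p, q) by rewrite -Es.
    by [].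
  by rewrite (le_trans aP) // (le_trans (Ha _ pqs q0)) // ler_peMl.
rewrite (le_trans _ (ler_peMl _ q1)) // (le_trans _ (ltW h)) //.
have qm : 0 < q%:R ^+ m :> R by rewrite exprn_gt0 // ltr0n.
rewrite ler_pdivrMr ?exprn_gt0 ?ltr0n // mulrC ler_pdivlMr //.
apply: (le_trans (ler_piMl (ltW qm) a1)).
by rewrite lerXn2r ?nnegrE ?ler0n // ler_nat.
Qed.

End Arith.

(** * Gradients of trigonometric expressions; integration by parts *)

Section GradTrig.
Variable R : realType.
Implicit Types (f g : R * R -> R) (x y z p v w : R * R).

Lemma grad_cos n f x v : classC n.+1 f -> grad (fun x => cos (f x)) x v = - sin (f x) * grad f x v.
Proof.
move=> Hf; rewrite /grad.
have [_ ->] : is_derive x (1, 0) (fun x => cos (f x)) (- sin (f x) * 'D_(1, 0) f x).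
  apply: slice1_derive.
  have := @is_derive1_comp R cos (fun s => f (s, x.2)) x.1 _ _ (is_derive_cos _) (classC_slice1 x Hf).
  by rewrite /= -surjective_pairing.
have [_ ->] : is_derive x (0, 1) (fun x => cos (f x)) (- sin (f x) * 'D_(0, 1) f x).
  apply: slice2_derive.
  have := @is_derive1_comp R cos (fun s => f (x.1, s)) x.2 _ _ (is_derive_cos _) (classC_slice2 x Hf).
  by rewrite /= -surjective_pairing.
by rewrite mulrDr !mulrA.
Qed.

Lemma grad_sin n f x v : classC n.+1 f -> grad (fun x => sin (f x)) x v = cos (f x) * grad f x v.
Proof.
move=> Hf; rewrite /grad.
have [_ ->] : is_derive x (1, 0) (fun x => sin (f x)) (cos (f x) * 'D_(1, 0) f x).
  apply: slice1_derive.
  have := @is_derive1_comp R sin (fun s => f (s, x.2)) x.1 _ _ (is_derive_sin _) (classC_slice1 x Hf).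
  by rewrite /= -surjective_pairing.
have [_ ->] : is_derive x (0, 1) (fun x => sin (f x)) (cos (f x) * 'D_(0, 1) f x).
  apply: slice2_derive.
  have := @is_derive1_comp R sin (fun s => f (x.1, s)) x.2 _ _ (is_derive_sin _) (classC_slice2 x Hf).
  by rewrite /= -surjective_pairing.
by rewrite mulrDr !mulrA.
Qed.

Lemma classC_sum (I : Type) (s : seq I) (P : pred I) (F : I -> R * R -> R) n :
  (forall i, classC n (F i)) -> classC n (fun x => \sum_(i <- s | P i) F i x).
Proof.
move=> cF; elim: s => [|i s IH].
  rewrite (_ : (fun _ => _) = fun=> 0); first exact: classC_cst.
  by apply/funext => x; rewrite big_nil.
case Pi: (P i).
  rewrite (_ : (fun _ => _) = fun x => F i x + \sum_(i <- s | P i) F i x).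
    exact: (classCD (cF i) IH).
  by apply/funext => x; rewrite big_cons Pi.
rewrite (_ : (fun _ => _) = fun x => \sum_(i <- s | P i) F i x) //.
by apply/funext => x; rewrite big_cons Pi.
Qed.

Lemma grad_sum (I : Type) (s : seq I) (P : pred I) (F : I -> R * R -> R) n x v :
  (forall i, classC n.+1 (F i)) ->
  grad (fun x => \sum_(i <- s | P i) F i x) x v = \sum_(i <- s | P i) grad (F i) x v.
Proof.
move=> cF; elim: s => [|i s IH].
  rewrite (_ : (fun _ => _) = fun=> 0); first by rewrite big_nil grad_cst.
  by apply/funext => y; rewrite big_nil.
rewrite big_cons; case Pi: (P i).
  rewrite (_ : (fun _ => _) = fun x => F i x + \sum_(i <- s | P i) F i x); last first.
    by apply/funext => y; rewrite big_cons Pi.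
  by rewrite (gradD _ _ (cF i) (classC_sum s P cF)) IH.
rewrite (_ : (fun _ => _) = fun x => \sum_(i <- s | P i) F i x) //.
by apply/funext => y; rewrite big_cons Pi.
Qed.

(** The divergence of F g v has mean zero. *)
Lemma mean_ibp_field (F g v1 v2 : R * R -> R) n : classC n.+1 F -> classC n.+1 g ->
  classC n.+1 v1 -> classC n.+1 v2 ->
  Z2periodic F -> Z2periodic g -> Z2periodic v1 -> Z2periodic v2 ->
  mean (fun x => F x * grad g x (v1 x, v2 x)) =
  - mean (fun x => ('D_(1, 0) (fun x => F x * v1 x) x + 'D_(0, 1) (fun x => F x * v2 x) x) * g x).
Proof.
move=> cF cg c1 c2 pF pg p1 p2.
have cF1 := classCM cF c1; have cF2 := classCM cF c2.
have pF1 := periodicM pF p1; have pF2 := periodicM pF p2.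
have E1 := mean_derive1 (classCM cg cF1) (periodicM pg pF1).
have E2 := mean_derive2 (classCM cg cF2) (periodicM pg pF2).
have b0 f k : classC k f -> Z2periodic f -> bmeas f by move=> /classC_cont; exact: bmeas_periodic.
have bD1 f k : classC k.+1 f -> Z2periodic f -> bmeas (fun x => 'D_(1, 0) f x).
  by move=> h p; exact: (b0 _ _ (classC_d1 h) (periodic_derive _ p)).
have bD2 f k : classC k.+1 f -> Z2periodic f -> bmeas (fun x => 'D_(0, 1) f x).
  by move=> h p; exact: (b0 _ _ (classC_d2 h) (periodic_derive _ p)).
apply/eqP; rewrite -subr_eq0 opprK -meanD; last 2 first.
- apply: bmeasM; first exact: (b0 _ _ cF pF).
  apply: bmeasD; apply: bmeasM.
  + exact: (bD1 _ _ cg pg).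
  + exact: (b0 _ _ c1 p1).
  + exact: (bD2 _ _ cg pg).
  + exact: (b0 _ _ c2 p2).
- apply: bmeasM; last exact: (b0 _ _ cg pg).
  by apply: bmeasD; [exact: (bD1 _ _ cF1 pF1)|exact: (bD2 _ _ cF2 pF2)].
rewrite -[X in _ == X](_ : mean (fun x => 'D_(1, 0) (fun x => g x * (F x * v1 x)) x) +
  mean (fun x => 'D_(0, 1) (fun x => g x * (F x * v2 x)) x) = 0); last by rewrite E1 E2 addr0.
rewrite -meanD; last 2 first.
- exact: (bD1 _ _ (classCM cg cF1) (periodicM pg pF1)).
- exact: (bD2 _ _ (classCM cg cF2) (periodicM pg pF2)).
apply/eqP; apply: mean_eq => x; rewrite (deriveM_e1 x cg cF1) (deriveM_e2 x cg cF2) /grad /=.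
move: ('D_(1, 0) g x) ('D_(0, 1) g x) ('D_(1, 0) (fun x => F x * v1 x) x)
  ('D_(0, 1) (fun x => F x * v2 x) x) => *; ring.
Qed.

End GradTrig.

(** * Fourier modes in straightened coordinates *)

Section Modes.
Variable R : realType.
Implicit Types (f g : R * R -> R) (x y z p v w : R * R) (j k : int * int).
Variables (r : nat) (P1 P2 : R * R -> R).
Hypothesis cP1 : classC r.+3 P1.
Hypothesis cP2 : classC r.+3 P2.
Hypothesis pP1 : forall x k, P1 (x + lattice R k) = P1 x + k.1%:~R.
Hypothesis pP2 : forall x k, P2 (x + lattice R k) = P2 x + k.2%:~R.

(** The argument of the j-th Fourier mode in the coordinates (P1, P2). *)
Definition phase j x : R := 2 * pi * (j.1%:~R * P1 x + j.2%:~R * P2 x).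

Lemma phase_classC j : classC r.+3 (phase j).
Proof. exact: (classCZ _ (classCD (classCZ _ cP1) (classCZ _ cP2))). Qed.

Lemma phase_lattice j x k : phase j (x + lattice R k) = phase j x + 2 * pi * (j.1 * k.1 + j.2 * k.2)%:~R.
Proof. by rewrite /phase pP1 pP2 intrD !intrM; ring. Qed.

Lemma cos_addphase_periodic (a : R) j : Z2periodic (fun x => cos (a + phase j x)).
Proof. by move=> x k; rewrite phase_lattice addrA cos_int. Qed.

Lemma sin_addphase_periodic (a : R) j : Z2periodic (fun x => sin (a + phase j x)).
Proof. by move=> x k; rewrite phase_lattice addrA sin_int. Qed.

Lemma phaseD i j x : phase (i + j) x = phase i x + phase j x.
Proof. by rewrite /phase /= !intrD; ring. Qed.

Lemma phaseN j x : phase (- j) x = - phase j x.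
Proof. by rewrite /phase /= !mulrNz; ring. Qed.

Lemma phase0 x : phase 0 x = 0.
Proof. by rewrite /phase /= !mul0r addr0 mulr0. Qed.

Lemma grad_phase j x v : grad (phase j) x v =
  2 * pi * (j.1%:~R * grad P1 x v + j.2%:~R * grad P2 x v).
Proof.
rewrite /phase (gradCM _ _ _ (classCD (classCZ _ cP1) (classCZ _ cP2))).
by rewrite (gradD _ _ (classCZ _ cP1) (classCZ _ cP2)) (gradCM _ _ _ cP1) (gradCM _ _ _ cP2).
Qed.

Lemma cos_phase_classC j : classC r.+3 (fun x => cos (phase j x)).
Proof. by have [] := classC_cos_sin (phase_classC j). Qed.

Lemma sin_phase_classC j : classC r.+3 (fun x => sin (phase j x)).
Proof. by have [] := classC_cos_sin (phase_classC j). Qed.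

Lemma cos_phase_periodic j : Z2periodic (fun x => cos (phase j x)).
Proof. by have := @cos_addphase_periodic 0 j => h x k; have := h x k; rewrite !add0r. Qed.

Lemma sin_phase_periodic j : Z2periodic (fun x => sin (phase j x)).
Proof. by have := @sin_addphase_periodic 0 j => h x k; have := h x k; rewrite !add0r. Qed.

Lemma bmeas_cos_phase j : bmeas (fun x => cos (phase j x)).
Proof. by apply: bmeas_periodic; [exact: (classC_cont (cos_phase_classC j))|exact: cos_phase_periodic]. Qed.

Lemma bmeas_sin_phase j : bmeas (fun x => sin (phase j x)).
Proof. by apply: bmeas_periodic; [exact: (classC_cont (sin_phase_classC j))|exact: sin_phase_periodic]. Qed.

(** Along a field v dual to the i-th coordinate, differentiation exchanges sine and
    cosine up to a factor proportional to the i-th component of j; each integration by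
    parts replaces F by the divergence of F v and gains one power of that component. *)
Lemma mode_decay (i : bool) (v1 v2 : R * R -> R) : classC r.+2 v1 -> classC r.+2 v2 ->
  Z2periodic v1 -> Z2periodic v2 ->
  (forall j x, grad (phase j) x (v1 x, v2 x) = 2 * pi * (if i then j.1 else j.2)%:~R) ->
  forall n, (n <= r.+2)%N -> forall F, classC n F -> Z2periodic F ->
  exists2 A, 0 <= A & forall j, (if i then j.1 else j.2) != 0 ->
    `|mean (fun x => F x * cos (phase j x))| <= A / `|(if i then j.1 else j.2)%:~R| ^+ n /\
    `|mean (fun x => F x * sin (phase j x))| <= A / `|(if i then j.1 else j.2)%:~R| ^+ n.
Proof.
move=> c1 c2 p1 p2 dual; elim=> [|n IH] nr F cF pF.
  have [A A0 HA] := periodic_bounded (classC_cont cF) pF.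
  have bF := bmeas_periodic (classC_cont cF) pF.
  exists A => // j _; rewrite expr0 divr1; split.
    apply: mean_norm; first by apply: bmeasM => //; exact: bmeas_cos_phase.
    by move=> x; rewrite -[A]mulr1; apply: normrM_le => //; rewrite ler_norml cos_geN1 cos_le1.
  apply: mean_norm; first by apply: bmeasM => //; exact: bmeas_sin_phase.
  by move=> x; rewrite -[A]mulr1; apply: normrM_le => //; rewrite ler_norml sin_geN1 sin_le1.
have c1' := classC_le nr c1; have c2' := classC_le nr c2.
pose D x := 'D_(1, 0) (fun x => F x * v1 x) x + 'D_(0, 1) (fun x => F x * v2 x) x.
have cD : classC n D by exact: (classCD (classC_d1 (classCM cF c1')) (classC_d2 (classCM cF c2'))).
have pD : Z2periodic D.
  by move=> x k; rewrite /D !periodic_derive //; exact: periodicM.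
have [A A0 HA] := IH (ltnW nr) D cD pD.
exists A => // j j0; set J : R := _%:~R.
have J0 : 0 < `|J| by rewrite normr_gt0 intr_eq0.
have [H1 H2] := HA j j0; rewrite -/J in H1 H2.
have cS := classC_le (leqW nr) (sin_phase_classC j); have cC := classC_le (leqW nr) (cos_phase_classC j).
have bF := bmeas_periodic (classC_cont cF) pF.
have E1 := mean_ibp_field cF cS c1' c2' pF (sin_phase_periodic j) p1 p2.
have E2 := mean_ibp_field cF cC c1' c2' pF (cos_phase_periodic j) p1 p2.
rewrite -/(D _) in E1; rewrite -/(D _) in E2.
have e1 : mean (fun x => F x * grad (fun x => sin (phase j x)) x (v1 x, v2 x)) =
   2 * pi * J * mean (fun x => F x * cos (phase j x)).
  rewrite -meanZ; last by apply: bmeasM => //; exact: bmeas_cos_phase.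
  apply: mean_eq => x; rewrite (grad_sin _ _ (phase_classC j)) dual -/J.
  by rewrite mulrA mulrC.
have e2 : mean (fun x => F x * grad (fun x => cos (phase j x)) x (v1 x, v2 x)) =
   - (2 * pi * J) * mean (fun x => F x * sin (phase j x)).
  rewrite -meanZ; last by apply: bmeasM => //; exact: bmeas_sin_phase.
  apply: mean_eq => x; rewrite (grad_cos _ _ (phase_classC j)) dual -/J.
  by move: (F x) (sin _) => p q; ring.
have pi1 : 1 <= 2 * pi :> R.
  by rewrite (le_trans _ (ler_peMl _ (ler1n R 2))) ?pi_ge0 // (le_trans _ (pi_ge2 R)) // ler1n.
have bnd (m m' : R) : `|m'| <= A / `|J| ^+ n -> 2 * pi * J * m = m' -> `|m| <= A / `|J| ^+ n.+1.
  rewrite ler_pdivlMr ?exprn_gt0 // => h E; rewrite ler_pdivlMr ?exprn_gt0 //.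
  apply: le_trans h; rewrite -E normrM [`|2 * pi * J|]normrM (ger0_norm (le_trans ler01 pi1)).
  have -> : `|m| * `|J| ^+ n.+1 = (`|J| * `|m|) * `|J| ^+ n by rewrite exprS mulrCA mulrA.
  apply: ler_wpM2r; first exact: exprn_ge0.
  by rewrite -[leRHS]mulrA ler_peMl // mulr_ge0.
split.
  by apply: (bnd _ (- mean (fun x => D x * sin (phase j x)))); [rewrite normrN|rewrite -e1 E1].
by apply: bnd H1 _; apply/oppr_inj; rewrite -mulNr -e2 E2.
Qed.

End Modes.

(** * Fejer means and the corrector *)

Section Kernel.
Variable R : realType.
Implicit Types (x y : R * R) (j k : int * int).

(** The frequencies of the square of the modulus of a trigonometric sum over [0, N[^2. *)
Definition lag (N : nat) (n m : 'I_N * 'I_N) : int * int :=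
  ((n.1 : nat)%:Z - (m.1 : nat)%:Z, (n.2 : nat)%:Z - (m.2 : nat)%:Z).

Lemma lagN N (n m : 'I_N * 'I_N) : lag m n = - lag n m.
Proof. by congr pair; rewrite /= opprB. Qed.

Lemma lag_eq0 N (n m : 'I_N * 'I_N) : (lag n m == 0) = (n == m).
Proof.
case: n m => [n1 n2] [m1 m2]; rewrite /lag xpair_eqE /= !subr_eq0 !eqz_nat.
by rewrite xpair_eqE.
Qed.

(** The Fejer weights, before division by N^2. *)
Definition lag_count (N : nat) j : R := \sum_(n : 'I_N * 'I_N) \sum_(m : 'I_N * 'I_N) (lag n m == j)%:R.

Lemma lag_count0 N : lag_count N 0 = N%:R ^+ 2.
Proof.
rewrite /lag_count (eq_bigr (fun=> 1)); last first.
  move=> n _; rewrite (bigD1 n) //= lag_eq0 eqxx big1 ?addr0 // => m mn.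
  by rewrite lag_eq0 eq_sym (negbTE mn).
by rewrite sumr_const card_prod card_ord natrM expr2.
Qed.

Lemma lag_countN N j : lag_count N (- j) = lag_count N j.
Proof.
rewrite /lag_count exchange_big /=; apply: eq_bigr => n _; apply: eq_bigr => m _.
by rewrite lagN eqr_opp.
Qed.

Lemma sum_succ N : \sum_(i < N) (i.+1 < N)%N%:R = N%:R - (N != 0)%N%:R :> R.
Proof.
case: N => [|N]; first by rewrite big_ord0 subr0.
rewrite big_ord_recr /= ltnn addr0 (eq_bigr (fun=> 1)); last first.
  by move=> i _; rewrite ltnS ltn_ord.
by rewrite sumr_const card_ord -natr1 addrK.
Qed.

(** The first coordinates are consecutive, which leaves N - 1 choices; the common second
    coordinate is free. *)
Lemma lag_count_e1 N : N%:R ^+ 2 - N%:R <= lag_count N (1, 0).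
Proof.
apply: (@le_trans _ _ (\sum_(m : 'I_N * 'I_N) (m.1.+1 < N)%N%:R)); last first.
  rewrite /lag_count exchange_big; apply: ler_sum => -[m1 m2] _ /=.
  case: (boolP (m1.+1 < N)%N) => h; last by apply: sumr_ge0 => *; exact: ler0n.
  rewrite (bigD1 (Ordinal h, m2)) //=.
  have -> : lag (Ordinal h, m2) (m1, m2) == (1, 0).
    by rewrite /lag /= -addn1 PoszD addrAC !subrr add0r.
  by rewrite lerDl sumr_ge0.
rewrite -(pair_bigA _ (fun (i k : 'I_N) => (i.+1 < N)%N%:R)) /=.
rewrite (eq_bigr (fun i : 'I_N => N%:R * (i.+1 < N)%N%:R)); last first.
  by move=> i _; rewrite sumr_const card_ord mulr_natl.
rewrite -mulr_sumr sum_succ expr2 mulrBr lerD2l lerN2.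
by case: N => [|N]; rewrite ?mulr0 ?mulr1.
Qed.

Lemma lag_count_e2 N : N%:R ^+ 2 - N%:R <= lag_count N (0, 1).
Proof.
apply: (@le_trans _ _ (\sum_(m : 'I_N * 'I_N) (m.2.+1 < N)%N%:R)); last first.
  rewrite /lag_count exchange_big; apply: ler_sum => -[m1 m2] _ /=.
  case: (boolP (m2.+1 < N)%N) => h; last by apply: sumr_ge0 => *; exact: ler0n.
  rewrite (bigD1 (m1, Ordinal h)) //=.
  have -> : lag (m1, Ordinal h) (m1, m2) == (0, 1).
    by rewrite /lag /= -addn1 PoszD addrAC !subrr add0r.
  by rewrite lerDl sumr_ge0.
rewrite -(pair_bigA _ (fun (i k : 'I_N) => (k.+1 < N)%N%:R)) /=.
rewrite (eq_bigr (fun i : 'I_N => N%:R - (N != 0)%N%:R)); last by move=> i _; rewrite sum_succ.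
rewrite sumr_const card_ord -[leRHS]mulr_natl expr2 mulrBr lerD2l lerN2.
by case: N => [|N]; rewrite ?mulr0 ?mulr1.
Qed.

Variables (r : nat) (P1 P2 : R * R -> R).
Hypothesis cP1 : classC r.+3 P1.
Hypothesis cP2 : classC r.+3 P2.
Hypothesis pP1 : forall x k, P1 (x + lattice R k) = P1 x + k.1%:~R.
Hypothesis pP2 : forall x k, P2 (x + lattice R k) = P2 x + k.2%:~R.
Hypothesis inj : forall x y, P1 x = P1 y -> P2 x = P2 y -> x = y.
Variables (b : R * R -> R * R) (sigma kappa : R * R -> R) (c : R * R).
Hypothesis bs : bmeas sigma.
Hypothesis s0 : forall x, 0 < sigma x.
Hypothesis ck : classC r.+2 kappa.
Hypothesis pk : Z2periodic kappa.
Hypothesis k0 : forall x, 0 < kappa x.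
Hypothesis mk : mean (fun x => kappa x * sigma x) = 1.
Hypothesis mL : forall g, classC 1 g -> Z2periodic g -> mean (fun x => grad g x (b x) * sigma x) = 0.
Hypothesis LP1 : forall x, grad P1 x (b x) = kappa x * c.1.
Hypothesis LP2 : forall x, grad P2 x (b x) = kappa x * c.2.
Hypothesis irr : incommensurable c.

(** Dividing by it inverts the derivative along b on modes of frequency j, up to the
    factor 2 pi kappa. *)
Definition divisor j := c.1 * j.1%:~R + c.2 * j.2%:~R.

Local Notation th := (phase P1 P2).

Lemma Lie_phase j x : grad (th j) x (b x) = 2 * pi * divisor j * kappa x.
Proof.
by rewrite (grad_phase cP1 cP2) LP1 LP2 /divisor; move: (pi) => p; ring.
Qed.

Let bk : bmeas kappa. Proof. by apply: bmeas_periodic => //; exact: (classC_cont ck). Qed.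
Let bks : bmeas (fun x => kappa x * sigma x). Proof. exact: bmeasM. Qed.
Let bc j := bmeas_cos_phase cP1 cP2 pP1 pP2 j.
Let bsn j := bmeas_sin_phase cP1 cP2 pP1 pP2 j.

(** For j nonzero this mode is proportional to the derivative along b of a sine. *)
Lemma orth_cos j : j != 0 -> mean (fun x => kappa x * sigma x * cos (th j x)) = 0.
Proof.
move=> j0; have c1 := classC_le (ltn0Sn r.+2) (sin_phase_classC cP1 cP2 j).
have := mL c1 (sin_phase_periodic pP1 pP2 j).
rewrite (@mean_eq _ _ (fun x => 2 * pi * divisor j * (kappa x * sigma x * cos (th j x)))); last first.
  move=> x; rewrite (grad_sin _ _ (phase_classC cP1 cP2 j)) Lie_phase.
  by move: (cos _) (pi) => *; ring.
rewrite meanZ; last by apply: bmeasM.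
by move=> /eqP; rewrite !mulf_eq0 pnatr_eq0 /= (gt_eqF (pi_gt0 R)) /= (negbTE (irr j0)) => /eqP.
Qed.

Lemma orth_sin j : mean (fun x => kappa x * sigma x * sin (th j x)) = 0.
Proof.
have [->|j0] := eqVneq j 0.
  rewrite -[RHS](mean_cst 0); apply: mean_eq => x; by rewrite phase0 sin0 mulr0.
have c1 := classC_le (ltn0Sn r.+2) (cos_phase_classC cP1 cP2 j).
have := mL c1 (cos_phase_periodic pP1 pP2 j).
rewrite (@mean_eq _ _ (fun x => - (2 * pi * divisor j) * (kappa x * sigma x * sin (th j x)))); last first.
  move=> x; rewrite (grad_cos _ _ (phase_classC cP1 cP2 j)) Lie_phase.
  by move: (sin _) (pi) => *; ring.
rewrite meanZ; last by apply: bmeasM.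
by move=> /eqP; rewrite !mulf_eq0 oppr_eq0 !mulf_eq0 pnatr_eq0 /= (gt_eqF (pi_gt0 R)) /= (negbTE (irr j0)) => /eqP.
Qed.

(** Phase differences make the kernel a function of two points of the torus. *)
Definition dphase j x y : R := th j x - th j y.

Lemma dphaseD i j x y : dphase (i + j) x y = dphase i x y + dphase j x y.
Proof. by rewrite /dphase !phaseD opprD addrACA. Qed.

Lemma dphaseN j x y : dphase (- j) x y = - dphase j x y.
Proof. by rewrite /dphase !phaseN opprB opprK addrC. Qed.

Lemma bmeas_cos_dphase j x : bmeas (fun y => cos (dphase j x y)).
Proof.
rewrite (_ : (fun y => _) = (fun y => cos (th j x) * cos (th j y) + sin (th j x) * sin (th j y))).
  by apply: bmeasD; apply: bmeasM => //; exact: bmeas_cst.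
by apply/funext => y; rewrite /dphase cosB.
Qed.

(** The modes are orthonormal for the density kappa sigma. *)
Lemma orth_cos_dphase j x : mean (fun y => kappa y * sigma y * cos (dphase j x y)) = (j == 0)%:R.
Proof.
rewrite (@mean_eq _ _ (fun y => cos (th j x) * (kappa y * sigma y * cos (th j y)) +
   sin (th j x) * (kappa y * sigma y * sin (th j y)))); last first.
  by move=> y; rewrite /dphase cosB; move: (cos _) (sin _) (cos _) (sin _) => *; ring.
rewrite meanD; last 2 first.
- by apply: bmeasM; [exact: bmeas_cst|apply: bmeasM].
- by apply: bmeasM; [exact: bmeas_cst|apply: bmeasM].
rewrite !meanZ; [|by apply: bmeasM|by apply: bmeasM].
rewrite orth_sin mulr0 addr0; have [->|j0] := eqVneq j 0; last by rewrite orth_cos // mulr0.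
rewrite phase0 cos0 mul1r -[RHS]mk; apply: mean_eq => y.
by rewrite phase0 cos0 mulr1.
Qed.

Definition fejer N x y : R := (N%:R ^+ 2)^-1 *
  \sum_(n : 'I_N * 'I_N) \sum_(m : 'I_N * 'I_N) cos (dphase (lag n m) x y).

(** The double sum is the squared modulus of a sum of exponentials. *)
Lemma fejer_ge0 N x y : 0 <= fejer N x y.
Proof.
rewrite /fejer mulr_ge0 ?invr_ge0 ?sqr_ge0 //.
pose ph (n : 'I_N * 'I_N) := dphase ((n.1 : nat)%:Z, (n.2 : nat)%:Z) x y.
have E n m : cos (dphase (lag n m) x y) = cos (ph n) * cos (ph m) + sin (ph n) * sin (ph m).
  by rewrite -cosB -dphaseN -dphaseD.
rewrite (eq_bigr (fun n => \sum_m cos (ph n) * cos (ph m) + \sum_m sin (ph n) * sin (ph m))).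
  by rewrite big_split /= -!big_distrlr /= addr_ge0 // -expr2 sqr_ge0.
by move=> n _; rewrite -big_split; apply: eq_bigr => m _.
Qed.

Lemma bmeas_fejer N x : bmeas (fejer N x).
Proof.
apply: bmeasM; first exact: bmeas_cst.
by apply: bmeas_sum => n; apply: bmeas_sum => m; exact: bmeas_cos_dphase.
Qed.

Lemma mean_against_fejer N x (f : R * R -> R) (F : int * int -> R) : bmeas f ->
  (forall j, mean (fun y => f y * cos (dphase j x y)) = F j) ->
  mean (fun y => f y * fejer N x y) = (N%:R ^+ 2)^-1 * \sum_(n : 'I_N * 'I_N) \sum_(m : 'I_N * 'I_N) F (lag n m).
Proof.
move=> bf HF.
rewrite (@mean_eq _ _ (fun y => (N%:R ^+ 2)^-1 * \sum_(n : 'I_N * 'I_N) \sum_(m : 'I_N * 'I_N)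
    (f y * cos (dphase (lag n m) x y)))); last first.
  by move=> y; rewrite /fejer mulrCA mulr_sumr; congr (_ * _); apply: eq_bigr => n _; rewrite mulr_sumr.
have b1 n m : bmeas (fun y => f y * cos (dphase (@lag N n m) x y)) by apply: bmeasM => //; exact: bmeas_cos_dphase.
rewrite meanZ; last by apply: bmeas_sum => n; apply: bmeas_sum => m; exact: b1.
congr (_ * _); rewrite mean_sum; last by move=> n; apply: bmeas_sum => m; exact: b1.
apply: eq_bigr => n _; rewrite mean_sum; last by move=> m; exact: b1.
by apply: eq_bigr => m _; rewrite HF.
Qed.

Lemma mean_fejer N x : (0 < N)%N -> mean (fun y => kappa y * sigma y * fejer N x y) = 1.
Proof.
move=> N0; rewrite (mean_against_fejer N bks (fun j => orth_cos_dphase j x)) -[X in _ * X]/(lag_count N 0) lag_count0.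
by rewrite mulVf // expf_neq0 // pnatr_eq0 -lt0n.
Qed.

(** The kernel concentrates on the diagonal: multiplying by 1 - cos in the direction e
    costs the relative loss in the number of pairs, which is at most 1/N. *)
Lemma mean_fejer_chord N x (e : int * int) : (0 < N)%N -> N%:R ^+ 2 - N%:R <= lag_count N e ->
  mean (fun y => kappa y * sigma y * (1 - cos (dphase e x y)) * fejer N x y) <= N%:R^-1.
Proof.
move=> N0 ce; have N0' : 0 < N%:R :> R by rewrite ltr0n.
(* the Fourier coefficients of 1 - cos *)
pose F j : R := (j == 0)%:R - 2^-1 * ((j == - e)%:R + (j == e)%:R).
rewrite (@mean_against_fejer N x (fun y => kappa y * sigma y * (1 - cos (dphase e x y))) F).
- rewrite (eq_bigr (fun n => \sum_m (lag n m == 0)%:R - 2^-1 * (\sum_m (lag n m == - e)%:R +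
    \sum_m (lag n m == e)%:R))); last first.
    by move=> n _; rewrite /F sumrB -mulr_sumr -big_split.
  rewrite sumrB -mulr_sumr big_split /= -/(lag_count N 0) -/(lag_count N (- e)) -/(lag_count N e) lag_countN lag_count0.
  rewrite ler_pdivrMl ?exprn_gt0 // expr2 -mulrA mulfV ?gt_eqF // mulr1.
  by move: ce; rewrite expr2; move: (lag_count N e) => C; lra.
- by apply: bmeasM => //; apply: bmeasD; [exact: bmeas_cst|apply: bmeasN; exact: bmeas_cos_dphase].
move=> j.
rewrite (@mean_eq _ _ (fun y => kappa y * sigma y * cos (dphase j x y) - 2^-1 *
  (kappa y * sigma y * cos (dphase (j + e) x y) + kappa y * sigma y * cos (dphase (j - e) x y)))); last first.
  move=> y; rewrite !dphaseD dphaseN cosD cosB.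
  by move: (cos _) (sin _) (cos _) (sin _) => *; field.
have bb i : bmeas (fun y => kappa y * sigma y * cos (dphase i x y)) by apply: bmeasM => //; exact: bmeas_cos_dphase.
rewrite meanB //; last by apply: bmeasM; [exact: bmeas_cst|exact: bmeasD].
rewrite meanZ; last exact: bmeasD.
by rewrite meanD // !orth_cos_dphase /F addr_eq0 subr_eq0.
Qed.

(** A substitute for the squared distance on the torus, made of Fourier modes. *)
Definition chord x y : R := (1 - cos (dphase (1, 0) x y)) + (1 - cos (dphase (0, 1) x y)).

Lemma chord_eq0 x y : chord x y = 0 -> exists k, x = y + lattice R k.
Proof.
rewrite /chord => q0.
have le1 (a : R) : 0 <= 1 - cos a by rewrite subr_ge0 cos_le1.
move: (le1 (dphase (1, 0) x y)) (le1 (dphase (0, 1) x y)) => h1 h2.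
have e1 : cos (dphase (1, 0) x y) = 1 by lra.
have e2 : cos (dphase (0, 1) x y) = 1 by lra.
have E1 : dphase (1, 0) x y = 2 * pi * (P1 x - P1 y).
  by rewrite /dphase /phase /= !mul1r !mul0r !addr0 -mulrBr.
have E2 : dphase (0, 1) x y = 2 * pi * (P2 x - P2 y).
  by rewrite /dphase /phase /= !mul1r !mul0r !add0r -mulrBr.
rewrite E1 in e1; rewrite E2 in e2.
have [m1 M1] := cos_eq1_int e1; have [m2 M2] := cos_eq1_int e2.
exists (m1, m2); apply: inj.
  by rewrite pP1 /= -M1 addrC subrK.
by rewrite pP2 /= -M2 addrC subrK.
Qed.

Lemma cos_dphase_periodic j x y k l : cos (dphase j (x + lattice R k) (y + lattice R l)) = cos (dphase j x y).
Proof.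
have E : dphase j (x + lattice R k) (y + lattice R l) = dphase j x y + 2 * pi * (j.1 * k.1 + j.2 * k.2)%:~R
   + 2 * pi * (- (j.1 * l.1 + j.2 * l.2))%:~R.
  by rewrite /dphase !(phase_lattice pP1 pP2) mulrNz; move: (_%:~R) (_%:~R) (pi) => *; ring.
by rewrite E !cos_int.
Qed.

Lemma chord_ge0 x y : 0 <= chord x y.
Proof. by rewrite /chord addr_ge0 // subr_ge0 cos_le1. Qed.

(** On the compact set of pairs where g varies by at least e, chord has a positive
    minimum. *)
Lemma modulus_chord (g : R * R -> R) e : continuous g -> Z2periodic g -> 0 < e ->
  exists2 C, 0 <= C & forall x y, `|g y - g x| <= e + C * chord x y.
Proof.
move=> cg pg e0.
have [M M0 HM] := periodic_bounded cg pg.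
pose cs : set (R * R) := `[0, 1]%classic `*` `[0, 1]%classic.
have ccs : compact cs := @closed_square_compact R.
pose G (z : (R * R) * (R * R)) : R := `|g z.2 - g z.1|.
pose Q (z : (R * R) * (R * R)) : R := chord z.1 z.2.
have cG : continuous G.
  move=> z; apply: cvg_norm; apply: cvgB.
    by apply: (@continuous_comp _ _ _ snd g); [exact: cvg_snd|exact: cg].
  by apply: (@continuous_comp _ _ _ fst g); [exact: cvg_fst|exact: cg].
have cQ : continuous Q.
  have ct j : continuous (fun z : (R * R) * (R * R) => cos (dphase j z.1 z.2)).
    move=> z; apply: (@continuous_comp _ _ _ (fun z : (R * R) * (R * R) => dphase j z.1 z.2) cos); last exact: continuous_cos.
    apply: cvgB.
      by apply: (@continuous_comp _ _ _ fst (th j)); [exact: cvg_fst|exact: (classC_cont (phase_classC cP1 cP2 j))].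
    by apply: (@continuous_comp _ _ _ snd (th j)); [exact: cvg_snd|exact: (classC_cont (phase_classC cP1 cP2 j))].
  by move=> z; apply: cvgD; apply: cvgB; [exact: cvg_cst|exact: ct|exact: cvg_cst|exact: ct].
(* compact, and disjoint from the zero set of chord *)
pose S := (cs `*` cs) `&` [set z | e <= G z].
have cS : compact S.
  apply: compact_closedI; first exact: compact_setX.
  have /continuous_closedP := cG => /(_ _ (@closed_ge R e)); exact.
suff [C C0 HC] : exists2 C : R, 0 <= C & forall z : (R * R) * (R * R), S z -> G z <= e + C * Q z.
  exists C => // x y.
  have [k kx] := closed_square_reduce x; have [l ly] := closed_square_reduce y.
  have -> : chord x y = Q (x + lattice R k, y + lattice R l) by rewrite /Q /chord !cos_dphase_periodic.
  have -> : `|g y - g x| = G (x + lattice R k, y + lattice R l) by rewrite /G /= !pg.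
  have [h|/ltW h] := leP e (G (x + lattice R k, y + lattice R l)); first by apply: HC; split.
  by rewrite (le_trans h) // lerDl mulr_ge0 // chord_ge0.
have [S0|/set0P Sn] := eqVneq S set0; first by exists 0 => // z; rewrite S0.
have [|z0 Sz0 Hz0] := @compact_EVT_min _ _ Q S Sn cS.
  exact: continuous_subspaceT.
have q0 : 0 < Q z0.
  rewrite lt_neqAle chord_ge0 andbT eq_sym; apply/eqP => /chord_eq0[k xk].
  have [_ /=] : S z0 by apply/set_mem.
  by rewrite /G xk pg subrr normr0 leNgt e0.
exists ((M + M) / Q z0); first by apply: divr_ge0; [exact: addr_ge0|exact: ltW].
move=> z Sz; apply: (@le_trans _ _ (M + M)); first exact: (le_trans (ler_normB _ _) (lerD (HM _) (HM _))).
apply: (@le_trans _ _ ((M + M) / Q z0 * Q z)); last by rewrite lerDr ltW.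
rewrite mulrAC ler_pdivlMr //; apply: ler_wpM2l; [exact: addr_ge0|apply: Hz0].
exact/mem_set.
Qed.

Variables (X : R -> R * R -> R * R) (Bd : R).
Hypothesis HX : is_flow b X.
Hypothesis ms : mean sigma = 1.
Hypothesis c0 : c != 0.

Definition cos_coef j := mean (fun y => sigma y * cos (th j y)).
Definition sin_coef j := mean (fun y => sigma y * sin (th j y)).
(** The part of frequency j of the mean of sigma against the kernel. *)
Definition mode j x := cos (th j x) * cos_coef j + sin (th j x) * sin_coef j.

Hypothesis Hdec : forall j, j != 0 -> (`|cos_coef j| + `|sin_coef j|) / `|2 * pi * divisor j| <=
  Bd * ((1 + j.1%:~R ^+ 2)^-1 * (1 + j.2%:~R ^+ 2)^-1).

Lemma modeE j x : mean (fun y => sigma y * cos (dphase j x y)) = mode j x.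
Proof.
rewrite (@mean_eq _ _ (fun y => cos (th j x) * (sigma y * cos (th j y)) +
   sin (th j x) * (sigma y * sin (th j y)))); last first.
  by move=> y; rewrite /dphase cosB; move: (cos _) (sin _) (cos _) (sin _) => *; ring.
rewrite meanD; last 2 first.
- by apply: bmeasM; [exact: bmeas_cst|apply: bmeasM].
- by apply: bmeasM; [exact: bmeas_cst|apply: bmeasM].
by rewrite !meanZ; [|by apply: bmeasM|by apply: bmeasM].
Qed.

Definition smoothed N x := (N%:R ^+ 2)^-1 * \sum_(n : 'I_N * 'I_N) \sum_(m : 'I_N * 'I_N) mode (lag n m) x.

Lemma smoothedE N x : mean (fun y => sigma y * fejer N x y) = smoothed N x.
Proof. exact: (mean_against_fejer N bs (fun j => modeE j x)). Qed.

(** Korovkin's argument for the density kappa sigma: [smoothed] is the mean of 1/kappa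
    against a positive kernel of mass 1 ([mean_fejer]) concentrated on the diagonal
    ([mean_fejer_chord]), and [modulus_chord] controls the variation of 1/kappa. *)
Lemma smoothed_approx e : 0 < e -> exists2 N, (0 < N)%N & forall x, `|kappa x * smoothed N x - 1| <= e.
Proof.
move=> e0.
have [M M0 HM] := periodic_bounded (classC_cont ck) pk.
have kn0 x : kappa x != 0 by rewrite gt_eqF.
pose g x := (kappa x)^-1.
have cg : continuous g by exact: (classC_cont (classCV kn0 ck)).
have pg : Z2periodic g by move=> x k; rewrite /g pk.
have M1 : 0 < M + 1 by rewrite ltr_wpDl.
pose e' := e / (M + 1) / 2.
have e'0 : 0 < e' by rewrite !divr_gt0.
have [C C0 HC] := modulus_chord cg pg e'0.
pose N := (Num.bound (C * 2 / e')).+1.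
have N0 : 0 < N%:R :> R by rewrite ltr0n.
have CN : C * (2 / N%:R) <= e'.
  rewrite mulrA ler_pdivrMr // [e' * _]mulrC -ler_pdivrMr //.
  have h : 0 <= C * 2 / e' by apply: divr_ge0; [exact: mulr_ge0|exact: ltW].
  by rewrite (le_trans (ltW (archi_boundP h))) // ler_nat.
exists N => // x.
have bKs : bmeas (fun y => sigma y * fejer N x y) by apply: bmeasM => //; exact: bmeas_fejer.
have bKk : bmeas (fun y => kappa y * sigma y * fejer N x y) by apply: bmeasM => //; exact: bmeas_fejer.
have bg : bmeas g by exact: bmeas_periodic.
have E : smoothed N x - g x = mean (fun y => kappa y * sigma y * fejer N x y * (g y - g x)).
  rewrite -smoothedE -[X in _ - X]mulr1 -(mean_fejer x (ltn0Sn _ : (0 < N)%N)) -meanZ // -meanB //; last first.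
    by apply: bmeasM => //; exact: bmeas_cst.
  by apply: mean_eq => y; rewrite /g; field; rewrite !kn0.
have bA e1 : bmeas (fun y => kappa y * sigma y * (1 - cos (dphase e1 x y)) * fejer N x y).
  apply: bmeasM; last exact: bmeas_fejer.
  by apply: bmeasM => //; apply: bmeasD; [exact: bmeas_cst|apply: bmeasN; exact: bmeas_cos_dphase].
pose h y := e' * (kappa y * sigma y * fejer N x y) +
   C * (kappa y * sigma y * (1 - cos (dphase (1, 0) x y)) * fejer N x y +
        kappa y * sigma y * (1 - cos (dphase (0, 1) x y)) * fejer N x y).
have bh : bmeas h.
  by apply: bmeasD; apply: bmeasM; [exact: bmeas_cst|exact: bKk|exact: bmeas_cst|apply: bmeasD; exact: bA].
have mh : mean h <= e' + e'.
  rewrite /h meanD; [|by apply: bmeasM; [exact: bmeas_cst|]|by apply: bmeasM; [exact: bmeas_cst|exact: bmeasD]].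
  rewrite !meanZ ?meanD //; last exact: bmeasD.
  rewrite mean_fejer // mulr1 lerD2l (le_trans _ CN) // ler_wpM2l //.
  have h1 := mean_fejer_chord x (ltn0Sn _ : (0 < N)%N) (lag_count_e1 N).
  have h2 := mean_fejer_chord x (ltn0Sn _ : (0 < N)%N) (lag_count_e2 N).
  by rewrite (le_trans (lerD h1 h2)) // -mulr2n -[leLHS]mulr_natl.
have hb y : `|kappa y * sigma y * fejer N x y * (g y - g x)| <= h y.
  have w0 : 0 <= kappa y * sigma y * fejer N x y.
    by rewrite mulr_ge0 ?fejer_ge0 // mulr_ge0 // ltW.
  rewrite normrM ger0_norm // (le_trans (ler_wpM2l w0 (HC x y))) // /h /chord.
  by rewrite le_eqVlt; apply/orP; left; apply/eqP; move: (cos _) (cos _) (fejer N x y) => *; ring.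
have bw : bmeas (fun y => kappa y * sigma y * fejer N x y * (g y - g x)).
  by apply: bmeasM => //; apply: bmeasD => //; exact: bmeas_cst.
have Ub : `|smoothed N x - g x| <= e' + e'.
  rewrite E ler_norml; apply/andP; split.
    rewrite lerNl (le_trans _ mh) // -meanN //; apply: mean_le => //; first exact: bmeasN.
    by move=> y; rewrite (le_trans (ler_norm _)) // normrN.
  rewrite (le_trans _ mh) //; apply: mean_le => // y.
  by rewrite (le_trans (ler_norm _)).
rewrite (_ : kappa x * smoothed N x - 1 = kappa x * (smoothed N x - g x)); last first.
  by rewrite mulrBr mulfV.
apply: (le_trans (normrM_le (HM x) Ub)).
rewrite /e' -splitr mulrA ler_pdivrMr // mulrC ler_wpM2l ?lerDl // ltW //.
Qed.

(** The antiderivative along b of kappa times [mode]. *)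
Definition corrector_mode j x := (2 * pi * divisor j)^-1 * (cos_coef j * sin (th j x) + - sin_coef j * cos (th j x)).

Lemma corrector_mode_classC j : classC r.+3 (corrector_mode j).
Proof.
exact: (classCZ _ (classCD (classCZ _ (sin_phase_classC cP1 cP2 j)) (classCZ _ (cos_phase_classC cP1 cP2 j)))).
Qed.

Lemma Lie_corrector_mode j x : j != 0 -> grad (corrector_mode j) x (b x) = kappa x * mode j x.
Proof.
move=> j0; have cS := sin_phase_classC cP1 cP2 j; have cC := cos_phase_classC cP1 cP2 j.
rewrite /corrector_mode (gradCM _ _ _ (classCD (classCZ _ cS) (classCZ _ cC))).
rewrite (gradD _ _ (classCZ _ cS) (classCZ _ cC)) (gradCM _ _ _ cS) (gradCM _ _ _ cC).
rewrite (grad_sin _ _ (phase_classC cP1 cP2 j)) (grad_cos _ _ (phase_classC cP1 cP2 j)) Lie_phase /mode.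
have p0 : pi != 0 :> R by rewrite gt_eqF ?pi_gt0.
have jj : divisor j != 0 by exact: irr.
by move: (cos _) (sin _) p0 => C S; move: (pi) => P p0; field; rewrite p0 jj.
Qed.

Definition corrector N x := (N%:R ^+ 2)^-1 *
  \sum_(n : 'I_N * 'I_N) \sum_(m : 'I_N * 'I_N | lag n m != 0) corrector_mode (lag n m) x.

Lemma corrector_classC N : classC r.+3 (corrector N).
Proof.
exact: (classCZ _ (classC_sum _ _ (fun n => classC_sum _ _ (fun m => corrector_mode_classC (lag n m))))).
Qed.

(** The diagonal terms, of frequency 0, each contribute the mean of sigma; removing
    them accounts for the term - 1. *)
Lemma Lie_corrector N x : (0 < N)%N -> grad (corrector N) x (b x) = kappa x * (smoothed N x - 1).
Proof.
move=> N0; have cs1 n := classC_sum (index_enum _) (fun m : 'I_N * 'I_N => lag n m != 0) (fun m => corrector_mode_classC (lag n m)).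
rewrite /corrector (gradCM _ _ _ (classC_sum (index_enum _) xpredT cs1)) (grad_sum _ _ _ _ cs1).
rewrite (eq_bigr (fun n => kappa x * (\sum_m mode (lag n m) x - 1))); last first.
  move=> n _; rewrite (grad_sum _ _ _ _ (fun m => corrector_mode_classC (lag n m))).
  rewrite (eq_bigr (fun m => kappa x * mode (lag n m) x)); last by move=> m; exact: Lie_corrector_mode.
  rewrite -mulr_sumr; congr (_ * _); rewrite [in RHS](bigID (fun m => lag n m != 0)) /=.
  rewrite [X in _ = _ + X - 1](eq_bigl (pred1 n)); last first.
    by move=> m; rewrite negbK lag_eq0 eq_sym.
  rewrite big_pred1_eq (_ : lag n n = 0); last by apply/eqP; rewrite lag_eq0.
  rewrite /mode /cos_coef !phase0 cos0 sin0 mul0r addr0 mul1r.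
  rewrite (@mean_eq _ _ sigma) ?ms ?addrK // => y.
  by rewrite phase0 cos0 mulr1.
rewrite -mulr_sumr sumrB sumr_const card_prod card_ord /smoothed -[_ *+ _]mulr_natr natrM.
have n0 : N%:R != 0 :> R by rewrite pnatr_eq0 -lt0n.
by move: (\sum_n _) => T; field; rewrite n0.
Qed.

(** The weights being at most 1 after division by N^2, absolute convergence of the
    double series with terms 1/((1 + j1^2)(1 + j2^2)) suffices. *)
Lemma corrector_bound N x : (0 < N)%N -> `|corrector N x| <= 64 * Bd.
Proof.
move=> N0; have N2 : 0 < N%:R ^+ 2 :> R by rewrite exprn_gt0 // ltr0n.
have Bd0 : 0 <= Bd.
  have := @Hdec (1, 0) isT => /(le_trans _) h.
  have /h : 0 <= (`|cos_coef (1, 0)| + `|sin_coef (1, 0)|) / `|2 * pi * divisor (1, 0)| by rewrite divr_ge0 ?addr_ge0.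
  by rewrite pmulr_lge0 // mulr_gt0 // invr_gt0 ltr_wpDr // sqr_ge0.
rewrite /corrector normrM gtr0_norm ?invr_gt0 // ler_pdivrMl //.
apply: (le_trans (ler_norm_sum _ _ _)).
rewrite (_ : N%:R ^+ 2 * _ = \sum_(n : 'I_N * 'I_N) (64 * Bd)); last first.
  by rewrite sumr_const card_prod card_ord -[(64 * Bd) *+ _]mulr_natl natrM expr2.
apply: ler_sum => -[n1 n2] _; apply: (le_trans (ler_norm_sum _ _ _)).
pose D1 (m : 'I_N) : R := (1 + ((n1 : nat)%:R - (m : nat)%:R) ^+ 2)^-1.
pose D2 (m : 'I_N) : R := (1 + ((n2 : nat)%:R - (m : nat)%:R) ^+ 2)^-1.
have D10 m : 0 <= D1 m by rewrite invr_ge0 addr_ge0 ?sqr_ge0.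
have D20 m : 0 <= D2 m by rewrite invr_ge0 addr_ge0 ?sqr_ge0.
apply: (@le_trans _ _ (\sum_(m : 'I_N * 'I_N) Bd * (D1 m.1 * D2 m.2))).
  rewrite big_mkcond; apply: ler_sum => -[m1 m2] _ /=.
  case: ifPn => [d0|_]; last by rewrite mulr_ge0 // mulr_ge0.
  have := Hdec d0; rewrite /D1 /D2 /= !intrB -!pmulrn => h; apply: le_trans h.
  rewrite /corrector_mode normrM normfV mulrC ler_wpM2r ?invr_ge0 //.
  apply: (le_trans (ler_normD _ _)); rewrite !normrM normrN.
  by rewrite lerD // ler_piMr // ler_norml ?sin_geN1 ?sin_le1 ?cos_geN1 ?cos_le1.
rewrite -(pair_bigA _ (fun i l : 'I_N => Bd * (D1 i * D2 l))) /=.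
rewrite (eq_bigr (fun i => Bd * (D1 i * \sum_l D2 l))); last first.
  by move=> i _; rewrite -mulr_sumr -mulr_sumr.
rewrite -mulr_sumr -mulr_suml mulrC ler_wpM2r //.
rewrite (_ : 64 = 8 * 8); last by ring.
by rewrite ler_pM ?sumr_ge0 // sum_inv_square.
Qed.

(** The position along c in the straightened coordinates. *)
Definition clock x := (c.1 * P1 x + c.2 * P2 x) / dot c c.

(** Correct the clock by W: its derivative along the orbit is then kappa times a Fejer
    mean of 1/kappa, within 1/(|t| + 1) of 1 for an order that depends on t. *)
Lemma clock_flow t x : `|clock (X t x) - clock x - t| <= 2 * (64 * Bd) + 1.
Proof.
have t1 : 0 < `|t| + 1 by rewrite ltr_wpDl.
have [N N0 HN] := smoothed_approx (divr_gt0 ltr01 t1).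
have cH : classC r.+3 clock.
  rewrite (_ : clock = (fun x => (dot c c)^-1 * (c.1 * P1 x + c.2 * P2 x))).
    exact: (classCZ _ (classCD (classCZ _ cP1) (classCZ _ cP2))).
  by apply/funext => y; rewrite /clock mulrC.
have LH y : grad clock y (b y) = kappa y.
  rewrite (_ : clock = (fun x => (dot c c)^-1 * (c.1 * P1 x + c.2 * P2 x))); last first.
    by apply/funext => z; rewrite /clock mulrC.
  rewrite (gradCM _ _ _ (classCD (classCZ _ cP1) (classCZ _ cP2))).
  rewrite (gradD _ _ (classCZ _ cP1) (classCZ _ cP2)) (gradCM _ _ _ cP1) (gradCM _ _ _ cP2).
  rewrite LP1 LP2 /dot; have := dotcc c0; rewrite /dot => d0.
  by field; rewrite gt_eqF.
pose f (s : R) := s - (clock (X s x) + corrector N (X s x)).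
have Df (s : R) : is_derive s 1 f (1 - (grad clock (X s x) (b (X s x)) + grad (corrector N) (X s x) (b (X s x)))).
  apply: is_deriveB; apply: is_deriveD.
    exact: (flow_path HX x s (classC_C1 cH)).
  exact: (flow_path HX x s (classC_C1 (corrector_classC N))).
have [s _ E] := MVT_any 0 t Df.
have : `|f t - f 0| <= 1.
  rewrite E LH Lie_corrector // (_ : 1 - _ = - (kappa (X s x) * smoothed N (X s x) - 1)); last by ring.
  rewrite subr0 normrM normrN (le_trans (ler_wpM2r _ (HN _))) //.
  by rewrite mulrC mulrA mulr1 ler_pdivrMr // mul1r lerDl.
have w1 := corrector_bound (X t x) N0; have w2 := corrector_bound x N0.
rewrite /f (flow0 HX).
rewrite (_ : clock (X t x) - clock x - t = - (t - (clock (X t x) + corrector N (X t x)) - (0 - (clock x + corrector N x)))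
   - (corrector N (X t x) - corrector N x)); last by ring.
move=> h; rewrite (le_trans (ler_normB _ _)) // normrN addrC lerD //.
by rewrite (le_trans (ler_normB _ _)) // mulr_natl mulr2n lerD.
Qed.

End Kernel.

(** * The stream function and the decay of Fourier coefficients *)

Section Stream.
Variable R : realType.
Implicit Types (f g : R * R -> R) (x y z p v w : R * R) (j k : int * int).

Lemma lattice_periodic f : (forall x, f (x + (1, 0)) = f x) -> (forall x, f (x + (0, 1)) = f x) ->
  Z2periodic f.
Proof.
move=> f1 f2.
have g (e : R * R) : (forall x, f (x + e) = f x) -> forall (m : int) x, f (x + m%:~R *: e) = f x.
  move=> fe; have nat (n : nat) x : f (x + n%:R *: e) = f x.
    elim: n x => [|n IH] x; first by rewrite scale0r addr0.
    by rewrite -natr1 scalerDl scale1r addrA fe IH.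
  case=> n x; first by rewrite -pmulrn nat.
  by rewrite NegzE mulrNz scaleNr -(nat n.+1) -pmulrn subrK.
move=> x [k1 k2]; rewrite -[RHS](g _ f1 k1 x) -[RHS](g _ f2 k2 (x + _)) -addrA.
congr (f (x + _)); congr pair; rewrite /= /GRing.scale /=.
  by rewrite mulr1 mulr0 addr0.
by rewrite mulr1 mulr0 add0r.
Qed.

Lemma zero_gradient f : (forall x, is_derive x (1, 0) f 0) -> (forall x, is_derive x (0, 1) f 0) ->
  forall x y, f x = f y.
Proof.
move=> D1 D2 x y; apply/eqP; rewrite -subr_eq0 -normr_le0.
have := @C1_Lip R f 0 (fun x => @ex_derive _ _ _ _ _ _ _ (D1 x)) (fun x => @ex_derive _ _ _ _ _ _ _ (D2 x)).
move=> /(_ _ _ y x); rewrite mulr0 mul0r; apply.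
  by move=> z; have [_ ->] := D1 z; rewrite normr0.
by move=> z; have [_ ->] := D2 z; rewrite normr0.
Qed.

Lemma is_derive_translate f (a x v : R * R) l : is_derive (x + a) v f l ->
  is_derive x v (fun x => f (x + a)) l.
Proof.
move=> [df <-]; have E : (fun h : R => h^-1 *: (((fun x => f (x + a)) \o shift x) (h *: v) - f (x + a)))
  = (fun h : R => h^-1 *: ((f \o shift (x + a)) (h *: v) - f (x + a))).
  by apply/funext => h /=; rewrite addrA.
by split; rewrite /derivable /derive E.
Qed.

(** [poincare] gives the potential; its increments along lattice vectors are constant,
    and their values follow by taking means of the partial derivatives. *)
Lemma stream_function n (F1 F2 : R * R -> R) : classC n.+1 F1 -> classC n.+1 F2 ->
  Z2periodic F1 -> Z2periodic F2 -> (forall x, 'D_(1, 0) F1 x + 'D_(0, 1) F2 x = 0) ->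
  exists psi : R * R -> R, [/\ classC n.+2 psi, forall x, 'D_(1, 0) psi x = - F2 x,
    forall x, 'D_(0, 1) psi x = F1 x &
    Z2periodic (fun x => psi x - dot (- mean F2, mean F1) x)].
Proof.
move=> c1 c2 p1 p2 dv.
have pN : Z2periodic (fun x => - F2 x) by move=> x k; rewrite p2.
have [x|psi [cpsi [D1 D2]]] := poincare (classCN c2) c1 pN p1.
  have [_ ->] := is_deriveN (classC_derive2 x c2).
  by apply/eqP; rewrite eq_sym -subr_eq0 opprK dv.
have shift (e : R * R) k : e = lattice R k -> exists a, forall x, psi (x + e) = psi x + a.
  move=> ek; exists (psi e - psi 0) => x.
  have Z1 (y : R * R) : is_derive y (1, 0) (fun x => psi (x + e) - psi x) 0.
    have := is_deriveB (is_derive_translate (D1 (y + e))) (D1 y).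
    by rewrite ek pN subrr.
  have Z2 (y : R * R) : is_derive y (0, 1) (fun x => psi (x + e) - psi x) 0.
    have := is_deriveB (is_derive_translate (D2 (y + e))) (D2 y).
    by rewrite ek p1 subrr.
  have /= := zero_gradient Z1 Z2 x 0; rewrite add0r => <-.
  by rewrite [RHS]addrC subrK.
have [|a1 A1] := shift (1, 0) (1, 0); first by [].
have [|a2 A2] := shift (0, 1) (0, 1); first by [].
pose p x := psi x - dot (a1, a2) x.
have pp : Z2periodic p.
  apply: lattice_periodic => x.
    by rewrite /p A1 dotD {2}/dot /= mulr1 mulr0 addr0; ring.
  by rewrite /p A2 dotD {2}/dot /= mulr1 mulr0 add0r; ring.
have clin : classC n.+2 (dot (a1, a2)).
  exact: (classCD (classCZ _ (classC_fst _ _)) (classCZ _ (classC_snd _ _))).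
have cp : classC n.+2 p by exact: (classCB cpsi clin).
have b1 : bmeas F1 by apply: bmeas_periodic => //; exact: (classC_cont c1).
have b2 : bmeas F2 by apply: bmeas_periodic => //; exact: (classC_cont c2).
have dl1 x : is_derive x (1, 0) (dot (a1, a2)) a1.
  apply: slice1_derive; apply/is_derive_epsP => e e0; exists 1 => // h _.
  by rewrite /dot /= (_ : _ - _ - _ = 0) ?normr0 ?mulr_ge0 // ?ltW //; ring.
have dl2 x : is_derive x (0, 1) (dot (a1, a2)) a2.
  apply: slice2_derive; apply/is_derive_epsP => e e0; exists 1 => // h _.
  by rewrite /dot /= (_ : _ - _ - _ = 0) ?normr0 ?mulr_ge0 // ?ltW //; ring.
have E1 : a1 = - mean F2.
  have := mean_derive1 cp pp; rewrite (@mean_eq _ _ (fun x => - F2 x - a1)); last first.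
    by move=> x; have [_ ->] := is_deriveB (D1 x) (dl1 x).
  rewrite meanB ?mean_cst ?meanN //; [|exact: bmeasN|exact: bmeas_cst].
  by move=> /eqP; rewrite subr_eq0 => /eqP.
have E2 : a2 = mean F1.
  have := mean_derive2 cp pp; rewrite (@mean_eq _ _ (fun x => F1 x - a2)); last first.
    by move=> x; have [_ ->] := is_deriveB (D2 x) (dl2 x).
  rewrite meanB ?mean_cst //; [|exact: bmeas_cst].
  by move=> /eqP; rewrite subr_eq0 => /eqP.
exists psi; split=> //.
- by move=> x; have [_ ->] := D1 x.
- by move=> x; have [_ ->] := D2 x.
- by rewrite -E1 -E2.
Qed.

End Stream.

Section Decay.
Variable R : realType.
Implicit Types (f g : R * R -> R) (x y z p v w : R * R) (j k : int * int).
Variables (m : nat) (P1 P2 sigma : R * R -> R).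
Local Notation r := m.+2.
Hypothesis cP1 : classC r.+3 P1.
Hypothesis cP2 : classC r.+3 P2.
Hypothesis pP1 : forall x k, P1 (x + lattice R k) = P1 x + k.1%:~R.
Hypothesis pP2 : forall x k, P2 (x + lattice R k) = P2 x + k.2%:~R.
Hypothesis cs : classC r.+2 sigma.
Hypothesis ps : Z2periodic sigma.
Let D x := 'D_(1, 0) P1 x * 'D_(0, 1) P2 x - 'D_(0, 1) P1 x * 'D_(1, 0) P2 x.
Hypothesis D0 : forall x, D x != 0.

Local Notation th := (phase P1 P2).

(** Increments that do not depend on x disappear in the derivatives. *)
Lemma derive_quasiperiodic f (a : int * int -> R) v : (forall x k, f (x + lattice R k) = f x + a k) ->
  Z2periodic (fun x => 'D_v f x).
Proof.
move=> pf x k; have E : (fun h : R => h^-1 *: ((f \o shift (x + lattice R k)) (h *: v)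
      - f (x + lattice R k))) = (fun h => h^-1 *: ((f \o shift x) (h *: v) - f x)).
  by apply/funext => h /=; rewrite addrA !pf opprD addrACA subrr addr0.
by rewrite /derive E.
Qed.

(** The fields dual to the coordinates are read off the inverse Jacobian matrix; use
    [mode_decay] along the larger component of j. *)
Lemma fourier_decay : exists2 A, 0 <= A & forall j, j != 0 -> exists P : nat,
  [/\ (0 < P)%N, (`|j.1| <= P)%N, (`|j.2| <= P)%N,
   `|mean (fun x => sigma x * cos (th j x))| <= A / P%:R ^+ m.+4 &
   `|mean (fun x => sigma x * sin (th j x))| <= A / P%:R ^+ m.+4].
Proof.
have c11 := classC_d1 cP1; have c12 := classC_d2 cP1.
have c21 := classC_d1 cP2; have c22 := classC_d2 cP2.
have cD : classC r.+2 D by exact: (classCB (classCM c11 c22) (classCM c12 c21)).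
have cV := classCV D0 cD.
have p11 := derive_quasiperiodic (1, 0) pP1; have p12 := derive_quasiperiodic (0, 1) pP1.
have p21 := derive_quasiperiodic (1, 0) pP2; have p22 := derive_quasiperiodic (0, 1) pP2.
have pV : Z2periodic (fun x => (D x)^-1) by move=> x k; rewrite /D p11 p12 p21 p22.
have pN f : Z2periodic f -> Z2periodic (fun x => - f x) by move=> pf x k; rewrite pf.
have dual1 j x : grad (th j) x ('D_(0, 1) P2 x * (D x)^-1, - 'D_(1, 0) P2 x * (D x)^-1) =
    2 * pi * (j.1)%:~R.
  rewrite (grad_phase cP1 cP2) /grad /=; move: (D0 x); rewrite /D.
  by move: ('D_(1, 0) P1 x) ('D_(0, 1) P1 x) ('D_(1, 0) P2 x) ('D_(0, 1) P2 x) => a b c d h; field.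
have dual2 j x : grad (th j) x (- 'D_(0, 1) P1 x * (D x)^-1, 'D_(1, 0) P1 x * (D x)^-1) =
    2 * pi * (j.2)%:~R.
  rewrite (grad_phase cP1 cP2) /grad /=; move: (D0 x); rewrite /D.
  by move: ('D_(1, 0) P1 x) ('D_(0, 1) P1 x) ('D_(1, 0) P2 x) ('D_(0, 1) P2 x) => a b c d h; field.
have [A1 A10 H1] := @mode_decay R r P1 P2 cP1 cP2 pP1 pP2 true
  (fun x => 'D_(0, 1) P2 x * (D x)^-1) (fun x => - 'D_(1, 0) P2 x * (D x)^-1)
  (classCM c22 cV) (classCM (classCN c21) cV) (periodicM p22 pV) (periodicM (pN _ p21) pV)
  dual1 r.+2 (leqnn _) sigma cs ps.
have [A2 A20 H2] := @mode_decay R r P1 P2 cP1 cP2 pP1 pP2 false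
  (fun x => - 'D_(0, 1) P1 x * (D x)^-1) (fun x => 'D_(1, 0) P1 x * (D x)^-1)
  (classCM (classCN c12) cV) (classCM c11 cV) (periodicM (pN _ p12) pV) (periodicM p11 pV)
  dual2 r.+2 (leqnn _) sigma cs ps.
exists (A1 + A2); first exact: addr_ge0.
move=> j j0; exists (maxn `|j.1| `|j.2|).
have bnd (a A : R) (i : int) : `|a| <= A / `|i%:~R| ^+ r.+2 -> A <= A1 + A2 ->
    `|a| <= (A1 + A2) / (`|i|%N)%:R ^+ r.+2.
  by move=> h AA; rewrite (le_trans h) // -intr_norm -abszE -pmulrn ler_wpM2r // invr_ge0 exprn_ge0.
have [le12|le21] := leqP `|j.1|%N `|j.2|%N.
  have j2 : j.2 != 0.
    apply: contra j0 => /eqP j2; move: le12; rewrite j2 absz0 leqn0 absz_eq0 => /eqP j1.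
    by rewrite [j]surjective_pairing j1 j2.
  have [h1 h2] := H2 j j2; split=> //; first by rewrite absz_gt0.
  - by apply: bnd h1 _; rewrite lerDr.
  - by apply: bnd h2 _; rewrite lerDr.
have j1 : j.1 != 0 by rewrite -absz_eq0 -lt0n (leq_ltn_trans _ le21).
have [h1 h2] := H1 j j1; split=> //; first by rewrite absz_gt0.
- exact: ltnW.
- by apply: bnd h1 _; rewrite lerDl.
- by apply: bnd h2 _; rewrite lerDl.
Qed.

End Decay.

(** * The Diophantine case *)

Section Diophantine.
Variable R : realType.
Implicit Types (f g : R * R -> R) (x y z p v w : R * R) (j k : int * int).

(** The quantitative form of smoothness used in the retraction and in the flow box.  The
    field v is the gradient divided by its squared length. *)
Lemma stream_estimates n (psi : R * R -> R) (G1 G2 : R * R -> R) : classC n.+3 psi ->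
  (forall x, 'D_(1, 0) psi x = G1 x) -> (forall x, 'D_(0, 1) psi x = G2 x) ->
  classC n.+2 G1 -> classC n.+2 G2 -> Z2periodic G1 -> Z2periodic G2 ->
  (forall x, 0 < G1 x ^+ 2 + G2 x ^+ 2) ->
  (exists2 C, 0 <= C & forall x y, `|psi y - psi x - grad psi x (y - x)| <= C * `|y - x| ^+ 2) /\
  (exists2 G, 0 <= G & forall x y w, `|grad psi y w - grad psi x w| <= G * `|y - x| * `|w|) /\
  (exists2 L, 0 <= L & forall x y, `|psi y - psi x| <= L * `|y - x|) /\
  (exists V, 0 <= V /\ exists v : R * R -> R * R, [/\ continuous v, forall x, `|v x| <= V &
     forall x, grad psi x (v x) = 1]).
Proof.
move=> cpsi D1 D2 c1 c2 p1 p2 pos.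
have [_ [d1 d2 _ _]] := cpsi.
have e1 : (fun x => 'D_(1, 0) psi x) = G1 by apply/funext.
have e2 : (fun x => 'D_(0, 1) psi x) = G2 by apply/funext.
have L1 := periodic_Lip c1 p1; have L2 := periodic_Lip c2 p2.
split; first by apply: Taylor_Lip d1 d2 _ _; [rewrite e1|rewrite e2].
split.
  have [A A0 HA] := L1; have [B B0 HB] := L2.
  exists (A + B); first exact: addr_ge0.
  move=> x y w; rewrite /grad !D1 !D2.
  rewrite (_ : _ - _ = (G1 y - G1 x) * w.1 + (G2 y - G2 x) * w.2); last by ring.
  rewrite (le_trans (ler_normD _ _)) //.
  rewrite (_ : _ * `|w| = A * `|y - x| * `|w| + B * `|y - x| * `|w|); last by rewrite 2!mulrDl.
  exact: (lerD (normrM_le (HA _ _) (norm_fst w)) (normrM_le (HB _ _) (norm_snd w))).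
have [A A0 HA] := periodic_bounded (classC_cont c1) p1.
have [B B0 HB] := periodic_bounded (classC_cont c2) p2.
split.
  exists (2 * (A + B)); first by rewrite mulr_ge0 // addr_ge0.
  move=> x y; apply: (C1_Lip d1 d2) => z.
    by rewrite D1 (le_trans (HA z)) // lerDl.
  by rewrite D2 (le_trans (HB z)) // lerDr.
pose N x := G1 x * G1 x + G2 x * G2 x.
have cN : classC n.+2 N by exact: (classCD (classCM c1 c1) (classCM c2 c2)).
have N0 x : N x != 0 by rewrite /N -!expr2 gt_eqF.
have cV := classCV N0 cN.
have pV : Z2periodic (fun x => (N x)^-1) by move=> x k; rewrite /N p1 p2.
have cV1 := classCM c1 cV; have cV2 := classCM c2 cV.
have [V1 V10 HV1] := periodic_bounded (classC_cont cV1) (periodicM p1 pV).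
have [V2 V20 HV2] := periodic_bounded (classC_cont cV2) (periodicM p2 pV).
exists (V1 + V2); split; first exact: addr_ge0.
exists (fun x => (G1 x * (N x)^-1, G2 x * (N x)^-1)); split.
- exact: (continuous_pair (classC_cont cV1) (classC_cont cV2)).
- move=> x; rewrite norm2_le /=; apply/andP; split.
    by rewrite (le_trans (HV1 x)) // lerDl.
  by rewrite (le_trans (HV2 x)) // lerDr.
- move=> x; rewrite /grad D1 D2 /=; move: (N0 x); rewrite /N.
  by move: (G1 x) (G2 x) => a b h; field.
Qed.

Lemma affine_periodic_bound f (u : R * R) : continuous f ->
  (forall x k, f (x + lattice R k) = f x + dot u (lattice R k)) ->
  exists2 M, 0 <= M & forall x, `|f x - dot u x| <= M.
Proof.
move=> cf pf; apply: periodic_bounded.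
  move=> x; apply: cvgB; first exact: cf.
  apply: (classC_cont (n := 0)).
  exact: (classCD (classCZ _ (classC_fst _ _)) (classCZ _ (classC_snd _ _))).
by move=> x k; rewrite pf dotD opprD addrACA subrr addr0.
Qed.

(** With m the exponent of the Diophantine condition, coefficients decaying like
    |j|^-(m+4) leave |j|^-4 after division by the small divisors; m + 4 integrations
    by parts with fields one derivative less regular than the coordinates account
    for the class C^(m+5). *)
Lemma fine_expansion_diophantine (lambda : R) : diophantine lambda ->
  exists kb ksigma : nat, [/\ (2 <= kb)%N, (5 <= ksigma)%N &
     forall (b : R * R -> R * R) (sigma : R * R -> R)
            (X : R -> R * R -> R * R),
       Csharp2 kb b -> (forall x, b x != 0) -> is_flow b X ->
       Csharp ksigma sigma -> (forall x, 0 < sigma x) ->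
       torus_probability sigma -> invariant_density X sigma ->
       let sb := mean2 (fun x => sigma x *: b x) in
       incommensurable sb -> sb.1 / sb.2 = lambda ->
       fine_expansion X (fun=> sb)].
Proof.
move=> [irr [m fin]].
have [a a0 Ha] := diophantine_bound irr fin.
(* psi, h and the coordinates will be of class C^(r+3) *)
pose r := m.+2; exists r.+3, r.+3; split=> // b sigma X Hb b0 HX Hs s0 prob inv.
move=> c inc lam.
pose b1 x := (b x).1; pose b2 x := (b x).2.
have cb1 : classC r.+3 b1 by case: Hb => [[]].
have cb2 : classC r.+3 b2 by case: Hb => [_ []].
have pb1 : Z2periodic b1 by case: Hb => [[]].
have pb2 : Z2periodic b2 by case: Hb => [_ []].
have [cs ps] := Hs.
pose F1 x := sigma x * b1 x; pose F2 x := sigma x * b2 x.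
have cF1 : classC r.+3 F1 by exact: (classCM cs cb1).
have cF2 : classC r.+3 F2 by exact: (classCM cs cb2).
have pF1 : Z2periodic F1 by exact: periodicM.
have pF2 : Z2periodic F2 by exact: periodicM.
have bm0 n f : classC n f -> Z2periodic f -> bmeas f by move=> /classC_cont; exact: bmeas_periodic.
have bs := bm0 _ _ cs ps.
have cE : c = (mean F1, mean F2) by [].
have c1E : c.1 = mean F1 by [].
have c2E : c.2 = mean F2 by [].
have ms : mean sigma = 1.
  move: prob; rewrite /torus_probability torus_measureE //.
  rewrite (@mean_eq _ _ sigma); last by move=> x; rewrite indicE mem_setT mulr1.
  by move=> E; apply: EFin_inj.
have c20 : c.2 != 0.
  by have := inc (0, 1) isT; rewrite /= mulr0 add0r mulr1.
have c0 : c != 0 by apply: contra c20 => /eqP ->.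
have dcc := dotcc c0.
clearbody c.
have [psi [cpsi D1 D2 ppsi]] := stream_function cF1 cF2 pF1 pF2 (divergence_free Hb HX Hs inv).
rewrite -c1E -c2E in ppsi.

have [K K0 LK] := b_Lip Hb; have [B B0 HB] := b_bounded Hb; have pb := b_periodic Hb.
have dbb x : 0 < dot (b x) (b x) by exact: dotcc.
have [beta beta0 Hbeta] : exists2 beta, 0 < beta & forall x, beta <= dot (b x) (b x).
  have cdot : classC r.+3 (fun x => b1 x * b1 x + b2 x * b2 x).
    exact: (classCD (classCM cb1 cb1) (classCM cb2 cb2)).
  apply: periodic_pos => //; first exact: (classC_cont cdot).
  by move=> x k; rewrite pb.
have [sm sm0 Hsm] := periodic_pos (classC_cont cs) ps s0.
have posG x : 0 < (- F2 x) ^+ 2 + F1 x ^+ 2.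
  rewrite (_ : _ + _ = sigma x ^+ 2 * dot (b x) (b x)) ?mulr_gt0 ?exprn_gt0 //.
  by rewrite /F1 /F2 /dot /b1 /b2; ring.
have pNF2 : Z2periodic (fun x => - F2 x) by move=> x k; rewrite pF2.
have [[C C0 HC] [[G G0 HG] [[L L0 HL] [V [V0 [v [cv vV gv]]]]]]] :=
  stream_estimates cpsi D1 D2 (classCN cF2) cF1 pNF2 pF1 posG.
have cpsi0 : continuous psi by exact: (classC_cont cpsi).
have ret := retract C0 HC cv V0 vV gv cpsi0.
have ppsi' x k : psi (x + lattice R k) = psi x + dot (- c.2, c.1) (lattice R k).
  by have := ppsi x k; rewrite dotD; move: (psi _) (psi x) (dot _ _) (dot _ x) => ? ? ? ? ?; lra.
have [M M0 HM] := affine_periodic_bound cpsi0 ppsi'.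
have Cpsi : C1 psi := classC_C1 cpsi.
have orbit := level_orbit K0 LK B0 HB HX beta0 Hbeta sm0 Hsm Cpsi D1 D2 C0 HC G0 HG L0 HL ret.
have [T T0 [s s1 adv]] := flow_drift K0 LK pb B0 HB HX beta0 Hbeta sm0 Hsm Cpsi D1 D2 C0 HC G0 HG L0 HL V0 ret M0 HM c0.
have [h [ch ph Lh]] := transversal_function Hb HX T0 adv.
have mL g : classC 1 g -> Z2periodic g -> mean (fun x => grad g x (b x) * sigma x) = 0.
  exact: (mean_Lie Hb HX Hs inv).
have pLh : Z2periodic (fun x => grad h x (b x)).
  by move=> x k; rewrite /grad pb !(derive_quasiperiodic _ ph).
have cLh : classC r.+2 (fun x => grad h x (b x)).
  exact: (classCD (classCM (classC_d1 ch) (classCW cb1)) (classCM (classC_d2 ch) (classCW cb2))).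
have mLh : mean (fun x => grad h x (b x) * sigma x) = dot (s *: c) c.
  pose l x := - dot (s *: c) x.
  have cl : classC r.+3 l.
    exact: (classCN (classCD (classCZ _ (classC_fst _ _)) (classCZ _ (classC_snd _ _)))).
  have ghl x : grad (fun x => h x + l x) x (b x) = grad h x (b x) - dot (s *: c) (b x).
    have E : l = (fun x => - (s *: c).1 * x.1 + - (s *: c).2 * x.2).
      by apply/funext => y; rewrite /l /dot; ring.
    rewrite (gradD _ _ ch cl) {1}E.
    rewrite (gradD _ _ (classCZ _ (classC_fst R 1)) (classCZ _ (classC_snd R 1))).
    rewrite (gradCM _ _ _ (classC_fst R 1)) (gradCM _ _ _ (classC_snd R 1)) grad_fst grad_snd.
    by rewrite /dot; ring.
  have := mL (fun x => h x + l x) (classC_le (ltn0Sn _) (classCD ch cl)).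
  have phl : Z2periodic (fun x => h x + l x).
    by move=> x k; rewrite ph /l dotD; ring.
  move=> /(_ phl) E; apply/eqP; rewrite -subr_eq0; apply/eqP; rewrite -[RHS]E.
  have bF1 := bm0 _ _ cF1 pF1; have bF2 := bm0 _ _ cF2 pF2.
  have bZ1 : bmeas (fun x => (s *: c).1 * F1 x) by exact: (bmeasM (bmeas_cst _) bF1).
  have bZ2 : bmeas (fun x => (s *: c).2 * F2 x) by exact: (bmeasM (bmeas_cst _) bF2).
  rewrite (_ : dot (s *: c) c = mean (fun x => (s *: c).1 * F1 x + (s *: c).2 * F2 x)); last first.
    by rewrite (meanD bZ1 bZ2) (meanZ _ bF1) (meanZ _ bF2) -c1E -c2E.
  rewrite -meanB; last 2 first.
  - by apply: bmeasM => //; exact: (bm0 _ _ cLh pLh).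
  - exact: (bmeasD bZ1 bZ2).
  apply: mean_eq => x; rewrite ghl /F1 /F2 /b1 /b2 /dot.
  by move: (grad h x (b x)) => q; ring.
(* the mean of a positive function is positive, while it equals s |c|^2 *)
have sE : s = 1.
  case: s1 => // sN; have : 0 <= mean (fun x => grad h x (b x) * sigma x).
    by apply: mean_ge0 => x; rewrite mulr_ge0 // ltW.
  rewrite mLh sN scaleN1r (_ : dot (- c) c = - dot c c); last by rewrite /dot /=; ring.
  by rewrite oppr_ge0 leNgt dcc.
rewrite sE scale1r in ph mLh.
have dn : dot c c != 0 by rewrite gt_eqF.

(* the coordinates in which psi and h are the components orthogonal to and along c *)
pose d := (dot c c)^-1.
pose P1 x := d * (- c.2 * psi x + c.1 * h x).
pose P2 x := d * (c.1 * psi x + c.2 * h x).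
have cpsi3 := classCW cpsi.
have cP1 : classC r.+3 P1 by exact: (classCZ _ (classCD (classCZ _ cpsi3) (classCZ _ ch))).
have cP2 : classC r.+3 P2 by exact: (classCZ _ (classCD (classCZ _ cpsi3) (classCZ _ ch))).
have pP1 x k : P1 (x + lattice R k) = P1 x + k.1%:~R.
  rewrite /P1 ppsi' ph /d /dot /lattice /=; move: dn; rewrite /dot => dn'.
  by move: dn'; clear; move: (c.1) (c.2) (psi x) (h x) (k.1%:~R : R) (k.2%:~R : R) => *; field.
have pP2 x k : P2 (x + lattice R k) = P2 x + k.2%:~R.
  rewrite /P2 ppsi' ph /d /dot /lattice /=; move: dn; rewrite /dot => dn'.
  by move: dn'; clear; move: (c.1) (c.2) (psi x) (h x) (k.1%:~R : R) (k.2%:~R : R) => *; field.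
have psiE x : psi x = - c.2 * P1 x + c.1 * P2 x.
  rewrite /P1 /P2 /d /dot; move: dn; rewrite /dot => dn'.
  by move: dn'; clear; move: (c.1) (c.2) (psi x) (h x) => *; field.
have hE x : h x = c.1 * P1 x + c.2 * P2 x.
  rewrite /P1 /P2 /d /dot; move: dn; rewrite /dot => dn'.
  by move: dn'; clear; move: (c.1) (c.2) (psi x) (h x) => *; field.
have psiX t x : psi (X t x) = psi x by exact: (psi_flow HX Cpsi D1 D2).
have inj x y : P1 x = P1 y -> P2 x = P2 y -> x = y.
  move=> e1 e2; have Epsi : psi x = psi y by rewrite !psiE e1 e2.
  have Eh : h x = h y by rewrite !hE e1 e2.
  have [t Ht] := orbit _ _ Epsi; suff t0 : t = 0 by rewrite -Ht t0 (flow0 HX).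
  have [u _] := MVT_any 0 t (fun u => flow_path HX x u (classC_C1 ch)).
  rewrite Ht (flow0 HX) Eh subrr subr0 => /esym/eqP.
  by rewrite mulf_eq0 (gt_eqF (Lh _)) /= => /eqP.
pose kappa x := d * grad h x (b x).
have d0 : 0 < d by rewrite invr_gt0.
have ck : classC r.+2 kappa by exact: (classCZ _ cLh).
have pk : Z2periodic kappa by move=> x k; rewrite /kappa pLh.
have k0 x : 0 < kappa x by rewrite mulr_gt0.
have gpsi0 x : grad psi x (b x) = 0 by rewrite /grad D1 D2 /F1 /F2 /b1 /b2; ring.
have LP1 x : grad P1 x (b x) = kappa x * c.1.
  rewrite /P1 (gradCM _ _ _ (classCD (classCZ _ cpsi3) (classCZ _ ch))).
  rewrite (gradD _ _ (classCZ _ cpsi3) (classCZ _ ch)) (gradCM _ _ _ cpsi3) (gradCM _ _ _ ch).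
  by rewrite gpsi0 mulr0 add0r /kappa [c.1 * _]mulrC mulrA.
have LP2 x : grad P2 x (b x) = kappa x * c.2.
  rewrite /P2 (gradCM _ _ _ (classCD (classCZ _ cpsi3) (classCZ _ ch))).
  rewrite (gradD _ _ (classCZ _ cpsi3) (classCZ _ ch)) (gradCM _ _ _ cpsi3) (gradCM _ _ _ ch).
  by rewrite gpsi0 mulr0 add0r /kappa [c.2 * _]mulrC mulrA.
have mk : mean (fun x => kappa x * sigma x) = 1.
  rewrite (@mean_eq _ _ (fun x => d * (grad h x (b x) * sigma x))); last first.
    by move=> x; rewrite /kappa mulrA.
  rewrite meanZ; last by apply: bmeasM => //; exact: (bm0 _ _ cLh pLh).
  by rewrite mLh /d mulVf.

(* psi and h have independent gradients because h, unlike psi, varies along b *)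
have jac x : 'D_(1, 0) P1 x * 'D_(0, 1) P2 x - 'D_(0, 1) P1 x * 'D_(1, 0) P2 x != 0.
  have e1 : forall v1, grad P1 x v1 = d * (- c.2 * grad psi x v1 + c.1 * grad h x v1).
    move=> v1; rewrite /P1 (gradCM _ _ _ (classCD (classCZ _ cpsi3) (classCZ _ ch))).
    by rewrite (gradD _ _ (classCZ _ cpsi3) (classCZ _ ch)) (gradCM _ _ _ cpsi3) (gradCM _ _ _ ch).
  have e2 : forall v1, grad P2 x v1 = d * (c.1 * grad psi x v1 + c.2 * grad h x v1).
    move=> v1; rewrite /P2 (gradCM _ _ _ (classCD (classCZ _ cpsi3) (classCZ _ ch))).
    by rewrite (gradD _ _ (classCZ _ cpsi3) (classCZ _ ch)) (gradCM _ _ _ cpsi3) (gradCM _ _ _ ch).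
  have g1 f : 'D_(1, 0) f x = grad f x (1, 0) by rewrite /grad /= mulr1 mulr0 addr0.
  have g2 f : 'D_(0, 1) f x = grad f x (0, 1) by rewrite /grad /= mulr1 mulr0 add0r.
  rewrite !g1 !g2 !e1 !e2 -!g1 -!g2 D1 D2.
  rewrite (_ : _ - _ = d * (sigma x * grad h x (b x))); first by rewrite gt_eqF // !mulr_gt0.
  rewrite /grad /F1 /F2 /b1 /b2 /d /dot; move: dn; rewrite /dot => dn'.
  by move: dn'; clear; move: (c.1) (c.2) ('D_(1, 0) h x) ('D_(0, 1) h x) (b x).1 (b x).2 (sigma x) => *; field.
have [A A0 HA] := fourier_decay cP1 cP2 pP1 pP2 (classCW cs) ps jac.
(* each of the two factors 1 + j_i^2 is at most 2 P^2 *)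
pose Bd := 4 * ((A + A) / (`|c.2| * a)).
have ca0 : 0 < `|c.2| * a by rewrite mulr_gt0 // normr_gt0.
have Hdec j : j != 0 -> (`|cos_coef P1 P2 sigma j| + `|sin_coef P1 P2 sigma j|) / `|2 * pi * divisor c j| <=
  Bd * ((1 + j.1%:~R ^+ 2)^-1 * (1 + j.2%:~R ^+ 2)^-1).
  move=> j0; have [P [P0 jP1 jP2 h1 h2]] := HA j j0.
  have P1' : 1 <= P%:R :> R by rewrite ler1n.
  have Pp : 0 < P%:R :> R by rewrite ltr0n.
  have jcE : `|divisor c j| = `|c.2| * `|j.1%:~R * lambda + j.2%:~R|.
    by rewrite -normrM -lam /divisor; congr `|_|; field.
  have low : (`|c.2| * a) / P%:R ^+ m <= `|2 * pi * divisor c j|.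
    rewrite normrM jcE -mulrA (le_trans (ler_wpM2l (normr_ge0 c.2) (Ha j j0 P P0 jP1))) //.
    rewrite ler_peMl ?mulr_ge0 // normrM !ger0_norm ?pi_ge0 //.
    by rewrite (le_trans _ (ler_peMl (pi_ge0 R) (ler1n R 2))) // (le_trans _ (pi_ge2 R)) // ler1n.
  have low0 : 0 < (`|c.2| * a) / P%:R ^+ m by rewrite divr_gt0 // exprn_gt0.
  have up : `|cos_coef P1 P2 sigma j| + `|sin_coef P1 P2 sigma j| <= (A + A) / P%:R ^+ m.+4.
    by rewrite mulrDl lerD.
  have AP0 : 0 <= (A + A) / P%:R ^+ m.+4 by rewrite divr_ge0 ?addr_ge0 // exprn_ge0.
  apply: (@le_trans _ _ (((A + A) / P%:R ^+ m.+4) / ((`|c.2| * a) / P%:R ^+ m))).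
    apply: ler_pM up _; first exact: addr_ge0.
      by rewrite invr_ge0.
    by rewrite lef_pV2 ?posrE // (lt_le_trans low0 low).
  have -> : ((A + A) / P%:R ^+ m.+4) / ((`|c.2| * a) / P%:R ^+ m) = (A + A) / (`|c.2| * a) / P%:R ^+ 4.
    rewrite -[m.+4]/(4 + m)%N exprD; field.
    by rewrite ?expf_neq0 ?gt_eqF // normr_gt0.
  have q0 : 0 <= (A + A) / (`|c.2| * a) by rewrite divr_ge0 ?addr_ge0 // ltW.
  rewrite /Bd; move: ((A + A) / (`|c.2| * a)) q0 => q q0; rewrite [4 * q]mulrC -mulrA ler_wpM2l // -invfM ler_pdivlMr; last first.
    by rewrite mulr_gt0 // ltr_wpDr // sqr_ge0.
  rewrite mulrC ler_pdivrMr ?exprn_gt0 //.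
  have sq (i : int) : (`|i| <= P)%N -> (1 + i%:~R ^+ 2) <= 2 * P%:R ^+ 2 :> R.
    move=> iP; rewrite mulr_natl mulr2n lerD ?exprn_ege1 // -[i%:~R ^+ 2]real_normK ?num_real //.
    by rewrite lerXn2r ?nnegrE // -intr_norm -abszE -pmulrn ler_nat.
  have pos1 (i : int) : 0 <= 1 + i%:~R ^+ 2 :> R by rewrite addr_ge0 // sqr_ge0.
  rewrite (le_trans (ler_pM (pos1 _) (pos1 _) (sq _ jP1) (sq _ jP2))) //.
  by rewrite le_eqVlt; apply/orP; left; apply/eqP; ring.
have HF := clock_flow cP1 cP2 pP1 pP2 inj bs s0 ck pk k0 mk mL LP1 LP2 inc HX ms c0 Hdec.
set Q := 2 * (64 * Bd) + 1 in HF.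
have [M1 M10 HM1] : exists2 M, 0 <= M & forall x, `|P1 x - dot (1, 0) x| <= M.
  apply: affine_periodic_bound; first exact: (classC_cont cP1).
  by move=> x k; rewrite pP1 /dot /= mul1r mul0r addr0.
have [M2 M20 HM2] : exists2 M, 0 <= M & forall x, `|P2 x - dot (0, 1) x| <= M.
  apply: affine_periodic_bound; first exact: (classC_cont cP2).
  by move=> x k; rewrite pP2 /dot /= mul1r mul0r add0r.
exists (2 * (M1 + M2) + `|c| * Q) => t x _.
have := HF t x; set dH := clock P1 P2 c (X t x) - clock P1 P2 c x => hH.
have Q0 : 0 <= Q by exact: le_trans (normr_ge0 _) hH.
have dP1 : P1 (X t x) - P1 x = c.1 * dH.
  rewrite /dH /clock -!hE /P1 psiX /d; move: dn.
  by move: (psi x) (h x) (h (X t x)) (dot c c) => *; field.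
have dP2 : P2 (X t x) - P2 x = c.2 * dH.
  rewrite /dH /clock -!hE /P2 psiX /d; move: dn.
  by move: (psi x) (h x) (h (X t x)) (dot c c) => *; field.
have n1 := norm_fst c; have n2 := norm_snd c.
rewrite norm2_le; apply/andP; split.
  have e : (X t x - (x + t *: c)).1 = c.1 * (dH - t)
     - (P1 (X t x) - dot (1, 0) (X t x)) + (P1 x - dot (1, 0) x).
    by rewrite mulrBr -dP1 /dot /= /GRing.scale /=; ring.
  rewrite e (le_trans (ler_normD _ _)) // (le_trans (lerD (ler_normB _ _) (HM1 x))) //.
  rewrite (le_trans (lerD (lerD (normrM_le n1 hH) (HM1 (X t x))) (lexx _))) //.
  by move: M20; move: (`|c| * Q) => z; lra.
have e : (X t x - (x + t *: c)).2 = c.2 * (dH - t)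
   - (P2 (X t x) - dot (0, 1) (X t x)) + (P2 x - dot (0, 1) x).
  by rewrite mulrBr -dP2 /dot /= /GRing.scale /=; ring.
rewrite e (le_trans (ler_normD _ _)) // (le_trans (lerD (ler_normB _ _) (HM2 x))) //.
rewrite (le_trans (lerD (lerD (normrM_le n2 hH) (HM2 (X t x))) (lexx _))) //.
by move: M10; move: (`|c| * Q) => z; lra.
Qed.

End Diophantine.

(** * Sums of trigonometric series *)

Section Series.
Variable R : realType.
Implicit Types (u v a phi : nat -> R) (l : nat -> R * R) (x y : R * R).

Definition summable_series u := cvgn (series u).
Definition series_sum u : R := limn (series u).

Lemma summable_series_le u v : (forall n, `|u n| <= v n) -> summable_series v -> summable_series u.
Proof.
move=> uv cv; apply: normed_cvg.
by apply: series_le_cvg cv => n //=; exact: le_trans (normr_ge0 _) (uv n).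
Qed.

Lemma series_sum_norm_le u v : (forall n, `|u n| <= v n) -> summable_series v -> `|series_sum u| <= series_sum v.
Proof.
move=> uv cv; have cn : summable_series (fun n => `|u n|).
  by apply: summable_series_le cv => n; rewrite normr_id.
by rewrite (le_trans (lim_series_norm cn)) // lim_series_le.
Qed.

Lemma series_sum_ge0 u : (forall n, 0 <= u n) -> summable_series u -> 0 <= series_sum u.
Proof.
move=> u0 cu; apply: (le_trans (normr_ge0 (series_sum u))); apply: series_sum_norm_le cu => n.
by rewrite ger0_norm.
Qed.

Lemma summable_seriesD u v : summable_series u -> summable_series v -> summable_series (fun n => u n + v n).
Proof. by move=> cu cv; exact: is_cvg_seriesD. Qed.

Lemma series_sumD u v : summable_series u -> summable_series v -> series_sum (fun n => u n + v n) = series_sum u + series_sum v.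
Proof. by move=> cu cv; exact: lim_seriesD. Qed.

Lemma summable_seriesZ c u : summable_series u -> summable_series (fun n => c * u n).
Proof. by move=> cu; exact: is_cvg_seriesZ. Qed.

Lemma series_sumZ c u : summable_series u -> series_sum (fun n => c * u n) = c * series_sum u.
Proof. by move=> cu; exact: lim_seriesZ. Qed.

(** Term-by-term differentiation under a summable second-order remainder bound. *)
Lemma is_derive_series_sum (F : nat -> R -> R) (F' M : nat -> R) (t : R) :
  (forall s, summable_series (fun n => F n s)) -> summable_series F' -> summable_series M ->
  (forall n h, `|F n (t + h) - F n t - h * F' n| <= M n * h ^+ 2) ->
  is_derive t 1 (fun s => series_sum (fun n => F n s)) (series_sum F').
Proof.
move=> cF cF' cM H; apply/is_derive_epsP => e e0.
have M0 n : 0 <= M n.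
  by have := le_trans (normr_ge0 _) (H n 1); rewrite expr1n mulr1.
have S0 : 0 <= series_sum M by exact: series_sum_ge0.
exists (e / (series_sum M + 1)) => [|h hd]; first by rewrite divr_gt0 // ltr_wpDl.
have cN u : summable_series u -> summable_series (fun n => - u n).
  by move=> cu; rewrite (_ : (fun n => _) = (fun n => -1 * u n)); [exact: summable_seriesZ|apply/funext => n; rewrite mulN1r].
have sN u : summable_series u -> series_sum (fun n => - u n) = - series_sum u.
  by move=> cu; rewrite -mulN1r -series_sumZ //; congr series_sum; apply/funext => n; rewrite mulN1r.
have c1 := cF (t + h); have c2 := cN _ (cF t); have c3 := cN _ (summable_seriesZ (c := h) cF').
rewrite -(series_sumZ h cF') -(sN _ (cF t)) -(sN _ (summable_seriesZ (c := h) cF')) -(series_sumD c1 c2) -(series_sumD (summable_seriesD c1 c2) c3).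
have cMh : summable_series (fun n => h ^+ 2 * M n) by exact: summable_seriesZ.
rewrite (le_trans (series_sum_norm_le (v := fun n => h ^+ 2 * M n) _ cMh)) //.
  by move=> n; rewrite [X in _ <= X]mulrC.
rewrite series_sumZ // -real_normK ?num_real // expr2 -mulrA mulrC ler_wpM2r //.
rewrite ltr_pdivlMr ?ltr_wpDl // in hd.
by rewrite (le_trans _ (ltW hd)) // ler_wpM2l // lerDl.
Qed.

Lemma cos_Lip (s t : R) : `|cos t - cos s| <= `|t - s|.
Proof.
have [c _ ->] := MVT_any s t (fun z => is_derive_cos z).
by rewrite normrM ler_piMl // normrN ler_norml sin_geN1 sin_le1.
Qed.

Lemma sin_Lip (s t : R) : `|sin t - sin s| <= `|t - s|.
Proof.
have [c _ ->] := MVT_any s t (fun z => is_derive_sin z).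
by rewrite normrM ler_piMl // ler_norml cos_geN1 cos_le1.
Qed.

Lemma cos_Taylor (s h : R) : `|cos (s + h) - cos s - h * - sin s| <= h ^+ 2.
Proof.
have [c Hc ->] := MVT_any s (s + h) (fun z => is_derive_cos z).
rewrite (_ : _ - _ = h * (sin s - sin c)); last by ring.
rewrite -[h ^+ 2]real_normK ?num_real // expr2 normrM ler_wpM2l // distrC.
apply: (le_trans (sin_Lip _ _)); apply: (le_trans Hc); rewrite (_ : s + h - s = h) //; ring.
Qed.

(** Phases shift by pi/2 under differentiation, so this family is stable under partial
    derivatives. *)
Definition trig_series a l phi x := series_sum (fun n => a n * cos (dot (l n) x + phi n)).

Lemma trig_summable a l phi x : summable_series (fun n => `|a n|) ->
  summable_series (fun n => a n * cos (dot (l n) x + phi n)).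
Proof.
apply: summable_series_le => n; rewrite normrM ler_piMr // ler_norml cos_geN1 cos_le1 //.
Qed.

Lemma trig_continuous a l phi (L : nat -> R) : (forall n, 1 <= L n) -> (forall n, `|l n| <= L n) ->
  summable_series (fun n => `|a n|) -> summable_series (fun n => `|a n| * L n) -> continuous (trig_series a l phi).
Proof.
move=> L1 lL ca cL x; apply/continuous_epsP => e e0.
have S0 : 0 <= series_sum (fun n => `|a n| * L n).
  by apply: series_sum_ge0 cL => n; rewrite mulr_ge0 // (le_trans _ (L1 n)).
set S := series_sum _ in S0.
exists (e / (2 * S + 1)) => [|y yx]; first by rewrite divr_gt0 // ltr_wpDl // mulr_ge0.
rewrite ltr_pdivlMr ?ltr_wpDl ?mulr_ge0 // in yx.
apply: le_lt_trans yx; rewrite /trig_series -[X in _ - X]mul1r -mulNr -series_sumZ; last exact: trig_summable.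
rewrite -series_sumD; [|exact: trig_summable|exact/summable_seriesZ/trig_summable].
have cv : summable_series (fun n => 2 * `|y - x| * (`|a n| * L n)) by exact: summable_seriesZ.
rewrite (le_trans (series_sum_norm_le (v := fun n => 2 * `|y - x| * (`|a n| * L n)) _ cv)) //; last first.
  by rewrite series_sumZ // -/S mulrAC mulrC ler_wpM2l // lerDl.
move=> n; rewrite mulN1r -mulrBr normrM mulrCA ler_wpM2l //.
rewrite (le_trans (cos_Lip _ _)) // (_ : _ - _ = (l n).1 * (y - x).1 + (l n).2 * (y - x).2); last first.
  by rewrite /dot /=; ring.
rewrite (le_trans (ler_normD _ _)) //.
rewrite (_ : 2 * _ * _ = L n * `|y - x| + L n * `|y - x|); last by ring.
have h1 : `|(l n).1| <= L n := le_trans (norm_fst _) (lL n).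
have h2 : `|(l n).2| <= L n := le_trans (norm_snd _) (lL n).
exact: (lerD (normrM_le h1 (norm_fst _)) (normrM_le h2 (norm_snd _))).
Qed.

Lemma trig_term_derive (c d p t h : R) : `|c * cos (d * (t + h) + p) - c * cos (d * t + p) -
   h * (c * d * cos (d * t + p + pi / 2))| <= `|c| * d ^+ 2 * h ^+ 2.
Proof.
rewrite cosDpihalf.
rewrite (_ : _ - _ = c * (cos (d * t + p + d * h) - cos (d * t + p) - d * h * - sin (d * t + p))); last first.
  by rewrite (_ : d * (t + h) + p = d * t + p + d * h); ring.
by rewrite normrM -[X in _ <= X]mulrA ler_wpM2l // -exprMn cos_Taylor.
Qed.

(** Coefficients that beat every power of the frequency remain so after one more
    factor of the frequency. *)
Lemma trig_classC n l (L : nat -> R) : (forall n, 1 <= L n) -> (forall n, `|l n| <= L n) ->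
  forall a phi, (forall m, summable_series (fun n => `|a n| * L n ^+ m)) -> classC n (trig_series a l phi).
Proof.
move=> L1 lL; have L0 i : 0 <= L i by exact: le_trans (L1 i).
have step a (c : nat -> R) : (forall i, `|c i| <= L i) -> (forall m, summable_series (fun i => `|a i| * L i ^+ m)) ->
    forall m, summable_series (fun i => `|a i * c i| * L i ^+ m).
  move=> cL H m; apply: summable_series_le (H m.+1) => i.
  rewrite ger0_norm ?mulr_ge0 ?exprn_ge0 // normrM exprS mulrA ler_wpM2r ?exprn_ge0 //.
  by rewrite ler_wpM2l.
have s0 a : (forall m, summable_series (fun i => `|a i| * L i ^+ m)) -> summable_series (fun i => `|a i|).
  by move=> H; apply: summable_series_le (H 0%N) => i; rewrite normr_id expr0 mulr1.
have l1 i : `|(l i).1| <= L i := le_trans (norm_fst _) (lL i).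
have l2 i : `|(l i).2| <= L i := le_trans (norm_snd _) (lL i).
have sM a (c : nat -> R) : (forall i, `|c i| <= L i) -> (forall m, summable_series (fun i => `|a i| * L i ^+ m)) ->
    summable_series (fun i => `|a i| * c i ^+ 2).
  move=> cL H; apply: summable_series_le (H 2%N) => i.
  by rewrite normrM normr_id ler_wpM2l // normrX lerXn2r ?nnegrE.
have cT a phi : (forall m, summable_series (fun i => `|a i| * L i ^+ m)) -> continuous (trig_series a l phi).
  move=> H; have H1 : summable_series (fun i => `|a i| * L i).
    by apply: summable_series_le (H 1%N) => i; rewrite expr1 normrM normr_id (ger0_norm (L0 i)).
  move=> x; exact: (trig_continuous L1 lL (s0 a H) H1).
elim: n => [|n IH] a phi H; first by split; [exact: cT|].
apply: (@classC_intro _ _ _ (trig_series (fun i => a i * (l i).1) l (fun i => phi i + pi / 2))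
   (trig_series (fun i => a i * (l i).2) l (fun i => phi i + pi / 2))).
- exact: cT.
- move=> x; apply: slice1_derive.
  have := @is_derive_series_sum (fun i s => a i * cos (dot (l i) (s, x.2) + phi i))
    (fun i => a i * (l i).1 * cos (dot (l i) x + (phi i + pi / 2))) (fun i => `|a i| * (l i).1 ^+ 2) x.1.
  apply.
  + by move=> s; exact/trig_summable/s0.
  + by apply: trig_summable; exact/s0/step.
  + exact: sM.
  + move=> i h; have := trig_term_derive (a i) (l i).1 ((l i).2 * x.2 + phi i) x.1 h.
    by rewrite /dot /= !addrA.
- move=> x; apply: slice2_derive.
  have := @is_derive_series_sum (fun i s => a i * cos (dot (l i) (x.1, s) + phi i))
    (fun i => a i * (l i).2 * cos (dot (l i) x + (phi i + pi / 2))) (fun i => `|a i| * (l i).2 ^+ 2) x.2.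
  apply.
  + by move=> s; exact/trig_summable/s0.
  + by apply: trig_summable; exact/s0/step.
  + exact: sM.
  + move=> i h; have := trig_term_derive (a i) (l i).2 ((l i).1 * x.1 + phi i) x.2 h.
    by rewrite /dot /= !addrA ![_ + (l i).1 * x.1]addrC.
- exact: IH (step _ _ l1 H).
- exact: IH (step _ _ l2 H).
Qed.

End Series.

(** * A resonant Stepanoff flow *)

Section Stepanoff.
Variable R : realType.
Implicit Types (u v A : nat -> R) (x y : R * R).

Lemma series_le_series_sum u n : (forall i, 0 <= u i) -> summable_series u -> series u n <= series_sum u.
Proof.
move=> u0 cu; apply: nondecreasing_cvgn_le => //.
by apply: nondecreasing_series => i _ _.
Qed.

Lemma term_le_series_sum u n : (forall i, 0 <= u i) -> summable_series u -> u n <= series_sum u.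
Proof.
move=> u0 cu; apply: le_trans (series_le_series_sum n.+1 u0 cu).
by rewrite seriesSr lerDr /series /= sumr_ge0.
Qed.

(** The terms u n are bounded by constants for n < N, and the tail of the sum of the
    v n beyond N is at most d. *)
Lemma series_sum_sublinear v A (d : R) : 0 < d -> (forall n, 0 <= v n) -> (forall n, 0 <= A n) -> summable_series v ->
  exists B, forall u (s : R), 0 <= s -> (forall n, 0 <= u n <= A n) -> (forall n, u n <= v n * s) ->
    summable_series u -> series_sum u <= B + d * s.
Proof.
move=> d0 v0 A0 cv.
have [N HN] : exists N, series_sum v - series v N <= d.
  have /cvgrPdist_le /(_ _ d0) [N _ HN] : series v @ \oo --> series_sum v := cv.
  by exists N; have := HN N (leqnn N); rewrite /= => h; exact: le_trans (ler_norm _) h.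
exists (series A N) => u s s0 uA uv cu.
have H m : series u (N + m)%N <= series A N + s * (series v (N + m)%N - series v N).
  elim: m => [|m IH].
    by rewrite addn0 subrr mulr0 addr0 /series /= ler_sum // => i _; case/andP: (uA i).
  rewrite addnS !seriesSr; have := uv (N + m)%N; move: IH.
  by move: (series u _) (series v _) (series A N) (series v N) (u _) (v _) => a b c e f g *; nra.
apply: limr_le => //; exists N => // n /= Nn; rewrite -(subnKC Nn) (le_trans (H _)) // lerD2l.
rewrite mulrC ler_wpM2r // (le_trans _ HN) // lerD2r.
exact: series_le_series_sum.
Qed.

Variables (xi : R * R) (k : nat -> int * int) (e L : nat -> R).
Definition freq n : R * R := (2 * pi * (k n).1%:~R, 2 * pi * (k n).2%:~R).
Hypothesis L1 : forall n, 1 <= L n.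
Hypothesis kL : forall n, `|freq n| <= L n.
Hypothesis e0 : forall n, 0 <= e n.
Hypothesis eL : forall m, summable_series (fun n => e n * L n ^+ m).
Hypothesis e_half : series_sum e <= 1 / 2.
Let W n := dot (freq n) xi.
Hypothesis W0 : forall n, W n != 0.
Hypothesis xi0 : xi != 0.
Hypothesis resonant : forall A : R, exists n, A < e n / `|W n|.

Let e_sum : summable_series e.
Proof. by apply: summable_series_le (@eL 0%N) => n; rewrite expr0 mulr1 ger0_norm. Qed.

(** The slowness of the flow; its inverse is the speed a. *)
Let rho x := 1 + trig_series (fun n => e n * Num.sg (W n)) freq (fun=> - (pi / 2)) x.
(** The n-th term of the deviation from s of the travel time. *)
Let delay x n (s : R) := e n / `|W n| * (cos (dot (freq n) x) - cos (dot (freq n) x + W n * s)).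
(** The time at which the orbit of x reaches the point x + s xi. *)
Let time x (s : R) := s + series_sum (fun n => delay x n s).

Let Wn0 n : 0 < `|W n|. Proof. by rewrite normr_gt0. Qed.

Let sgW n : `|Num.sg (W n)| = 1.
Proof. by rewrite normr_sg W0. Qed.

Lemma rhoE x : rho x = 1 + series_sum (fun n => e n * Num.sg (W n) * sin (dot (freq n) x)).
Proof. by rewrite /rho /trig_series; congr (1 + series_sum _); apply/funext => n; rewrite cosBpihalf. Qed.

Lemma rho_term x n : `|e n * Num.sg (W n) * sin (dot (freq n) x)| <= e n.
Proof.
rewrite 2!normrM sgW mulr1 ger0_norm // ler_piMr // ler_norml sin_geN1 sin_le1 //.
Qed.

Lemma rho_bounds x : 1 / 2 <= rho x <= 3 / 2.
Proof.
have := series_sum_norm_le (rho_term x) e_sum; rewrite rhoE ler_norml; move: (series_sum _) (series_sum e) e_half => a b *.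
by apply/andP; split; lra.
Qed.

Lemma rho_classC n : classC n rho.
Proof.
apply: classCD; first exact: classC_cst.
apply: (trig_classC _ L1 kL) => m; apply: summable_series_le (@eL m) => i.
have L0 : 0 <= L i by exact: le_trans (L1 i).
by rewrite ger0_norm ?mulr_ge0 ?exprn_ge0 // normrM sgW mulr1 ger0_norm.
Qed.

Lemma rho_periodic : Z2periodic rho.
Proof.
move=> x j; rewrite !rhoE; congr (1 + series_sum _); apply/funext => n; congr (_ * _).
rewrite dotD (_ : dot (freq n) (lattice R j) = 2 * pi * ((k n).1 * j.1 + (k n).2 * j.2)%:~R) ?sin_int //.
by rewrite /dot /freq /lattice /= rmorphD !rmorphM /=; ring.
Qed.

Lemma delay_le x n (s : R) : `|delay x n s| <= e n * `|s|.
Proof.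
rewrite /delay normrM ger0_norm ?divr_ge0 // -mulrA ler_wpM2l // ler_pdivrMl //.
rewrite (le_trans (cos_Lip _ _)) // opprD addrA subrr add0r normrN normrM //.
Qed.

Lemma delay_summable x (s : R) : summable_series (fun n => delay x n s).
Proof.
apply: summable_series_le (delay_le x ^~ s) _.
by have := summable_seriesZ (c := `|s|) e_sum; congr summable_series; apply/funext => n; rewrite mulrC.
Qed.

Lemma freq_dot_le n : `|W n| <= L n * (2 * `|xi|).
Proof.
by rewrite (le_trans (dot_le _ _)) // [2 * _]mulrC -mulrA ler_wpM2r // mulr_ge0.
Qed.

(** Only differences of cosines appear in [delay], so the series converges although its
    coefficients e n / |W n| are unbounded. *)
Lemma time_derive x (s : R) : is_derive s 1 (time x) (rho (x + s *: xi)).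
Proof.
rewrite rhoE; have H : is_derive s 1 (fun s => series_sum (fun n => delay x n s))
    (series_sum (fun n => e n * Num.sg (W n) * sin (dot (freq n) (x + s *: xi)))).
  apply: (@is_derive_series_sum _ _ _ (fun n => e n * `|W n|)).
  - exact: delay_summable.
  - exact: summable_series_le (rho_term _) e_sum.
  - apply: (summable_series_le _ (summable_seriesZ (c := 2 * `|xi|) (@eL 1%N))) => n.
    rewrite expr1 normrM normr_id ger0_norm // mulrCA ler_wpM2l // mulrC freq_dot_le //.
  - move=> n h; rewrite dotD dotZ -/(W n) /delay.
    rewrite [Num.sg (W n)](_ : _ = W n / `|W n|); last first.
      by rewrite -{2}[W n]mulr_sg_norm mulfK // gt_eqF.
    rewrite (_ : _ - _ = - (e n / `|W n|) * (cos (dot (freq n) x + s * W n + W n * h) - cos (dot (freq n) x + s * W n)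
       - (W n * h) * - sin (dot (freq n) x + s * W n))); last first.
      rewrite (_ : dot (freq n) x + s * W n + W n * h = dot (freq n) x + W n * (s + h)); last by ring.
      rewrite (_ : s * W n = W n * s); last by ring.
      by ring.
    have ew : 0 <= e n / `|W n| by exact: divr_ge0.
    rewrite [`|_|]normrM [`|- _|]normrN (ger0_norm ew).
    apply: (le_trans (ler_wpM2l ew (cos_Taylor _ _))).
    rewrite exprMn -[W n ^+ 2]real_normK ?num_real //.
    rewrite le_eqVlt; apply/orP; left; apply/eqP.
    by move: (Wn0 n) => /lt0r_neq0; move: (`|W n|) => w w0; field.
by have := is_deriveD (is_derive_id s 1) H.
Qed.

Lemma time0 x : time x 0 = 0.
Proof.
rewrite /time add0r (_ : (fun n => _) = (fun n => 0 * 0)); last first.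
  by apply/funext => n; rewrite /delay mulr0 addr0 subrr mulr0 mul0r.
have c0 : summable_series (fun _ : nat => 0 : R).
  by apply: summable_series_le e_sum => n; rewrite normr0.
by rewrite (series_sumZ 0 c0) mul0r.
Qed.

Lemma time_mvt x s t : exists2 c, 1 / 2 <= c & time x t - time x s = c * (t - s).
Proof.
have [c _ E] := MVT_any s t (time_derive x).
by exists (rho (x + c *: xi)); first by case/andP: (rho_bounds (x + c *: xi)).
Qed.

Lemma time_inj x s t : time x s = time x t -> s = t.
Proof.
move=> E; have [c c0] := time_mvt x s t; rewrite E subrr => /esym/eqP.
rewrite mulf_eq0 gt_eqF ?subr_eq0; last by lra.
by move=> /= /eqP.
Qed.

Lemma time_continuous x : continuous (time x).
Proof. by move=> s; apply: is_derive_continuous (time_derive x s). Qed.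

Lemma time_surj x t : exists s, time x s = t.
Proof.
have [c c0] := time_mvt x 0 (2 * `|t|); have [d d0] := time_mvt x 0 (- (2 * `|t|)).
rewrite time0 !subr0 => E1 E2; have t0 := normr_ge0 t.
have h1 : t <= time x (2 * `|t|).
  rewrite E2; apply: le_trans (ler_norm _) _; move: t0 c0; move: (`|t|) => a *; nra.
have h2 : time x (- (2 * `|t|)) <= t.
  rewrite E1; apply: (@le_trans _ _ (- `|t|)); last by rewrite lerNl -normrN ler_norm.
  move: t0 d0; move: (`|t|) => a *; nra.
have [|||s _ Es] := @IVT R (time x) (- (2 * `|t|)) (2 * `|t|) t.
- move: t0; move: (`|t|) => a *; lra.
- by apply: continuous_subspaceT; exact: time_continuous.
- by rewrite ge_min le_max h1 h2 orbT.
by exists s.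
Qed.

(** At the origin the deviation G of the travel time is o(s) and unbounded.  The first
    fact forces the rotation vector to be xi, and then a bounded error would bound G. *)
Lemma stepanoff_no_expansion : exists a : R * R -> R, [/\ Csharp_infty a, (forall x, 0 < a x) &
     exists X : R -> R * R -> R * R,
       is_flow (fun x => a x *: xi) X /\
       ~ exists zeta : R * R -> R * R, Z2periodic zeta /\ fine_expansion X zeta].
Proof.
have rho0 x : 0 < rho x by case/andP: (rho_bounds x) => h _; apply: lt_le_trans h; lra.
exists (fun x => (rho x)^-1); split.
- move=> n; split; last by move=> x j; rewrite rho_periodic.
  by apply: classCV; [move=> x; rewrite gt_eqF|exact: rho_classC].
- by move=> x; rewrite invr_gt0.
have [S HS] : exists S : R * R -> R -> R, forall x t, time x (S x t) = t.
  by exists (fun x => projT1 (choice (time_surj x))) => x; exact: (projT2 (choice (time_surj x))).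
have TS x s : S x (time x s) = s by apply: (@time_inj x); rewrite HS.
have dS x (t : R) : is_derive t 1 (S x) (rho (x + S x t *: xi))^-1.
  rewrite -{1}[t](HS x); apply: (@is_derive_inverse _ (time x)).
  - by near=> z; rewrite TS.
  - by near=> z; exact: time_continuous.
  - exact: time_derive.
  - by rewrite gt_eqF.
exists (fun t x => x + S x t *: xi); split.
  move=> x; split; first by rewrite -{1}(time0 x) TS scale0r addr0.
  move=> t; apply: is_derive_pair => /=.
    rewrite (_ : (fun s => _) = (fun s => xi.1 * S x s + x.1)); last first.
      by apply/funext => s; rewrite /= addrC mulrC.
    apply: is_derive_trans.
  have -> : (rho (x + S x t *: xi))^-1 *: xi.1 = xi.1 *: (rho (x + S x t *: xi))^-1 by exact: mulrC.
    by have := is_deriveZ xi.1 (dS x t).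
  rewrite (_ : (fun s => _) = (fun s => xi.2 * S x s + x.2)); last first.
    by apply/funext => s; rewrite /= addrC mulrC.
  apply: is_derive_trans.
  have -> : (rho (x + S x t *: xi))^-1 *: xi.2 = xi.2 *: (rho (x + S x t *: xi))^-1 by exact: mulrC.
  by have := is_deriveZ xi.2 (dS x t).
move=> [zeta [_ [C HC]]].
pose G s := series_sum (fun n => delay 0 n s).
have FE n s : delay 0 n s = e n / `|W n| * (1 - cos (W n * s)).
  by rewrite /delay (_ : dot _ 0 = 0) ?cos0 ?add0r // /dot /= !mulr0 addr0.
have F0 n s : 0 <= delay 0 n s by rewrite FE mulr_ge0 ?divr_ge0 // subr_ge0 cos_le1.
have G0 s : 0 <= G s by exact: (series_sum_ge0 (F0 ^~ s) (@delay_summable 0 s)).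
have key s : 0 <= s -> `|s *: xi - (s + G s) *: zeta 0| <= C.
  move=> s0; have := HC (time 0 s) 0; rewrite TS !add0r; apply.
  exact: (addr_ge0 s0 (G0 s)).
have C0 : 0 <= C by apply: le_trans (normr_ge0 _) (key 0 (lexx _)).
have Gsub (d : R) : 0 < d -> exists B, forall s, 0 <= s -> G s <= B + d * s.
  (* each delay is bounded by 2 e n / |W n|, and by e n s *)
  move=> d0; have A0 n : 0 <= e n / `|W n| * 2 by rewrite mulr_ge0 ?divr_ge0.
  have [B HB] := series_sum_sublinear d0 e0 A0 e_sum; exists B => s s0.
  apply: HB => // [n|n|].
  - rewrite F0 /= FE ler_wpM2l ?divr_ge0 //.
    by rewrite -[X in _ <= X]/(1 + 1) lerD2l lerNl cos_geN1.
  - by rewrite (le_trans (ler_norm _)) // (le_trans (delay_le _ _ _)) // (ger0_norm s0).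
  - exact: delay_summable.
have zE : zeta 0 = xi.
  apply/eqP; rewrite -subr_eq0 -normr_eq0; apply/negP => /negP z0.
  have zp : 0 < `|zeta 0 - xi| by rewrite lt0r z0 normr_ge0.
  have n0 := normr_ge0 (zeta 0).
  have [|B HB] := Gsub (`|zeta 0 - xi| / (2 * (`|zeta 0| + 1))).
    by rewrite divr_gt0 // mulr_gt0 // ltr_wpDl.
  have H s : 0 <= s -> s * `|zeta 0 - xi| / 2 <= C + `|B| * `|zeta 0|.
    move=> s0; have k1 := key s s0; have g1 := HB s s0.
    have k2 : s * `|zeta 0 - xi| <= C + G s * `|zeta 0|.
      rewrite -[s in X in X <= _](ger0_norm s0) -normrZ -[G s](ger0_norm (G0 s)) -normrZ.
      rewrite -normrN (_ : - _ = (s *: xi - (s + G s) *: zeta 0) + G s *: zeta 0).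
        by rewrite (le_trans (ler_normD _ _)) // lerD2r.
      by rewrite scalerBr scalerDl opprB opprD addrA addrNK.
    have g2 : G s * `|zeta 0| <= `|B| * `|zeta 0| + s * `|zeta 0 - xi| / 2.
      apply: (@le_trans _ _ ((`|B| + `|zeta 0 - xi| / (2 * (`|zeta 0| + 1)) * s) * `|zeta 0|)).
        by rewrite ler_wpM2r // (le_trans g1) // lerD2r ler_norm.
      rewrite mulrDl lerD2l.
      rewrite (_ : _ * `|zeta 0| = s * `|zeta 0 - xi| / 2 * (`|zeta 0| / (`|zeta 0| + 1))).
        rewrite ler_piMr ?divr_ge0 ?mulr_ge0 // ler_pdivrMr ?mul1r ?lerDl // ltr_wpDl //.
      have : `|zeta 0| + 1 != 0 by rewrite gt_eqF // ltr_wpDl.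
      by move: (`|zeta 0|) (`|zeta 0 - xi|) => p q h; field.
    move: k2 g2; move: (G s * _) (`|B| * _) (s * _) => p q w *; lra.
  have D0 : 0 <= C + `|B| * `|zeta 0| by rewrite addr_ge0 ?mulr_ge0.
  move: H D0 zp; move: (C + _) (`|zeta 0 - xi|) => D w H D0 w0.
  have /H : 0 <= (2 * D + 2) / w by apply: divr_ge0; [lra|exact: ltW].
  by rewrite divfK ?gt_eqF //; lra.
have xip : 0 < `|xi| by rewrite normr_gt0.
have [n Hn] := resonant (C / `|xi|).
(* the n-th delay is maximal at this time *)
have p0 : 0 <= pi / `|W n| by rewrite divr_ge0 ?pi_ge0.
have := key _ p0; rewrite zE scalerDl opprD addrA subrr add0r normrN normrZ (ger0_norm (G0 _)).
have : e n / `|W n| <= G (pi / `|W n|).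
  apply: le_trans (term_le_series_sum n (F0 ^~ _) (@delay_summable 0 _)); rewrite FE.
  have -> : cos (W n * (pi / `|W n|)) = -1.
    have [w0|w0] := ltP 0 (W n).
      by rewrite gtr0_norm // mulrCA divff ?mulr1 ?cospi ?gt_eqF.
    have w1 : W n < 0 by rewrite lt_neqAle W0.
    by rewrite ltr0_norm // invrN mulrN mulrN mulrCA divff ?W0 // mulr1 cosN cospi.
  by rewrite opprK ler_peMr ?divr_ge0 // lerDl.
rewrite ltr_pdivrMr // in Hn; move=> h1 h2.
have := lt_le_trans Hn (le_trans (ler_wpM2r (ltW xip) h1) h2).
by rewrite ltxx.
Unshelve. all: by end_near. Qed.

End Stepanoff.

(** * The Liouville case *)

Section LiouvilleFrequencies.
Variable R : realType.

Lemma geometric_summable (c : R) : summable_series (fun n => c * 2^-1 ^+ n) /\ series_sum (fun n => c * 2^-1 ^+ n) = c * 2.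
Proof.
have h : `|2^-1 : R| < 1 by rewrite ger0_norm ?invr_ge0 // invf_lt1 // ltr1n.
have H := @cvg_geometric_series R c _ h; split; first by apply/cvg_ex; eexists; exact: H.
rewrite /series_sum (cvg_lim _ H) //; have -> : 1 - 2^-1 = 2^-1 :> R by lra.
by rewrite invrK.
Qed.

(** Approximants of order 2n + 6 make |W n| at most a constant times Q^-(2n+5), so that
    e n / |W n| is at least a constant times Q^(n+3). *)
Lemma no_fine_expansion_liouville (xi : R * R) : xi.1 ^+ 2 + xi.2 ^+ 2 = 1 -> liouville (xi.1 / xi.2) ->
   exists a : R * R -> R, [/\ Csharp_infty a, (forall x, 0 < a x) &
     exists X : R -> R * R -> R * R,
       is_flow (fun x => a x *: xi) X /\
       ~ exists zeta : R * R -> R * R, Z2periodic zeta /\ fine_expansion X zeta].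
Proof.
move=> xi1; set lambda := xi.1 / xi.2 => -[irr H].
have z0 : xi.2 != 0.
  apply/eqP => E; have := irrational_neq 0 irr (oner_neq0 _ : (1 : int) != 0).
  by rewrite mulr0z mul0r subr0 /lambda E invr0 mulr0 eqxx.
have xi2 : `|xi.2| <= 1.
  by rewrite -[_ <= 1](ler_pXn2r (n := 2)) ?nnegrE // expr1n real_normK ?num_real // -xi1 lerDr sqr_ge0.
have [pq Hpq] : exists pq : nat -> int * int, forall n, 1 < (pq n).2 /\
    0 < `|lambda - (pq n).1%:~R / (pq n).2%:~R| < (pq n).2%:~R ^- (2 * n + 6).
  have H' n : exists r : int * int, 1 < r.2 /\
    0 < `|lambda - r.1%:~R / r.2%:~R| < r.2%:~R ^- (2 * n + 6).
    by have [p [q ?]] := H (2 * n + 6)%N; exists (p, q).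
  by exists (fun n => projT1 (cid (H' n))) => n; exact: (projT2 (cid (H' n))).
pose Q n : R := (pq n).2%:~R.
pose delta n := lambda - (pq n).1%:~R / Q n.
have Q2 n : 2 <= Q n.
  by have [h _] := Hpq n; rewrite -[2]/(2%:~R) ler_int.
have Q0 n : 0 < Q n by rewrite (lt_le_trans _ (Q2 n)).
have Qn0 n : Q n != 0 by rewrite gt_eqF.
have Q1 n : 1 <= Q n by rewrite (le_trans _ (Q2 n)) // ler1n.
have dn0 n : 0 < `|delta n| by have [_ /andP[]] := Hpq n.
have dnlt n : `|delta n| < Q n ^- (2 * n + 6) by have [_ /andP[]] := Hpq n.
pose k n : int * int := ((pq n).2, - (pq n).1).
pose Lam := `|lambda| + 1.
have Lam1 : 1 <= Lam by rewrite lerDr.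
pose L n := 2 * pi * Lam * Q n.
have tp0 : 0 <= 2 * pi :> R by rewrite mulr_ge0 ?pi_ge0.
have tp1 : 1 <= 2 * pi :> R by have := pi_ge2 R; move: (pi : R) => p *; lra.
have tp8 : 2 * pi <= 8 :> R by have /andP[_] := pihalf_02 R; move: (pi : R) => p *; lra.
have L1 n : 1 <= L n.
  exact: (mulr_ege1 (mulr_ege1 tp1 Lam1) (Q1 n)).
have pE n : (pq n).1%:~R = (lambda - delta n) * Q n.
  by rewrite /delta opprB addrCA subrr addr0 divfK.
have kL n : `|freq R k n| <= L n.
  rewrite norm2_le /freq /k /=; apply/andP; split.
    rewrite normrM (ger0_norm tp0) (ger0_norm (ltW (Q0 n))) /L -mulrA ler_wpM2l // ler_peMl //.
    exact: ltW.
  rewrite mulrNz pE normrM (ger0_norm tp0) normrN normrM (ger0_norm (ltW (Q0 n))) /L -[X in _ <= X]mulrA.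
  rewrite ler_wpM2l // (ler_wpM2r (ltW (Q0 n))) // (le_trans (ler_normB _ _)) // lerD2l.
  by rewrite (le_trans (ltW (dnlt n))) // invf_le1 ?exprn_gt0 // exprn_ege1.
pose e n := Q n ^- (n + 2).
have e0 n : 0 <= e n by rewrite invr_ge0 exprn_ge0 // ltW.
have e4 n : e n <= 4^-1 * 2^-1 ^+ n.
  rewrite /e (_ : 4^-1 * _ = 2 ^- (n + 2)); last first.
    by rewrite exprD exprVn -invfM mulrC; congr (_ * _)^-1; ring.
  by rewrite lef_pV2 ?posrE ?exprn_gt0 // lerXn2r ?nnegrE // ltW.
have [c4 s4] := geometric_summable 4^-1.
have eL m : summable_series (fun n => e n * L n ^+ m).
  (* the sum takes care of the finitely many n < m, for which the power of Q n is not yet beaten *)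
  pose D := 2 ^+ m * (1 + \sum_(i < m) Q i ^+ m).
  have [cD _] := geometric_summable ((2 * pi * Lam) ^+ m * D).
  apply: summable_series_le cD => n.
  have L0 : 0 <= 2 * pi * Lam by rewrite mulr_ge0 // (le_trans _ Lam1).
  rewrite ger0_norm; last by rewrite mulr_ge0 // exprn_ge0 // (le_trans _ (L1 n)).
  rewrite /L exprMn mulrCA -[X in _ <= X]mulrA ler_wpM2l ?exprn_ge0 //.
  have S0 : 0 <= \sum_(i < m) Q i ^+ m by rewrite sumr_ge0 // => i _; rewrite exprn_ge0 // ltW.
  have [nm|mn] := ltnP n m.
    have h1 : Q n ^+ m <= 1 + \sum_(i < m) Q i ^+ m.
      rewrite (bigD1 (Ordinal nm)) //= addrCA lerDl addr_ge0 // sumr_ge0 // => i _.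
      by rewrite exprn_ge0 // ltW.
    have h2 : 1 <= 2 ^+ m * 2^-1 ^+ n :> R.
      by rewrite -(subnK (ltnW nm)) exprD -mulrA -exprMn divff ?pnatr_eq0 // expr1n mulr1 exprn_ege1 // ler1n.
    have h3 : e n <= 1 by rewrite invf_le1 ?exprn_gt0 // exprn_ege1.
    rewrite /D mulrAC; apply: ler_pM => //; first by rewrite exprn_ge0 // ltW.
    exact: le_trans h3 h2.
  rewrite /D /e mulrAC; apply: (@le_trans _ _ (2 ^+ m * 2^-1 ^+ n)); last first.
    by rewrite ler_peMr ?lerDl // mulr_ge0 ?exprn_ge0 // invr_ge0.
  have -> : Q n ^- (n + 2) * Q n ^+ m = Q n ^- (n - m + 2).
    have nE : (n + 2 = n - m + 2 + m)%N by rewrite addnAC subnK.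
    rewrite nE exprD invfM -mulrA mulVf ?mulr1 //.
    by rewrite expf_neq0.
  have -> : 2 ^+ m * 2^-1 ^+ n = 2 ^- (n - m) :> R.
    by rewrite -{1}(subnK mn) exprD mulrC -mulrA -exprMn mulVf ?pnatr_eq0 // expr1n mulr1 exprVn.
  rewrite lef_pV2 ?posrE ?exprn_gt0 // (@le_trans _ _ (Q n ^+ (n - m))) //.
    by rewrite lerXn2r ?nnegrE // ltW.
  by rewrite exprD ler_peMr ?exprn_ege1 // exprn_ge0 // ltW.
have e_half : series_sum e <= 1 / 2.
  have : `|series_sum e| <= series_sum (fun n => 4^-1 * 2^-1 ^+ n).
    by apply: series_sum_norm_le c4 => n; rewrite ger0_norm.
  rewrite s4 => h; rewrite (le_trans (ler_norm _)) // (le_trans h) //; lra.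
have WE n : dot (freq R k n) xi = 2 * pi * xi.2 * Q n * delta n.
  rewrite /dot /freq /k /= mulrNz pE /lambda -/(Q n); field.
  done.
have W0 n : dot (freq R k n) xi != 0.
  have tpn : 2 * pi != 0 :> R by rewrite gt_eqF // (lt_le_trans ltr01 tp1).
  by rewrite WE; apply: mulf_neq0 (mulf_neq0 (mulf_neq0 tpn z0) (Qn0 n)) _; rewrite -normr_gt0.
have xi0 : xi != 0 by apply: contra z0 => /eqP ->.
apply: (stepanoff_no_expansion L1 kL e0 eL e_half W0 xi0) => A.
pose n := Num.bound `|A|; exists n.
have A2 : A < 2 ^+ n.
  have h1 := archi_boundP (normr_ge0 A).
  rewrite (le_lt_trans (ler_norm A)) // (lt_trans h1) // -natrX ltr_nat ltn_expl //.
apply: (lt_le_trans A2); rewrite ler_pdivlMr ?normr_gt0 // WE.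
have QX m : 0 < Q n ^+ m by rewrite exprn_gt0.
have h8 : `|2 * pi * xi.2 * Q n * delta n| <= 2 ^+ 3 * Q n * Q n ^- (2 * n + 6).
  rewrite normrM; apply: ler_pM => //; last exact: ltW.
  rewrite normrM (ger0_norm (ltW (Q0 n))) (ler_wpM2r (ltW (Q0 n))) // normrM (ger0_norm tp0).
  rewrite (le_trans (ler_pM _ _ tp8 xi2)) // mulr1; lra.
rewrite (le_trans (ler_wpM2l _ h8)) ?exprn_ge0 // mulrA ler_pdivrMr // /e.
rewrite (_ : (2 * n + 6 = (n + 2) + (n + 4))%N); last by rewrite mul2n -addnn addnACA.
rewrite [Q n ^+ (_ + (n + 4))]exprD mulKf ?gt_eqF // exprD (exprS _ 3) [Q n * _]mulrC.
rewrite [X in X <= _]mulrA [X in _ <= X]mulrA (ler_wpM2r (ltW (Q0 n))) //.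
by apply: ler_pM; rewrite ?exprn_ge0 // lerXn2r ?nnegrE // ltW.
Qed.

End LiouvilleFrequencies.

Theorem theorem3p1 (R : realType) :
  (* the regularity required of b and sigma depends only on the
     Diophantine number lambda *)
  (forall lambda : R, diophantine lambda ->
   exists kb ksigma : nat, [/\ (2 <= kb)%N, (5 <= ksigma)%N &
     forall (b : R * R -> R * R) (sigma : R * R -> R)
            (X : R -> R * R -> R * R),
       Csharp2 kb b -> (forall x, b x != 0) -> is_flow b X ->
       Csharp ksigma sigma -> (forall x, 0 < sigma x) ->
       torus_probability sigma -> invariant_density X sigma ->
       let sb := mean2 (fun x => sigma x *: b x) in
       incommensurable sb -> sb.1 / sb.2 = lambda ->
       fine_expansion X (fun=> sb)])
  /\
  (forall xi : R * R, xi.1 ^+ 2 + xi.2 ^+ 2 = 1 -> liouville (xi.1 / xi.2) ->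
   exists a : R * R -> R, [/\ Csharp_infty a, (forall x, 0 < a x) &
     exists X : R -> R * R -> R * R,
       is_flow (fun x => a x *: xi) X /\
       ~ exists zeta : R * R -> R * R, Z2periodic zeta /\ fine_expansion X zeta]).
Proof.
split; first exact: fine_expansion_diophantine.
exact: no_fine_expansion_liouville.
Qed.
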